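(* Let $K$ be an imaginary quadratic field and $\tau\in K\cap\mathbb{H}$. Then $1/g(\tau)$ and $1/U(\tau)$ are algebraic integers.
   Context: $q=e^{2\pi i\tau}$, $q^r=e^{2\pi i r\tau}$ for rational $r$, $(a;q)_\infty=\prod_{k\ge0}(1-aq^k)$, $\eta(\tau)=q^{1/24}(q;q)_\infty$. $g(\tau)=\dfrac{\eta^2(2\tau)\eta^4(5\tau)}{\eta^4(\tau)\eta^2(10\tau)}$. $U(\tau)=I(\tau)/J(\tau)$ where $I(\tau)=q^{3/4}\dfrac{(q;q^{10})_\infty(q^9;q^{10})_\infty}{(q^4;q^{10})_\infty(q^6;q^{10})_\infty}$ and $J(\tau)=q^{1/4}\dfrac{(q^2;q^{10})_\infty(q^8;q^{10})_\infty}{(q^3;q^{10})_\infty(q^7;q^{10})_\infty}$. *)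

(* Defs.v *)
From mathcomp Require Import all_boot all_order all_algebra.
From mathcomp Require Import all_classical all_reals all_analysis.
From mathcomp Require Import complex.
Import Order.TTheory GRing.Theory Num.Theory.
Import numFieldNormedType.Exports.

Set Implicit Arguments.
Unset Strict Implicit.
Unset Printing Implicit Defensive.

Local Open Scope classical_set_scope.
Local Open Scope ring_scope.
Local Open Scope complex_scope.

Section Defs.
Variable R : realType.

Definition cexp (z : R[i]) : R[i] :=
  (expR (complex.Re z))%:C * (cos (complex.Im z) +i* sin (complex.Im z)).

(* limit of a complex sequence, taken componentwise (complex convergence is
   componentwise convergence) *)
Definition climn (u : nat -> R[i]) : R[i] :=
  (limn (fun n => complex.Re (u n))) +i* (limn (fun n => complex.Im (u n))).

Definition qpow (tau : R[i]) (r : rat) : R[i] :=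
  cexp (2%:R * (pi : R)%:C * ratr r * 'i * tau).

Definition qpoch (tau : R[i]) (k m : rat) : R[i] :=
  climn (fun N => \prod_(n < N) (1 - qpow tau (k + m * n%:R))).

Definition eta (tau : R[i]) : R[i] := qpow tau (1 / 24%:R) * qpoch tau 1 1.

Definition gfun (tau : R[i]) : R[i] :=
  (eta (2%:R * tau) ^+ 2 * eta (5%:R * tau) ^+ 4) /
  (eta tau ^+ 4 * eta (10%:R * tau) ^+ 2).

Definition Ifun (tau : R[i]) : R[i] :=
  qpow tau (3%:R / 4%:R) * (qpoch tau 1 10%:R * qpoch tau 9%:R 10%:R) /
  (qpoch tau 4%:R 10%:R * qpoch tau 6%:R 10%:R).

Definition Jfun (tau : R[i]) : R[i] :=
  qpow tau (1 / 4%:R) * (qpoch tau 2%:R 10%:R * qpoch tau 8%:R 10%:R) /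
  (qpoch tau 3%:R 10%:R * qpoch tau 7%:R 10%:R).

Definition Ufun (tau : R[i]) : R[i] := Ifun tau / Jfun tau.

Definition alg_integer (z : R[i]) : Prop :=
  exists p : {poly int}, p \is monic /\ root (map_poly intr p) z.

Definition sqrt_neg (d : int) : R[i] := 'i * (Num.sqrt (- (d%:~R : R)))%:C.

End Defs.

(* Main.v *)
Require Import Defs.
From HB Require Import structures.
From mathcomp Require Import all_boot all_order all_algebra.
From mathcomp Require Import all_classical all_reals all_analysis.
From mathcomp Require Import complex mxpoly.
From mathcomp Require Import zify ring lra.
Import Order.TTheory GRing.Theory Num.Theory.
Import numFieldNormedType.Exports.
Set Implicit Arguments.
Unset Strict Implicit.
Unset Printing Implicit Defensive.
Local Open Scope ring_scope.
Local Open Scope complex_scope.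

(* With Delta = eta^24, the 12th power of 1/g and the 24th power of 1/U are both
   quotients of values of Delta at tau, 2 tau, 5 tau and 10 tau. At a CM point sigma,
   Delta(sigma) / Delta(p sigma) and p^12 Delta(p sigma) / Delta(sigma) are algebraic
   integers, so that each of the two quotients becomes integral after multiplication
   by 2^12 and also after multiplication by 5^12, hence is integral.

   The integrality at CM points is the classical argument. The functions
   d^12 Delta(tau) / Delta((a tau + b) / d), with a d = n and 0 <= b < d, are permuted
   by the modular group and have q-expansions with algebraic integer coefficients;
   their elementary symmetric functions are therefore polynomials with integral
   coefficients in a modular function J = q^-1 + ..., and J is itself integral at CM
   points. For J one can take the sum of these functions for n = 2.

   The transformation Delta(-1/tau) = tau^12 Delta(tau) is obtained without Eisenstein
   series: an absolutely convergent product over the lattice, formed at 2- and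
   3-torsion points, is evaluated row by row with the sine product as a constant times
   eta^12 divided by an elementary factor. Expansions in q are handled without
   complex differentiation, as uniform polynomial approximations. *)

(** * Limits and infinite products of complex numbers *)

(** Both quotients of Delta values split into three ratios of the form D(k)/D(pk) or its inverse.
    Only one of the three is inverted, and so costs p^12; the splitting can be arranged so that this
    p is 2 or 5. At a CM point the difference J(tau) - J(M tau) vanishes for some M of determinant
    n, but this gives a monic equation for J(tau) only if no two leading terms cancel, that is, if n
    is not a square. Adding a multiple e of the identity to a trace-zero matrix of determinant e
    fixing tau gives the determinant e(e + 1). All function theory is reduced to one vanishing
    statement. Every orbit meets Im tau >= 1/2, where |q| <= 1/4; Cauchy's estimate on |q| = 3/4
    then halves any bound for a modular function whose expansion starts beyond the constant term.
    Taking for J a sum of Delta quotients gives integral coefficients directly from the Euler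
    product and its inverse. The lattice product yields eta^12, of weight 6 with a sign under the
    inversion; squaring removes the sign. *)

Section ComplexLimits.
Variable R : realType.
Local Notation C := R[i].
Implicit Types (z w l : C) (u v b : nat -> C).

(** Real-valued, unlike the norm of [R[i]], which lands in [R[i]]; estimates then take place in the
    ordered field [R]. *)
Definition cmod (z : C) : R := Normc.normc z.

Lemma cmod0 : cmod 0 = 0. Proof. exact: Normc.normc0. Qed.
Lemma cmod1 : cmod 1 = 1. Proof. exact: Normc.normc1. Qed.
Lemma cmodM z w : cmod (z * w) = cmod z * cmod w. Proof. exact: Normc.normcM. Qed.
Lemma cmodV z : cmod z^-1 = (cmod z)^-1. Proof. exact: Normc.normcV. Qed.
Lemma cmodN z : cmod (- z) = cmod z. Proof. exact: normcN. Qed.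
Lemma cmodD z w : cmod (z + w) <= cmod z + cmod w. Proof. exact: le_normcD. Qed.
Lemma cmod_ge0 z : 0 <= cmod z.
Proof. by case: z => a b; rewrite /cmod /= sqrtr_ge0. Qed.
Lemma cmodB z w : cmod (z - w) <= cmod z + cmod w.
Proof. by rewrite -(cmodN w) cmodD. Qed.
Lemma cmod_distC z w : cmod (z - w) = cmod (w - z).
Proof. by rewrite -cmodN opprB. Qed.
Lemma cmodB_ge z w : cmod z - cmod w <= cmod (z - w).
Proof. by rewrite lerBlDr -{1}(subrK w z) cmodD. Qed.
Lemma cmod_trans z w t : cmod (z - t) <= cmod (z - w) + cmod (w - t).
Proof. by rewrite -{1}(subrK w z) -addrA cmodD. Qed.
Lemma cmod_eq0 z : (cmod z == 0) = (z == 0).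
Proof. by apply/eqP/eqP => [/Normc.eq0_normc //|->]; rewrite cmod0. Qed.
Lemma cmod_gt0 z : (0 < cmod z) = (z != 0).
Proof. by rewrite lt_def cmod_ge0 andbT cmod_eq0. Qed.
Lemma cmodX z n : cmod (z ^+ n) = cmod z ^+ n.
Proof. by elim: n => [|n IH]; rewrite ?expr0 ?cmod1 // !exprS cmodM IH. Qed.
Lemma cmod_real (x : R) : cmod x%:C = `|x|.
Proof. by rewrite /cmod /= expr0n /= addr0 sqrtr_sqr. Qed.
Lemma cmod_nat n : cmod n%:R = n%:R.
Proof. by rewrite -(rmorph_nat (real_complex R)) cmod_real ger0_norm. Qed.
Lemma cmod_Re z : `|complex.Re z| <= cmod z.
Proof.
case: z => a b; rewrite /cmod /= -sqrtr_sqr ler_sqrt ?lerDl ?sqr_ge0 //.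
by rewrite addr_ge0 ?sqr_ge0.
Qed.
Lemma cmod_Im z : `|complex.Im z| <= cmod z.
Proof.
case: z => a b; rewrite /cmod /= -sqrtr_sqr ler_sqrt ?lerDr ?sqr_ge0 //.
by rewrite addr_ge0 ?sqr_ge0.
Qed.
Lemma cmod_i : cmod 'i%C = 1.
Proof. by rewrite /cmod /= expr0n /= add0r expr1n sqrtr1. Qed.
Lemma cmod_ReIm z : cmod z <= `|complex.Re z| + `|complex.Im z|.
Proof.
rewrite {1}(complexE z) (le_trans (cmodD _ _)) // cmodM cmod_i mul1r.
by rewrite !cmod_real.
Qed.
Lemma cmod_sum (I : Type) (s : seq I) (P : pred I) (F : I -> C) :
  cmod (\sum_(i <- s | P i) F i) <= \sum_(i <- s | P i) cmod (F i).
Proof.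
elim/big_ind2: _ => [|x x' y y' hx hy|//]; first by rewrite cmod0.
by rewrite (le_trans (cmodD _ _)) // lerD.
Qed.
(** A relation that carries the existence of the limit. The [climn] of the statement is built from
    [limn], which has a value even without convergence; [climn_clim] is the bridge. *)
Definition clim u l :=
  forall e : R, 0 < e -> exists N, forall n, (N <= n)%N -> cmod (u n - l) <= e.

Lemma clim_ext u v l : (forall n, u n = v n) -> clim u l -> clim v l.
Proof. by move=> h hu e /hu[N hN]; exists N => n /hN; rewrite h. Qed.

Lemma clim_ext_ge N0 u v l :
  (forall n, (N0 <= n)%N -> u n = v n) -> clim u l -> clim v l.
Proof.
move=> h hu e /hu[N hN]; exists (maxn N N0) => n; rewrite geq_max => /andP[h1 h2].
by rewrite -h // hN.
Qed.

Lemma clim_cst l : clim (fun=> l) l.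
Proof. by move=> e e0; exists 0%N => n _; rewrite subrr cmod0 ltW. Qed.

Lemma clim_le u l w (c : R) N :
  (forall n, (N <= n)%N -> cmod (u n - w) <= c) -> clim u l -> cmod (l - w) <= c.
Proof.
move=> h hu; apply/ler_addgt0Pr => e e0; have [N' hN'] := hu e e0.
have := hN' _ (leq_maxr N N'); have := h _ (leq_maxl N N') => h1 h2.
by rewrite (addrC c) (le_trans (cmod_trans _ (u (maxn N N')) _)) // lerD // cmod_distC.
Qed.

Lemma clim_uniq u l l' : clim u l -> clim u l' -> l = l'.
Proof.
move=> hl hl'; apply/eqP; rewrite -subr_eq0 -cmod_eq0 eq_le cmod_ge0 andbT.
apply/ler_addgt0Pr => e e0; have [N hN] := hl' e e0; rewrite add0r.
exact: (clim_le hN hl).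
Qed.

Lemma climD u v l l' : clim u l -> clim v l' -> clim (fun n => u n + v n) (l + l').
Proof.
move=> hu hv e e0; have e2 : 0 < e / 2 by rewrite divr_gt0.
have [N hN] := hu _ e2; have [N' hN'] := hv _ e2.
exists (maxn N N') => n; rewrite geq_max => /andP[h1 h2].
rewrite opprD addrACA (le_trans (cmodD _ _)) //.
by rewrite (splitr e) lerD ?hN ?hN'.
Qed.

Lemma climM u v l l' : clim u l -> clim v l' -> clim (fun n => u n * v n) (l * l').
Proof.
move=> hu hv e e0.
set A := cmod l + 1; set B := cmod l' + 1.
have A0 : 0 < A by rewrite ltr_wpDl ?cmod_ge0.
have B0 : 0 < B by rewrite ltr_wpDl ?cmod_ge0.
have [N1 hN1] := hu 1 ltr01.
have [N2 hN2] := hu (e / 2 / B) (divr_gt0 (divr_gt0 e0 (ltr0Sn _ _)) B0).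
have [N3 hN3] := hv (e / 2 / A) (divr_gt0 (divr_gt0 e0 (ltr0Sn _ _)) A0).
exists (maxn N1 (maxn N2 N3)) => n; rewrite !geq_max => /and3P[h1 h2 h3].
have hA : cmod (u n) <= A.
  by rewrite -(subrK l (u n)) (le_trans (cmodD _ _)) // addrC lerD2l hN1.
have -> : u n * v n - l * l' = u n * (v n - l') + l' * (u n - l) by ring.
rewrite (le_trans (cmodD _ _)) // !cmodM (splitr e) lerD //.
  rewrite (le_trans (ler_pM _ _ hA (hN3 _ h3))) ?cmod_ge0 //.
  by rewrite mulrC divfK ?gt_eqF.
have hB : cmod l' <= B by rewrite lerDl.
rewrite (le_trans (ler_pM _ _ hB (hN2 _ h2))) ?cmod_ge0 //.
by rewrite mulrC divfK ?gt_eqF.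
Qed.

Lemma climZ u l c : clim u l -> clim (fun n => c * u n) (c * l).
Proof. by move=> h; apply: climM => //; apply: clim_cst. Qed.

Lemma climX u l k : clim u l -> clim (fun n => u n ^+ k) (l ^+ k).
Proof.
move=> h; elim: k => [|k IH]; first exact: clim_cst.
by rewrite exprS; apply: clim_ext (climM h IH) => n; rewrite exprS.
Qed.

Lemma climV u l : l != 0 -> clim u l -> clim (fun n => (u n)^-1) l^-1.
Proof.
rewrite -cmod_gt0 => l0 hu e e0.
have [N1 hN1] := hu _ (divr_gt0 l0 (ltr0Sn R 1)).
have [N2 hN2] := hu (e * (cmod l / 2) * cmod l) (mulr_gt0 (mulr_gt0 e0 (divr_gt0 l0 (ltr0Sn _ _))) l0).
exists (maxn N1 N2) => n; rewrite geq_max => /andP[h1 h2].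
have hl : cmod l / 2 <= cmod (u n).
  have := cmodB_ge l (l - u n); rewrite subKr (cmod_distC l) => h3.
  have := hN1 _ h1; lra.
have un0 : 0 < cmod (u n) by apply: lt_le_trans hl; rewrite divr_gt0.
have -> : (u n)^-1 - l^-1 = (l - u n) / (u n * l).
  by field; rewrite -!cmod_gt0 un0 l0.
rewrite cmodM cmodV cmodM ler_pdivrMr ?mulr_gt0 // cmod_distC.
by rewrite (le_trans (hN2 _ h2)) // -mulrA ler_pM2l // ler_pM2r.
Qed.

Lemma clim_prod (I : Type) (s : seq I) (F : I -> nat -> C) (G : I -> C) :
  (forall i, clim (F i) (G i)) ->
  clim (fun n => \prod_(i <- s) F i n) (\prod_(i <- s) G i).
Proof.
move=> h; elim: s => [|i s IH].
  by rewrite big_nil; apply: clim_ext (clim_cst 1) => n; rewrite big_nil.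
by rewrite big_cons; apply: clim_ext (climM (h i) IH) => n; rewrite big_cons.
Qed.

Lemma clim_sub u l (phi : nat -> nat) :
  (forall n, (n <= phi n)%N) -> clim u l -> clim (fun n => u (phi n)) l.
Proof. by move=> h hu e /hu[N hN]; exists N => n hn; rewrite hN // (leq_trans hn). Qed.

(** Real and imaginary parts are 1-Lipschitz for [cmod], so both are Cauchy sequences in the
    complete field [R]. *)
Lemma ccauchy_clim u :
  (forall e : R, 0 < e -> exists N, forall m n, (N <= m)%N -> (N <= n)%N -> cmod (u m - u n) <= e) ->
  exists l, clim u l.
Proof.
move=> h.
have key (f : C -> R) : (forall z w, `|f z - f w| <= cmod (z - w)) ->
    exists a, forall e, 0 < e -> exists N, forall n, (N <= n)%N -> `|f (u n) - a| <= e.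
  move=> hf; have cv : cvgn (fun n => f (u n)).
    apply/cauchy_cvgP/cauchy_exP => e e0.
    have [N hN] := h (e / 2) (divr_gt0 e0 (ltr0Sn _ _)).
    exists (f (u N)); exists N => // n /= hn.
    rewrite /ball_ /= /ball /= (le_lt_trans (hf _ _)) //.
    by rewrite (le_lt_trans (hN _ _ (leqnn _) hn)) // ltr_pdivrMr // ltr_pMr // ltr1n.
  exists (limn (fun n => f (u n))) => e e0.
  move/cvgrPdist_le: cv => /(_ e e0)[N _ hN]; exists N => n hn.
  by rewrite distrC; exact: hN.
have [|a ha] := key (@complex.Re R).
  by move=> z w; rewrite -raddfB /=; exact: cmod_Re.
have [|a' ha'] := key (@complex.Im R).
  by move=> z w; rewrite -raddfB /=; exact: cmod_Im.
exists (a +i* a') => e e0; have e2 : 0 < e / 2 by rewrite divr_gt0.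
have [N hN] := ha _ e2; have [N' hN'] := ha' _ e2.
exists (maxn N N') => n; rewrite geq_max => /andP[h1 h2].
rewrite (le_trans (cmod_ReIm _)) // (splitr e) lerD //.
  by move: (hN _ h1); case: (u n).
by move: (hN' _ h2); case: (u n).
Qed.

Lemma climn_clim u l : clim u l -> climn u = l.
Proof.
move=> h.
have key (f : C -> R) : (forall z w, `|f z - f w| <= cmod (z - w)) ->
    limn (fun n => f (u n)) = f l.
  move=> hf; apply/cvg_lim => //; apply/cvgrPdist_le => e e0.
  have [N hN] := h e e0; exists N => // n /= hn.
  by rewrite distrC (le_trans (hf _ _)) ?hN.
rewrite /climn !key; first by case: (l).
  by move=> z w; rewrite -raddfB /=; exact: cmod_Im.
by move=> z w; rewrite -raddfB /=; exact: cmod_Re.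
Qed.

End ComplexLimits.

(** * Convergence of infinite products, dominated convergence, double products *)

Section InfiniteProducts.
Variable R : realType.
Local Notation C := R[i].
Implicit Types (p l : C) (b : nat -> C) (beta : nat -> R).

(** The form [expR s - 1] is stable under products, with the exponents adding ([near1M]); a bound on
    the sum of the |b_n| thus controls the product of the 1 + b_n. *)
Definition near1 p (s : R) := cmod (p - 1) <= expR s - 1.

Lemma near1_le p s : near1 p s -> cmod p <= expR s.
Proof.
rewrite /near1 => h; rewrite -(subrK 1 p) (le_trans (cmodD _ _)) // cmod1.
by rewrite -lerBrDr.
Qed.

Lemma near1M p q (s t : R) : near1 p s -> near1 q t -> near1 (p * q) (s + t).
Proof.
move=> hp hq; rewrite /near1 expRD.
have -> : p * q - 1 = p * (q - 1) + (p - 1) by ring.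
rewrite (le_trans (cmodD _ _)) // cmodM.
have -> : expR s * expR t - 1 = expR s * (expR t - 1) + (expR s - 1) by ring.
by rewrite lerD // ler_pM ?cmod_ge0 // near1_le.
Qed.

Lemma near1_1D (z : C) (s : R) : cmod z <= s -> near1 (1 + z) s.
Proof.
move=> h; rewrite /near1 addrC addKr (le_trans h) //.
by rewrite lerBrDr addrC expR_ge1Dx.
Qed.

Lemma near1_prod (I : Type) (r : seq I) (P : pred I) (F : I -> C) (s : I -> R) :
  (forall i, near1 (F i) (s i)) ->
  near1 (\prod_(i <- r | P i) F i) (\sum_(i <- r | P i) s i).
Proof.
move=> h; elim/big_ind2: _ => [|p s1 q t|i _]; last exact: h.
  by rewrite /near1 subrr cmod0 expR0 subrr.
exact: near1M.
Qed.

Lemma near1_mono p (s t : R) : s <= t -> near1 p s -> near1 p t.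
Proof. by move=> st h; rewrite /near1 (le_trans h) // lerD2r ler_expR. Qed.

Lemma expRB1_small (e : R) : 0 < e ->
  exists2 d : R, 0 < d & forall t, t <= d -> expR t - 1 <= e.
Proof.
move=> e0; have e1 : 0 < 1 + e by rewrite addr_gt0.
(* Chosen so that [1 - d = (1 + e)^-1]; the inequality [1 - t <= expR (- t)] then inverts to
   [expR t <= 1 + e]. *)
exists (e / (1 + e)); first by rewrite divr_gt0.
move=> t ht; have h : 1 - e / (1 + e) <= expR (- t).
  by rewrite (le_trans _ (expR_ge1Dx _)) // lerD2l lerN2.
have h0 : 1 - e / (1 + e) = (1 + e)^-1 by field; rewrite gt_eqF.
move: h; rewrite h0 expRN lef_pV2 ?posrE ?expR_gt0 // => h; lra.
Qed.

Definition summable beta := exists S : R, forall N, \sum_(n < N) beta n <= S.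

(** [K] is taken so that its partial sum comes within [e] of the supremum of all partial sums. *)
Lemma summable_tail beta (e : R) : (forall n, 0 <= beta n) -> summable beta -> 0 < e ->
  exists K, forall M N, (K <= M)%N -> \sum_(M <= n < N) beta n <= e.
Proof.
move=> b0 [S hS] e0.
pose A : set R := [set x | exists N, x = \sum_(n < N) beta n]%classic.
have hA : has_sup A.
  split; first by exists 0; exists 0%N; rewrite big_ord0.
  by exists S => x [N ->].
have [x [K ->] hK] := sup_adherent e0 hA.
exists K => M N KM; have [NM|MN] := leqP N M; first by rewrite big_geq // ltW.
have hN : \sum_(n < N) beta n <= sup A by apply: ub_le_sup; [exact: hA.2|exists N].
have : \sum_(n < N) beta n = \sum_(n < K) beta n + (\sum_(K <= n < M) beta n + \sum_(M <= n < N) beta n).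
  have KN : (K <= N)%N := leq_trans KM (ltnW MN).
  rewrite -!(big_mkord xpredT beta) (big_cat_nat (leq0n K) KN) /=.
  by rewrite (big_cat_nat KM (ltnW MN)).
have : 0 <= \sum_(K <= n < M) beta n by apply: sumr_ge0.
lra.
Qed.

Lemma summableZ beta (c : R) : 0 <= c -> summable beta -> summable (fun n => c * beta n).
Proof. by move=> c0 [S hS]; exists (c * S) => N; rewrite -mulr_sumr ler_wpM2l. Qed.

Lemma summable_geom (r : R) : 0 <= r < 1 -> summable (fun n => r ^+ n).
Proof.
move=> /andP[r0 r1]; exists ((1 - r)^-1) => N.
rewrite -[leRHS]mul1r ler_pdivlMr ?subr_gt0 // mulrC.
have := subrX1 r N => h; have -> : (1 - r) * (\sum_(n < N) r ^+ n) = 1 - r ^+ N.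
  by rewrite -(opprB r 1) mulNr -h opprB.
by rewrite gerBl exprn_ge0.
Qed.

Lemma summable_invsq : summable (fun n => (n.+1%:R ^+ 2)^-1).
Proof.
(* The bound [2 - 1 / N] telescopes. At [N = 0] it reads [0 <= 2], because [0^-1 = 0], so the step
   to [N = 1] is checked separately. *)
exists 2 => N; suff h : \sum_(n < N) (n.+1%:R ^+ 2 : R)^-1 <= 2 - N%:R^-1 by rewrite (le_trans h) // gerBl invr_ge0.
elim: N => [|N IH]; first by rewrite big_ord0 invr0 subr0.
rewrite big_ord_recr /=; case: N IH => [_|N IH]; first by rewrite big_ord0 add0r expr1n invr1; lra.
rewrite (le_trans (lerD IH (lexx _))) //.
have h1 : 0 < N.+1%:R :> R by [].
have -> : N.+2%:R = N.+1%:R + 1 :> R by rewrite natr1.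
move: (N.+1%:R : R) h1 => x x0.
have x1 : 0 < x + 1 by lra.
rewrite -lerBrDl -subr_ge0.
have -> : 2 - (x + 1)^-1 - (2 - x^-1) - ((x + 1) ^+ 2)^-1 = (x * (x + 1) ^+ 2)^-1 by field; rewrite !gt_eqF.
by rewrite invr_ge0 mulr_ge0 ?sqr_ge0 // ltW.
Qed.

Section OneProduct.
Variables (b : nat -> C) (beta : nat -> R).
Hypothesis hb : forall n, cmod (b n) <= beta n.

Let beta0 n : 0 <= beta n. Proof. exact: le_trans (cmod_ge0 _) (hb n). Qed.

Lemma near1_prod_nat M N : near1 (\prod_(M <= n < N) (1 + b n)) (\sum_(M <= n < N) beta n).
Proof. by apply: near1_prod => n; apply: near1_1D. Qed.

Lemma prod_ord_le (S : R) N : \sum_(n < N) beta n <= S -> cmod (\prod_(n < N) (1 + b n)) <= expR S.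
Proof.
by move=> hS; apply: near1_le; apply: near1_mono hS _; apply: near1_prod => n; apply: near1_1D.
Qed.

Lemma prod_tail (S t : R) M N : (M <= N)%N -> \sum_(n < M) beta n <= S ->
  \sum_(M <= n < N) beta n <= t ->
  cmod (\prod_(n < N) (1 + b n) - \prod_(n < M) (1 + b n)) <= expR S * (expR t - 1).
Proof.
move=> MN hS ht; rewrite -!(big_mkord xpredT (fun n => 1 + b n)) (big_cat_nat (leq0n M) MN) /=.
rewrite -{2}[\prod_(0 <= i < M) _]mulr1 -mulrBr cmodM ler_pM ?cmod_ge0 //.
  by rewrite big_mkord prod_ord_le.
by apply: near1_mono ht _; exact: near1_prod_nat.
Qed.

Lemma prod_cvg : summable beta -> exists l, clim (fun N => \prod_(n < N) (1 + b n)) l.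
Proof.
move=> sb; have [S hS] := sb; apply: ccauchy_clim => e e0.
have [d d0 hd] := expRB1_small (divr_gt0 (divr_gt0 e0 (ltr0Sn R 1)) (expR_gt0 S)).
have [K hK] := summable_tail beta0 sb d0; exists K.
have key n : (K <= n)%N -> cmod (\prod_(i < n) (1 + b i) - \prod_(i < K) (1 + b i)) <= e / 2.
  move=> Kn; rewrite (le_trans (prod_tail Kn (hS K) (hK K n (leqnn K)))) //.
  by rewrite mulrC -ler_pdivlMr ?expR_gt0 // hd.
move=> m n hm hn; rewrite (le_trans (cmod_trans _ (\prod_(i < K) (1 + b i)) _)) //.
by rewrite (splitr e) lerD ?key // cmod_distC key.
Qed.

Lemma prod_lim_tail (S t : R) M l : clim (fun N => \prod_(n < N) (1 + b n)) l ->
  \sum_(n < M) beta n <= S -> (forall N, \sum_(M <= n < N) beta n <= t) ->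
  cmod (l - \prod_(n < M) (1 + b n)) <= expR S * (expR t - 1).
Proof.
move=> hl hS ht; apply: (clim_le (N := M) _ hl) => n Mn.
exact: prod_tail.
Qed.

(** Past some [K] the remaining factors multiply to within 1/2 of 1, so the limit stays within half
    the modulus of the nonzero [K]-th partial product. *)
Lemma prod_lim_neq0 l : summable beta -> (forall n, 1 + b n != 0) ->
  clim (fun N => \prod_(n < N) (1 + b n)) l -> l != 0.
Proof.
move=> sb hn hl; have [d d0 hd] := expRB1_small (divr_gt0 ltr01 (ltr0Sn R 1)).
have [K hK] := summable_tail beta0 sb d0.
set p := \prod_(n < K) (1 + b n).
have p0 : 0 < cmod p by rewrite cmod_gt0; apply/prodf_neq0 => i _.
have : cmod (l - p) <= cmod p / 2.
  apply: (clim_le (N := K) _ hl) => n Kn.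
  rewrite /p -!(big_mkord xpredT (fun n => 1 + b n)) (big_cat_nat (leq0n K) Kn) /=.
  rewrite -{2}[\prod_(0 <= i < K) _]mulr1 -mulrBr cmodM ler_wpM2l ?cmod_ge0 //.
  apply: le_trans (near1_prod_nat K n) _.
  by rewrite (le_trans (hd _ (hK K n _))) // mul1r.
move=> h; apply/eqP => l0; move: h; rewrite l0 sub0r cmodN; lra.
Qed.

End OneProduct.

(** Tannery's theorem for products: both the factors and their number depend on [N]. A fixed head of
    [M] factors converges termwise, and [beta] makes both tails small uniformly in [N]. *)
Lemma tannery_prod (b : nat -> nat -> C) (c : nat -> C) (K : nat -> nat) beta l :
  (forall N k, (k < K N)%N -> cmod (b N k) <= beta k) -> (forall k, 0 <= beta k) ->
  summable beta ->
  (forall M, exists N0, forall N, (N0 <= N)%N -> (M <= K N)%N) ->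
  (forall k, clim (fun N => b N k) (c k)) ->
  clim (fun N => \prod_(k < N) (1 + c k)) l ->
  clim (fun N => \prod_(k < K N) (1 + b N k)) l.
Proof.
move=> hb b0 sb hK hc hl e e0; have [S hS] := sb.
have hcb k : cmod (c k) <= beta k.
  have [N0 hN0] := hK k.+1; rewrite -[c k]subr0.
  by apply: (clim_le (N := N0) _ (hc k)) => n hn; rewrite subr0 hb // hN0.
have e3 : 0 < e / 3 by rewrite divr_gt0.
have [d d0 hd] := expRB1_small (divr_gt0 e3 (expR_gt0 S)).
have [M hM] := summable_tail b0 sb d0.
have hM' N : \sum_(M <= n < N) beta n <= d by apply: hM.
have [N1 hN1] := hK M.
have hfin : clim (fun N => \prod_(k < M) (1 + b N k)) (\prod_(k < M) (1 + c k)).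
  by apply: (@clim_prod _ _ _ (fun (k : 'I_M) N => 1 + b N k)) => k; apply: climD => //; apply: clim_cst.
have [N2 hN2] := hfin _ e3.
exists (maxn N1 N2) => N; rewrite geq_max => /andP[h1 h2].
have hsm : expR S * (expR d - 1) <= e / 3 by rewrite mulrC -ler_pdivlMr ?expR_gt0 // hd.
have t1 : cmod (\prod_(k < K N) (1 + b N k) - \prod_(k < M) (1 + b N k)) <= e / 3.
  (* Padding by 0 beyond [K N] extends the domination to every [k], as [prod_tail] requires. *)
  pose b' k := if (k < K N)%N then b N k else 0.
  have hb' k : cmod (b' k) <= beta k by rewrite /b'; case: ifP => [/hb//|_]; rewrite cmod0.
  have E L : (L <= K N)%N -> \prod_(k < L) (1 + b N k) = \prod_(k < L) (1 + b' k).
    by move=> hL; apply: eq_bigr => k _; rewrite /b' (leq_trans (ltn_ord k)).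
  rewrite E // E ?hN1 // (le_trans _ hsm) //.
  by apply: (prod_tail hb'); rewrite ?hN1.
have t2 := hN2 _ h2.
have t3 : cmod (\prod_(k < M) (1 + c k) - l) <= e / 3.
  by rewrite cmod_distC (le_trans _ hsm) // (prod_lim_tail hcb hl).
apply: le_trans (cmod_trans _ (\prod_(k < M) (1 + b N k)) _) _.
have := cmod_trans (\prod_(k < M) (1 + b N k)) (\prod_(k < M) (1 + c k)) l.
lra.
Qed.

(** Under the domination by [beta m * beta n], the block m < K <= n multiplies to within
    [expR (S * tail) - 1] of 1. Square partial products and products of row limits therefore have
    the same limit. *)
Lemma double_prod (r : nat -> nat -> C) (p : nat -> C) beta l :
  (forall m n, cmod (r m n) <= beta m * beta n) -> (forall k, 0 <= beta k) ->
  summable beta ->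
  (forall m, clim (fun N => \prod_(n < N) (1 + r m n)) (p m)) ->
  clim (fun K => \prod_(m < K) p m) l ->
  clim (fun K => \prod_(m < K) \prod_(n < K) (1 + r m n)) l.
Proof.
move=> hr b0 sb hp hl e e0; have [S0 hS0] := sb.
pose S := Num.max S0 1.
have S1 : 0 < S by rewrite lt_max ltr01 orbT.
have hS N : \sum_(n < N) beta n <= S by rewrite le_max hS0.
have e2 : 0 < e / 2 by rewrite divr_gt0.
have [d d0 hd] := expRB1_small (divr_gt0 e2 (expR_gt0 (S * S))).
have [K0 hK0] := summable_tail b0 sb (divr_gt0 d0 S1).
have [K1 hK1] := hl _ e2.
exists (maxn K0 K1) => K; rewrite geq_max => /andP[h0 h1].
have near N M N' : near1 (\prod_(m < M) \prod_(N <= n < N') (1 + r m n))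
    ((\sum_(m < M) beta m) * (\sum_(N <= n < N') beta n)).
  rewrite mulr_suml; apply: near1_prod => m; rewrite mulr_sumr.
  by apply: near1_prod => n; apply: near1_1D.
have key : cmod (\prod_(m < K) p m - \prod_(m < K) \prod_(n < K) (1 + r m n)) <= e / 2.
  have hlim : clim (fun N => \prod_(m < K) \prod_(n < N) (1 + r m n)) (\prod_(m < K) p m).
    by apply: (@clim_prod _ _ _ (fun (m : 'I_K) N => \prod_(n < N) (1 + r m n))) => m.
  apply: (clim_le (N := K) _ hlim) => N KN.
  have -> : \prod_(m < K) \prod_(n < N) (1 + r m n) =
      \prod_(m < K) \prod_(n < K) (1 + r m n) * \prod_(m < K) \prod_(K <= n < N) (1 + r m n).
    rewrite -big_split; apply: eq_bigr => m _.
    by rewrite -!(big_mkord xpredT (fun n => 1 + r m n)) (big_cat_nat (leq0n K) KN).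
  rewrite -{2}[\prod_(m < K) \prod_(n < K) _]mulr1 -mulrBr cmodM.
  have a1 : cmod (\prod_(m < K) \prod_(n < K) (1 + r m n)) <= expR (S * S).
    apply: near1_le; apply: near1_mono; last first.
      have := near 0%N K K; under eq_bigr => m _ do rewrite big_mkord.
      by apply.
    by rewrite big_mkord ler_pM ?sumr_ge0.
  have a2 : cmod (\prod_(m < K) \prod_(K <= n < N) (1 + r m n) - 1) <= e / 2 / expR (S * S).
    apply: le_trans (near _ _ _) _; apply: hd.
    rewrite (le_trans (ler_pM _ _ (hS K) (hK0 K N h0))) ?sumr_ge0 //.
    by rewrite mulrC divfK // gt_eqF.
  rewrite (le_trans (ler_pM _ _ a1 a2)) ?cmod_ge0 //.
  by rewrite mulrC divfK // gt_eqF ?expR_gt0.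
rewrite (le_trans (cmod_trans _ (\prod_(m < K) p m) _)) // (splitr e) lerD ?hK1 //.
by rewrite cmod_distC.
Qed.

End InfiniteProducts.

(** * The exponential and the product formula for the sine *)

Section ComplexExponential.
Variable R : realType.
Local Notation C := R[i].
Local Notation pi := (@pi R).
Implicit Types (z w h : C).

Lemma cexpD z w : cexp (z + w) = cexp z * cexp w.
Proof.
case: z => a b; case: w => c d; rewrite /cexp /= expRD cosD sinD.
by apply/eqP; rewrite eq_complex /=; apply/andP; split; apply/eqP; ring.
Qed.

Lemma cexp0 : cexp (0 : C) = 1.
Proof. by rewrite /cexp /= expR0 cos0 sin0 mul1r. Qed.

Lemma cmod_cexp z : cmod (cexp z) = expR (complex.Re z).
Proof.
rewrite /cexp cmodM cmod_real ger0_norm ?expR_ge0 //.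
by rewrite /cmod /= cos2Dsin2 sqrtr1 mulr1.
Qed.

Lemma cexpMn z n : cexp (z *+ n) = cexp z ^+ n.
Proof. by elim: n => [|n IH]; rewrite ?mulr0n ?cexp0 // mulrS exprS cexpD IH. Qed.

Lemma sin_mvt (x : R) : exists2 t, `|t| <= `|x| & sin x = x * cos t.
Proof.
have pos (y : R) : 0 < y -> exists2 t, `|t| <= `|y| & sin y = y * cos t.
  move=> y0; have [|t] := @MVT R sin cos 0 y y0 (fun t _ => is_derive_sin t).
    by apply: continuous_subspaceT => c; exact: continuous_sin.
  rewrite in_itv /= => /andP[t0 ty]; rewrite sin0 !subr0 => ->.
  by exists t; [rewrite !gtr0_norm // ltW | rewrite mulrC].
have [x0|x0|->] := ltgtP x 0.
- have [|t ht e] := pos (- x); first by rewrite oppr_gt0.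
  exists t; first by rewrite -(normrN x).
  by rewrite -(opprK x) sinN e mulNr !opprK.
- exact: pos.
by exists 0; rewrite ?sin0 ?mul0r.
Qed.

Lemma abs_sin_le (x : R) : `|sin x| <= `|x|.
Proof. by have [t _ ->] := sin_mvt x; rewrite normrM ler_piMr // cos_max. Qed.

Lemma abs_cosB1_le (x : R) : `|cos x - 1| <= x ^+ 2 / 2.
Proof.
have -> : cos x - 1 = - (sin (x / 2) ^+ 2 *+ 2).
  have -> : cos x = cos (x / 2 *+ 2) by congr cos; rewrite mulr2n; lra.
  rewrite cos_mulr2n cos2sin2; ring.
rewrite normrN normrMn normrX mulr2n.
have := abs_sin_le (x / 2); rewrite normrM (ger0_norm (_ : 0 <= 2^-1)) //.
have := normr_ge0 (sin (x / 2)); have := normr_ge0 x.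
rewrite -(real_normK (num_real x)); nra.
Qed.

Lemma abs_sinBx_le (x : R) : `|x| <= 1 -> `|sin x - x| <= x ^+ 2 / 2.
Proof.
move=> x1; have [t ht ->] := sin_mvt x.
have -> : x * cos t - x = x * (cos t - 1) by ring.
rewrite normrM; have := abs_cosB1_le t; rewrite -(real_normK (num_real t)).
rewrite -(real_normK (num_real x)).
have := normr_ge0 (cos t - 1); have := normr_ge0 t.
have x0 := normr_ge0 x; move=> t0 c0 hc.
have h1 : `|t| ^+ 2 <= `|x| ^+ 2 by rewrite lerXn2r ?nnegrE.
have h2 : `|cos t - 1| <= `|x| ^+ 2 / 2 by lra.
by apply: le_trans h2; rewrite ler_piMl.
Qed.

Lemma expRB1x (x : R) : `|x| <= 1 / 2 -> 0 <= expR x - 1 - x <= x ^+ 2 *+ 2.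
Proof.
rewrite ler_norml => /andP[x1 x2]; apply/andP; split.
  by have := expR_ge1Dx x; lra.
have := expR_ge1Dx (- x); rewrite expRN => h.
have e0 := expR_gt0 x.
have : expR x * (1 - x) <= 1.
  by rewrite -ler_pdivlMl // mulr1.
rewrite mulr2n; nra.
Qed.

(** Obtained componentwise from real bounds on [expR], [cos] and [sin]; it stands in for the complex
    derivative of [cexp] at 0 in [cexp_lim] and [cexp_diff_lim]. *)
Lemma cexp_taylor1 h : cmod h <= 1 / 2 -> cmod (cexp h - 1 - h) <= 6 * cmod h ^+ 2.
Proof.
move=> hh; 
have := cmod_Re h; have := cmod_Im h; move: hh; set M := cmod h.
case: h @M => a b M hM; rewrite [complex.Im _]/= [complex.Re _]/= => hb ha.
rewrite (le_trans (cmod_ReIm _)) //.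
rewrite /cexp /= !mul0r !subr0 !addr0.
have /andP[r0 r1] := expRB1x (le_trans ha hM).
have c1 := abs_cosB1_le b; have s1 := abs_sinBx_le (le_trans hb (le_trans hM _)).
have {}s1 : `|sin b - b| <= b ^+ 2 / 2 by apply: s1; lra.
set E := expR a in r0 r1 *.
have E2 : `|E| <= 2.
  rewrite ger0_norm ?expR_ge0 //; move: ha hM; rewrite ler_norml => /andP[h1 h2] h3; nra.
have Ea : `|E - 1| <= 2 * `|a|.
  have -> : E - 1 = (E - 1 - a) + a by ring.
  rewrite (le_trans (ler_normD _ _)) // ger0_norm //.
  move: r1; rewrite mulr2n -(real_normK (num_real a)) => r1.
  have := normr_ge0 a; nra.
have -> : E * cos b - 1 - a = E * (cos b - 1) + (E - 1 - a) by ring.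
have -> : E * sin b - b = E * (sin b - b) + (E - 1) * b by ring.
have t1 : `|E * (cos b - 1) + (E - 1 - a)| <= b ^+ 2 + a ^+ 2 *+ 2.
  rewrite (le_trans (ler_normD _ _)) // (ger0_norm r0) lerD // normrM.
  have := normr_ge0 E; have := normr_ge0 (cos b - 1); nra.
have t2 : `|E * (sin b - b) + (E - 1) * b| <= b ^+ 2 + 2 * `|a| * `|b|.
  rewrite (le_trans (ler_normD _ _)) // !normrM lerD //.
    have := normr_ge0 E; have := normr_ge0 (sin b - b); nra.
  by rewrite ler_wpM2r.
have a0 := normr_ge0 a; have b0 := normr_ge0 b.
move: t1 t2; rewrite -(real_normK (num_real a)) -(real_normK (num_real b)) mulr2n; nra.
Qed.

Lemma cmod_subXX (z w : C) (M : R) n : 1 <= M -> cmod z <= M -> cmod w <= M ->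
  cmod (z ^+ n - w ^+ n) <= n%:R * M ^+ n * cmod (z - w).
Proof.
move=> M1 hz hw; have M0 : 0 <= M by apply: le_trans M1.
rewrite subrXX cmodM mulrC ler_wpM2r ?cmod_ge0 //.
rewrite (le_trans (cmod_sum _ _ _)) //.
rewrite (le_trans (ler_sum _ (_ : forall i, true -> _ <= M ^+ n))) //; last first.
  by rewrite sumr_const card_ord mulr_natl.
move=> i _; rewrite cmodM !cmodX.
apply: (@le_trans _ _ (M ^+ (n.-1 - i) * M ^+ i)).
  by rewrite ler_pM ?exprn_ge0 ?cmod_ge0 // lerXn2r ?nnegrE ?cmod_ge0.
by rewrite -exprD ler_weXn2l //; have := ltn_ord i; lia.
Qed.

Lemma clim_invn (u : nat -> C) (l : C) (c : R) :
  (forall n, cmod (u n - l) <= c / n.+1%:R) -> clim u l.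
Proof.
move=> h e e0; exists (Num.truncn (c / e)) => n hn; apply: le_trans (h n) _.
rewrite ler_pdivrMr // mulrC -ler_pdivrMr //.
by rewrite (le_trans (ltW (truncnS_gt _))) // ler_nat.
Qed.

(** With N = [phi n], the numbers 1 + w/N and exp(w/N) differ by O(1/N^2), and passing to N-th
    powers costs at most a factor N e^|w| by [cmod_subXX]. *)
Lemma cexp_lim w (phi : nat -> nat) : (forall n, (n < phi n)%N) ->
  clim (fun n => (1 + w / (phi n)%:R) ^+ phi n) (cexp w).
Proof.
move=> hphi.
(* Beyond [n0] the quotient w/N lies in the disc where [cexp_taylor1] applies. Before it the
   sequence is replaced by its limit, because [clim_invn] asks for a bound at every index. *)
have := @truncnS_gt R (2 * cmod w); set n0 := (Num.truncn _).+1 => hn0.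
apply: (clim_ext_ge (N0 := n0) (u := fun n => if (n0 <= n)%N then (1 + w / (phi n)%:R) ^+ phi n else cexp w)).
  by move=> n ->.
apply: (clim_invn (c := 6 * cmod w ^+ 2 * expR (cmod w))) => n.
case: ifP => hn; last first.
  by rewrite subrr cmod0 divr_ge0 ?mulr_ge0 ?exprn_ge0 ?cmod_ge0 ?expR_ge0.
set N := phi n; have nN : (n < N)%N := hphi n.
have N0 : (0 : R) < N%:R by rewrite ltr0n (leq_ltn_trans _ nN).
have N0' : (N%:R : C) != 0 by rewrite pnatr_eq0; lia.
have -> : cexp w = cexp (w / N%:R) ^+ N by rewrite -cexpMn -[_ *+ N]mulr_natr divfK.
have hw : cmod (w / N%:R) = cmod w / N%:R by rewrite cmodM cmodV cmod_nat.
have hw2 : cmod (w / N%:R) <= 1 / 2.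
  rewrite hw ler_pdivrMr //; have : n0%:R <= N%:R :> R by rewrite ler_nat (leq_trans hn) // ltnW.
  lra.
set M := expR (cmod w / N%:R).
have M1 : 1 <= M by rewrite -expR0 ler_expR divr_ge0 ?cmod_ge0.
rewrite (le_trans (cmod_subXX N M1 _ _)) //.
- by rewrite (le_trans (cmodD _ _)) // cmod1 hw expR_ge1Dx.
- by rewrite cmod_cexp /M -hw ler_expR (le_trans (ler_norm _)) // cmod_Re.
have -> : M ^+ N = expR (cmod w) by rewrite /M -expRM_natr divfK ?gt_eqF.
rewrite cmod_distC opprD addrA (le_trans (ler_wpM2l _ (cexp_taylor1 hw2))) ?mulr_ge0 ?expR_ge0 //.
rewrite hw ler_pdivlMr // [leRHS]mulrC.
have -> : N%:R * expR (cmod w) * (6 * (cmod w / N%:R) ^+ 2) = expR (cmod w) * (6 * cmod w ^+ 2) / N%:R.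
  by field; rewrite gt_eqF.
rewrite mulrAC ler_pdivrMr // ler_wpM2l ?ler_nat //.
by rewrite mulr_ge0 ?expR_ge0 // mulr_ge0 ?exprn_ge0 ?cmod_ge0.
Qed.

(** Normalized to have period 1: q is [ce tau], and its fractional powers [ce (tau / N)] are
    single-valued in [tau]. *)
Definition ce z : C := cexp (2%:R * (pi)%:C * 'i * z).

Lemma ceD z w : ce (z + w) = ce z * ce w.
Proof. by rewrite /ce mulrDr cexpD. Qed.
Lemma ce0 : ce 0 = 1.
Proof. by rewrite /ce mulr0 cexp0. Qed.
Lemma ceN z : ce (- z) = (ce z)^-1.
Proof.
have h : ce z * ce (- z) = 1 by rewrite -ceD subrr ce0.
have z0 : ce z != 0 by apply/eqP => z0; move: h; rewrite z0 mul0r => /eqP; rewrite eq_sym oner_eq0.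
by apply: (mulfI z0); rewrite h divff.
Qed.
Lemma ce_neq0 z : ce z != 0.
Proof.
have h : ce z * ce (- z) = 1 by rewrite -ceD subrr ce0.
by apply/eqP => z0; move: h; rewrite z0 mul0r => /eqP; rewrite eq_sym oner_eq0.
Qed.
Lemma ceB z w : ce (z - w) = ce z / ce w.
Proof. by rewrite ceD ceN. Qed.
Lemma ceMn z n : ce (n%:R * z) = ce z ^+ n.
Proof. by rewrite /ce -cexpMn -mulr_natl; congr cexp; ring. Qed.

Lemma ce_arg z : 2%:R * (pi)%:C * 'i * z = (- (2 * pi * complex.Im z)) +i* (2 * pi * complex.Re z).
Proof.
case: z => a b; apply/eqP; rewrite eq_complex /=.
by apply/andP; split; apply/eqP; ring.
Qed.

Lemma cmod_ce z : cmod (ce z) = expR (- (2 * pi * complex.Im z)).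
Proof. by rewrite /ce cmod_cexp ce_arg. Qed.

Lemma ce_real (t : R) : ce t%:C = cos (2 * pi * t) +i* sin (2 * pi * t).
Proof. by rewrite /ce ce_arg /cexp /= mulr0 oppr0 expR0 mul1r. Qed.

Lemma ce1 : ce 1 = 1.
Proof. by rewrite (ce_real 1) mulr1 mulr_natl cos2pi sin2pi. Qed.

Lemma ce_nat n : ce n%:R = 1.
Proof. by rewrite -[n%:R]mulr1 ceMn ce1 expr1n. Qed.

Lemma ce_half : ce 2^-1 = -1.
Proof.
have -> : (2^-1 : C) = (2^-1 : R)%:C by rewrite fmorphV rmorph_nat.
rewrite ce_real; have -> : 2 * pi * 2^-1 = pi by field.
by rewrite cospi sinpi; apply/eqP; rewrite eq_complex /= oppr0 !eqxx.
Qed.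

Lemma cmod_1Bce (t : R) : cmod (1 - ce t%:C) = 2 * `|sin (pi * t)|.
Proof.
have -> : 1 - ce t%:C = (0 +i* (-(2 * sin (pi * t)))) * ce (t / 2)%:C.
  rewrite !ce_real; have -> : 2 * pi * (t / 2) = pi * t by field.
  have -> : 2 * pi * t = pi * t *+ 2 by rewrite mulr2n; ring.
  rewrite cos_mulr2n sin_mulr2n cos2sin2; apply/eqP; rewrite eq_complex /=.
  by apply/andP; split; apply/eqP; ring.
rewrite cmodM cmod_ce /= mulr0 oppr0 expR0 mulr1.
by rewrite /cmod /= expr0n /= add0r sqrtr_sqr normrN normrM ger0_norm.
Qed.

Lemma ce_real_neq1 (t : R) : 0 < t < 1 -> ce t%:C != 1.
Proof.
move=> /andP[t0 t1]; rewrite eq_sym -subr_eq0 -cmod_eq0 cmod_1Bce.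
rewrite mulf_neq0 // normr_eq0 gt_eqF // sin_gt0_pi // mulr_gt0 ?pi_gt0 //=.
by rewrite gtr_pMr ?pi_gt0.
Qed.

(** sin x = 2 sin(x/2) cos(x/2), and sin(x/2) = (x/2) cos t with cos t >= cos(x/2); since cos x >=
    0, the square of cos(x/2) is at least 1/2. *)
Lemma sin_ge_half (x : R) : 0 <= x <= pi / 2 -> x / 2 <= sin x.
Proof.
move=> /andP[x0 x2]; have p0 := pi_gt0 R.
have [t] := sin_mvt (x / 2); rewrite normrM (ger0_norm x0) ger0_norm ?invr_ge0 // => ht e.
have c0 : cos (x / 2) <= cos t.
  rewrite -(cos_norm t) -(cos_norm (x / 2)) (ger0_norm (_ : 0 <= x / 2)); last by lra.
  have [->|ne] := eqVneq `|t| (x / 2) => //.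
  have t0 := normr_ge0 t.
  by apply: ltW; rewrite ltr_cos ?in_itv /= ?lt_neqAle ?ne //; apply/andP; split; lra.
have c1 : 0 <= cos x by apply: cos_ge0_pihalf; apply/andP; split; lra.
have ex : x = x / 2 *+ 2 by rewrite mulr2n; lra.
have c2 : 0 <= cos (x / 2) by apply: cos_ge0_pihalf; apply/andP; split; lra.
rewrite {2}ex sin_mulr2n e; move: c1; rewrite {1}ex cos_mulr2n.
rewrite mulr2n => c1.
have h1 : cos (x / 2) * cos (x / 2) <= cos (x / 2) * cos t by rewrite ler_wpM2l.
have h2 : 1 / 2 <= cos (x / 2) * cos t by move: c1; rewrite expr2; lra.
have -> : cos (x / 2) * (x / 2 * cos t) *+ 2 = x * (cos (x / 2) * cos t) by rewrite mulr2n; lra.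
have := ler_wpM2l x0 h2; lra.
Qed.

(** Keeps roots of unity away from 1 at a linear rate, which is the domination needed for the sine
    product. *)
Lemma cmod_1Bce_ge (t : R) : 0 <= t <= 1 / 2 -> 2 * t <= cmod (1 - ce t%:C).
Proof.
move=> /andP[t0 t1]; have p2 := pi_ge2 R; rewrite cmod_1Bce ler_pM2l //.
apply: le_trans (ler_norm _); apply: le_trans (sin_ge_half _); first by nra.
by apply/andP; split; nra.
Qed.

Lemma prim_root_ce N : (0 < N)%N -> N.-primitive_root (ce N%:R^-1).
Proof.
move=> N0; rewrite /primitive_root_of_unity N0 /=; apply/forallP => k; apply/eqP.
have N0' : (N%:R : C) != 0 by rewrite pnatr_eq0 -lt0n.
apply/idP/idP; rewrite unity_rootE -ceMn; last first.
  by move=> /eqP ->; rewrite divff // ce1.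
apply: contraLR => ne.
have -> : (k.+1%:R / N%:R : C) = (k.+1%:R / N%:R : R)%:C by rewrite rmorphM fmorphV !rmorph_nat.
apply: ce_real_neq1; rewrite divr_gt0 ?ltr0n // ltr_pdivrMr ?ltr0n // mul1r ltr_nat.
by rewrite ltn_neqAle ne ltn_ord.
Qed.

End ComplexExponential.

Lemma prod_subr_unity (F : fieldType) (N : nat) (x y t : F) : N.-primitive_root t -> y != 0 ->
  x ^+ N - y ^+ N = \prod_(0 <= k < N) (x - t ^+ k * y).
Proof.
move=> pt y0; have e : \prod_(0 <= k < N) (x / y - t ^+ k) = (x / y) ^+ N - 1.
  have := congr1 (fun p => p.[x / y]) (factor_Xn_sub_1 pt).
  rewrite horner_prod hornerD hornerN hornerXn -polyC1 hornerC => <-.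
  by apply: eq_bigr => k _; rewrite hornerXsubC.
have -> : x ^+ N - y ^+ N = ((x / y) ^+ N - 1) * y ^+ N.
  by rewrite mulrBl mul1r -exprMn divfK.
have -> : y ^+ N = \prod_(0 <= k < N) y by rewrite prodr_const_nat subn0.
rewrite -e -big_split /=; apply: eq_bigr => k _.
by rewrite mulrBl divfK.
Qed.

Lemma prod_1B_unity (F : fieldType) (N : nat) (t : F) : N.-primitive_root t ->
  \prod_(1 <= k < N) (1 - t ^+ k) = N%:R.
Proof.
move=> pt; have N0 := prim_order_gt0 pt; have := factor_Xn_sub_1 pt.
rewrite big_ltn // expr0 subrX1 => /(mulfI (monic_neq0 (monicXsubC _))).
move=> /(congr1 (fun p => p.[1])); rewrite horner_prod horner_sum => e.
have -> : N%:R = \sum_(i < N) ('X^i : {poly F}).[1].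
  under eq_bigr => i _ do rewrite hornerXn expr1n.
  by rewrite sumr_const card_ord.
by rewrite -e; apply: eq_bigr => k _; rewrite hornerXsubC.
Qed.

(** For the odd number N = 2K + 1, the exponents k and N - k index a root of unity and its inverse;
    their two factors will combine into one that is even in [w]. *)
Lemma prod_pair_rev (T : comNzRingType) (F : nat -> T) K :
  \prod_(1 <= k < K.*2.+1) F k = \prod_(k < K) (F k.+1 * F (K.*2 - k)%N).
Proof.
have h2 : (K.+1 <= K.*2.+1)%N by lia.
rewrite (big_cat_nat (ltn0Sn K) h2) /=.
rewrite big_split /= big_add1 /= big_mkord; congr (_ * _).
rewrite big_nat_rev /= -{1}[K.+1]add0n big_addn.
have -> : (K.*2.+1 - K.+1)%N = K by lia.
by rewrite big_mkord; apply: eq_bigr => k _; congr F; lia.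
Qed.

Section SineProduct.
Variable R : realType.
Local Notation C := R[i].
Local Notation pi := (@pi R).
Implicit Types (z w : C).

Definition twopii : C := 2%:R * pi%:C * 'i.

Lemma twopii_neq0 : twopii != 0.
Proof.
rewrite /twopii !mulf_neq0 ?pnatr_eq0 //; last first.
  by rewrite eq_complex /= oner_eq0 andbF.
by rewrite -cmod_gt0 cmod_real gtr0_norm pi_gt0.
Qed.

Section Limits.
Variable phi : nat -> nat.
Hypothesis hphi : forall n, (n < phi n)%N.

Let phi0 n : (0 : R) < (phi n)%:R. Proof. by rewrite ltr0n (leq_ltn_trans _ (hphi n)). Qed.
Let phi0C n : ((phi n)%:R : C) != 0. Proof. by rewrite -cmod_gt0 cmod_nat. Qed.

Lemma clim_invphi : clim (fun n => ((phi n)%:R : C)^-1) 0.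
Proof.
apply: (clim_invn (c := 1)) => n; rewrite subr0 cmodV cmod_nat mul1r lef_pV2 ?posrE //.
by rewrite ler_nat.
Qed.

Lemma cexp_diff_lim (h : C) : clim (fun n => (phi n)%:R * (cexp (h / (phi n)%:R) - 1)) h.
Proof.
set n0 := (Num.truncn (2 * cmod h)).+1.
apply: (clim_ext_ge (N0 := n0) (u := fun n => if (n0 <= n)%N then (phi n)%:R * (cexp (h / (phi n)%:R) - 1) else h)).
  by move=> n ->.
apply: (clim_invn (c := 6 * cmod h ^+ 2)) => n.
case: ifP => hn; last by rewrite subrr cmod0 divr_ge0 ?mulr_ge0 ?exprn_ge0 ?cmod_ge0.
have hN := phi0 n; have hNC := phi0C n.
have -> : (phi n)%:R * (cexp (h / (phi n)%:R) - 1) - h = (phi n)%:R * (cexp (h / (phi n)%:R) - 1 - h / (phi n)%:R).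
  by field.
have hh : cmod (h / (phi n)%:R) = cmod h / (phi n)%:R by rewrite cmodM cmodV cmod_nat.
have hs : cmod (h / (phi n)%:R) <= 1 / 2.
  rewrite hh ler_pdivrMr //; have : n0%:R <= (phi n)%:R :> R by rewrite ler_nat (leq_trans hn) // ltnW.
  have := truncnS_gt (2 * cmod h); rewrite -/n0; lra.
rewrite cmodM cmod_nat (le_trans (ler_wpM2l _ (cexp_taylor1 hs))) // hh.
have -> : (phi n)%:R * (6 * (cmod h / (phi n)%:R) ^+ 2) = 6 * cmod h ^+ 2 / (phi n)%:R.
  by field; rewrite gt_eqF.
by rewrite ler_wpM2l ?mulr_ge0 ?exprn_ge0 ?cmod_ge0 // lef_pV2 ?posrE // ler_nat.
Qed.

Lemma cexp_small_lim (h : C) : clim (fun n => cexp (h / (phi n)%:R)) 1.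
Proof.
have := climD (climM (cexp_diff_lim h) clim_invphi) (clim_cst 1).
rewrite mulr0 add0r; apply: clim_ext => n.
by rewrite mulrAC mulfV ?phi0C // mul1r subrK.
Qed.

End Limits.

(** Euler's derivation: with w = pi i z and N odd, (1 + w/N)^N - (1 - w/N)^N is factored over the
    N-th roots of unity. The difference tends to e^w - e^(-w); the factors, grouped in inverse
    pairs, tend to the product by [tannery_prod]. *)
Lemma sine_product z :
  clim (fun K => z * \prod_(k < K) (1 - z ^+ 2 / k.+1%:R ^+ 2))
       ((ce (z / 2) - ce (- (z / 2))) / twopii).
Proof.
pose beta (k : nat) : R := cmod z ^+ 2 * (k.+1%:R ^+ 2)^-1.
have sbeta : summable beta by apply: summableZ; [rewrite exprn_ge0 ?cmod_ge0 | exact: summable_invsq].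
have hbeta k : cmod (- (z ^+ 2 / k.+1%:R ^+ 2)) <= beta k.
  by rewrite cmodN cmodM cmodV !cmodX cmod_nat.
have [l hl] := prod_cvg hbeta sbeta.
suff -> : (ce (z / 2) - ce (- (z / 2))) / twopii = z * l by apply: climZ.
have tp0 := twopii_neq0.
pose w : C := twopii * (z / 2).
pose N (K : nat) := K.*2.+1.
have hN n : (n < N n)%N by rewrite /N; lia.
have N0 K : (0 : R) < (N K)%:R by [].
have N0C K : ((N K)%:R : C) != 0 by rewrite pnatr_eq0.
pose t K := ce (N K)%:R^-1 : C.
have pt K : (N K).-primitive_root (t K) by apply: prim_root_ce.
pose c K k := (1 + t K ^+ k) / (1 - t K ^+ k).
(* What a pair of inverse roots contributes; [c] is a cotangent up to a factor i. As N (t^k - 1)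
   tends to 2 pi i k, this term tends to -z^2 / (k+1)^2. *)
pose b K k := - ((w / (N K)%:R) * c K k.+1) ^+ 2.
have tE K k : t K ^+ k = ce (k%:R / (N K)%:R : R)%:C.
  by rewrite -ceMn; congr ce; rewrite rmorphM fmorphV !rmorph_nat.
have tE' K k : t K ^+ k = cexp (twopii * k%:R / (N K)%:R).
  by rewrite -ceMn /ce; congr cexp; rewrite /twopii; ring.
have tge K k : (k <= K)%N -> 2 * (k%:R / (N K)%:R) <= cmod (1 - t K ^+ k).
  move=> kK; rewrite tE cmod_1Bce_ge // divr_ge0 //= ler_pdivrMr ?ltr0n //.
  by rewrite mul1r mulrC ler_pdivlMr // -natrM ler_nat /N; lia.
have tne K k : (k < K)%N -> 1 - t K ^+ k.+1 != 0.
  move=> kK; rewrite -cmod_gt0; apply: lt_le_trans (tge _ _ kK).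
  by rewrite mulr_gt0 // divr_gt0 ?ltr0n.
have hb K k : (k < K)%N -> cmod (w / (N K)%:R * c K k.+1) <= cmod w / k.+1%:R.
  move=> kK; have k0 : (0 : R) < k.+1%:R by [].
  have h1 := tge _ _ kK; have h2 : cmod (1 + t K ^+ k.+1) <= 2.
    by rewrite (le_trans (cmodD _ _)) // cmod1 tE cmod_ce /= mulr0 oppr0 expR0.
  have h3 : 0 < cmod (1 - t K ^+ k.+1) by rewrite cmod_gt0 tne.
  have h4 : cmod (1 + t K ^+ k.+1) / cmod (1 - t K ^+ k.+1) <= (N K)%:R / k.+1%:R.
    rewrite ler_pdivrMr // mulrAC ler_pdivlMr //.
    move: h1; rewrite mulrA ler_pdivrMr // [leRHS]mulrC; apply: le_trans.
    by rewrite ler_wpM2r // ltW.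
  rewrite /c (cmodM (w / _)) (cmodM w) (cmodV (N K)%:R) cmod_nat (cmodM (1 + _)) (cmodV (1 - _)).
  apply: le_trans (ler_wpM2l _ h4) _; first by rewrite divr_ge0 ?cmod_ge0 // ltW.
  by rewrite mulrA divfK // gt_eqF.
have hT : clim (fun K => \prod_(k < K) (1 + b K k)) l.
  apply: (tannery_prod (beta := fun k => cmod w ^+ 2 * (k.+1%:R ^+ 2)^-1) _ _ _ _ _ hl).
  - move=> K k kK; rewrite /b cmodN cmodX -exprVn -exprMn lerXn2r ?nnegrE ?cmod_ge0 ?hb //.
    by rewrite mulr_ge0 ?cmod_ge0.
  - by move=> k; rewrite mulr_ge0 ?exprn_ge0 ?cmod_ge0 ?invr_ge0 ?exprn_ge0.
  - by apply: summableZ; [rewrite exprn_ge0 ?cmod_ge0 | exact: summable_invsq].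
  - by move=> M; exists M.
  move=> k; have k0 : (k.+1%:R : C) != 0 by rewrite pnatr_eq0.
  have d0 : twopii * k.+1%:R != 0 by rewrite mulf_neq0.
  have h1 := climV d0 (cexp_diff_lim hN (twopii * k.+1%:R)).
  have h2 := climD (clim_cst 1) (cexp_small_lim hN (twopii * k.+1%:R)).
  have := climZ (-1) (climX 2 (climM (climZ (- w) h2) h1)).
  have -> : -1 * (- w * (1 + 1) * (twopii * k.+1%:R)^-1) ^+ 2 = - (z ^+ 2 / k.+1%:R ^+ 2).
    rewrite /w; move: (k.+1%:R : C) twopii k0 tp0 => x p x0 p0.
    by field; rewrite x0 p0.
  apply: (clim_ext_ge (N0 := k.+1)) => K kK; rewrite mulN1r /b -tE'; congr (- (_ ^+ 2)).
  rewrite /c; have := tne _ _ kK; move: (t K ^+ k.+1) => u u0.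
  have u1 : u - 1 != 0 by rewrite -oppr_eq0 opprB.
  by field; rewrite u0 N0C u1.
have hpow : clim (fun K => (1 + w / (N K)%:R) ^+ N K - (1 - w / (N K)%:R) ^+ N K) (cexp w - cexp (- w)).
  apply: climD; first exact: cexp_lim.
  rewrite -mulN1r; apply: clim_ext (climZ (-1) (cexp_lim (- w) hN)) => K.
  by rewrite mulN1r mulNr.
have hfac : clim (fun K => (1 + w / (N K)%:R) ^+ N K - (1 - w / (N K)%:R) ^+ N K) (2 * w * l).
  have := truncnS_gt (cmod w); set n0 := (Num.truncn _).+1 => hn0.
  apply: (clim_ext_ge (N0 := n0)) (climZ (2 * w) hT) => K hK.
  have y0 : 1 - w / (N K)%:R != 0.
    apply/eqP => /(congr1 (fun u => cmod (1 - u))); rewrite subKr subr0 cmod1 cmodM cmodV cmod_nat.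
    have : cmod w / (N K)%:R < 1.
      by rewrite ltr_pdivrMr // mul1r (lt_le_trans hn0) // ler_nat (leq_trans hK) // ltnW.
    by move=> lt1 e1; rewrite e1 ltxx in lt1.
  (* The factor at exponent 0 is 2w/N; its denominator cancels against the N coming from
     [prod_1B_unity]. *)
  rewrite (prod_subr_unity _ (pt K) y0) big_ltn // expr0.
  have -> : \prod_(1 <= k < N K) (1 + w / (N K)%:R - t K ^+ k * (1 - w / (N K)%:R)) =
     (N K)%:R * \prod_(k < K) (1 + b K k).
    transitivity (\prod_(1 <= k < N K) (1 - t K ^+ k) * \prod_(k < K) (1 + b K k)); last first.
      by rewrite (prod_1B_unity (pt K)).
    rewrite !prod_pair_rev -big_split /=; apply: eq_bigr => k _.
    have kK := ltn_ord k.
    have tN : t K ^+ k.+1 * t K ^+ (K.*2 - k) = 1.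
      rewrite -exprD; have -> : (k.+1 + (K.*2 - k) = N K)%N by rewrite /N; lia.
      exact: prim_expr_order.
    have := tne _ _ kK; rewrite /b /c; move: tN; move: (t K ^+ k.+1) (t K ^+ (K.*2 - k)) => u v uv u1.
    have u0 : u != 0 by apply/eqP => u0; move: uv; rewrite u0 mul0r => /eqP; rewrite eq_sym oner_eq0.
    have -> : v = u^-1 by apply: (mulfI u0); rewrite uv divff.
    by field; rewrite u0 u1 N0C.
  move: (\prod_(k < K) (1 + b K k)) (N0C K); move: (N K)%:R => n p n1.
  by field.
have := clim_uniq hpow hfac.
have -> : ce (z / 2) = cexp w by [].
have -> : ce (- (z / 2)) = cexp (- w) by rewrite /ce mulrN.
by move=> ->; rewrite /w; field.
Qed.

End SineProduct.

(** * The inversion formula for the discriminant *)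

Section TorsionCombination.
Variable F : fieldType.
Implicit Types (t : F) (g h : F -> F).

(** Each nonzero class of 2-torsion counts twice, the last one through two representatives; [tors3]
    takes each nonzero class of 3-torsion once up to sign. In [comb] the degrees are 6 and 3 * 4 =
    12, which is the origin of the weight 6. *)
Definition tors2 t g := (g 2^-1 * g (t / 2)) ^+ 2 * g ((1 + t) / 2) * g ((1 - t) / 2).
Definition tors3 t g := g 3^-1 * g (t / 3) * g ((1 + t) / 3) * g ((1 - t) / 3).
Definition comb t g := tors2 t g / tors3 t g ^+ 3.

Lemma eq_comb t g h : g =1 h -> comb t g = comb t h.
Proof. by move=> e; rewrite /comb /tors2 /tors3 !e. Qed.

Lemma comb1 t : comb t (fun=> 1) = 1.
Proof. by rewrite /comb /tors2 /tors3 !(mulr1, expr1n) divr1. Qed.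

Lemma combM t g h : comb t (fun z => g z * h z) = comb t g * comb t h.
Proof. by rewrite /comb /tors2 /tors3 !exprMn !invfM; ring. Qed.

Lemma combV t g : comb t (fun z => (g z)^-1) = (comb t g)^-1.
Proof. by rewrite /comb /tors2 /tors3 -!invfM !exprVn -!invfM. Qed.

Lemma comb_prod t (n : nat) (g : nat -> F -> F) :
  comb t (fun z => \prod_(i < n) g i z) = \prod_(i < n) comb t (g i).
Proof.
elim: n => [|n IH].
  rewrite big_ord0; transitivity (comb t (fun=> 1)); last exact: comb1.
  by apply: eq_comb => z; rewrite big_ord0.
rewrite big_ord_recr /= -IH -combM; apply: eq_comb => z.
by rewrite big_ord_recr.
Qed.

(* The zeros and poles of [comb t] sit at 2- and 3-torsion points of the lattice
   spanned by [1] and [t], with weights such that [Rtors t w = 1 + O(w^-4)]: the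
   product over the lattice then converges absolutely and may be rearranged. *)
Definition Rtors t (w : F) := comb t (fun z => 1 - z ^+ 2 / w ^+ 2).

Lemma Rtors_even t w : Rtors t (- w) = Rtors t w.
Proof. by rewrite /Rtors sqrrN. Qed.

Lemma Rtors_inv t w : 2 != 0 :> F -> 3 != 0 :> F -> t != 0 -> w != 0 ->
  Rtors (- t^-1) (w / t) = Rtors t w.
Proof.
move=> c2 c3 t0 w0; rewrite /Rtors /comb /tors2 /tors3.
have e1 (a b : F) : a ^+ 2 = (b / t) ^+ 2 -> 1 - a ^+ 2 / (w / t) ^+ 2 = 1 - b ^+ 2 / w ^+ 2.
  by move=> ->; field; rewrite t0 w0.
rewrite (e1 2^-1 (t / 2)); last by field; rewrite t0 c2.
rewrite (e1 (- t^-1 / 2) 2^-1); last by field; rewrite t0 c2.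
rewrite (e1 ((1 + - t^-1) / 2) ((1 - t) / 2)); last by field; rewrite t0 c2.
rewrite (e1 ((1 - - t^-1) / 2) ((1 + t) / 2)); last by field; rewrite t0 c2.
rewrite (e1 3^-1 (t / 3)); last by field; rewrite t0 c3.
rewrite (e1 (- t^-1 / 3) 3^-1); last by field; rewrite t0 c3.
rewrite (e1 ((1 + - t^-1) / 3) ((1 - t) / 3)); last by field; rewrite t0 c3.
rewrite (e1 ((1 - - t^-1) / 3) ((1 + t) / 3)); last by field; rewrite t0 c3.
by congr (_ / _ ^+ 3); ring.
Qed.

(** The degree 6 - 12 turns the scaling of the torsion points by [t^-1] into [t ^+ 6]. The sign is
    picked up by [(1 - t) / 2] in [tors2]; the two sign changes in [tors3] cancel. *)
Lemma comb_id_inv t : 2 != 0 :> F -> 3 != 0 :> F -> t != 0 -> 1 - t ^+ 2 != 0 ->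
  comb (- t^-1) id = - t ^+ 6 * comb t id.
Proof.
move=> c2 c3 t0; have -> : 1 - t ^+ 2 = (1 - t) * (1 + t) by ring.
rewrite mulf_eq0 negb_or => /andP[t1 t2].
have t1' : t - 1 != 0 by rewrite -oppr_eq0 opprB.
have t2' : t + 1 != 0 by rewrite addrC.
rewrite /comb /tors2 /tors3.
by field; rewrite ?c2 ?c3 ?t0 ?t1 ?t2 ?t1' ?t2' //= oppr_eq0 oner_eq0.
Qed.

(** 1 + q^m = (1 - q^(2m)) / (1 - q^m), and the odd exponents fill the gaps between the even ones.
    The boundary factor comes from the shift between [2 * m + 3] and [2 * m + 1]. [prod_T3] is the
    analogue modulo 3. *)
Lemma prod_T2 (q : F) K : (forall n, 1 - q ^+ n.+1 != 0) ->
  \prod_(m < K) ((1 + q ^+ m.+1) ^+ 2 * (1 - q ^+ (2 * m + 3)) * (1 - q ^+ (2 * m + 1))) =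
  ((\prod_(m < 2 * K) (1 - q ^+ m.+1)) / \prod_(m < K) (1 - q ^+ m.+1)) ^+ 2 * (1 - q ^+ (2 * K).+1) / (1 - q).
Proof.
move=> h; elim: K => [|K IH].
  by rewrite !big_ord0 invr1 mulr1 expr1n mul1r expr1 divff // -[q in 1 - q]expr1 h.
have P0 n : \prod_(m < n) (1 - q ^+ m.+1) != 0 by apply/prodf_neq0 => i _.
rewrite big_ord_recr /= IH.
have -> : (2 * K.+1 = (2 * K).+2)%N by lia.
rewrite !big_ord_recr /=.
have := h (2 * K)%N; have := P0 K; have := h K; have := h 0%N; rewrite expr1.
have -> : (2 * K + 3 = (2 * K).+3)%N by lia.
have -> : (2 * K + 1 = (2 * K).+1)%N by lia.
have -> : 1 - q ^+ (2 * K).+2 = (1 - q ^+ K.+1) * (1 + q ^+ K.+1).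
  have -> : ((2 * K).+2 = K.+1 + K.+1)%N by lia.
  by rewrite exprD; ring.
move: (1 - q ^+ (2 * K).+3) (1 - q ^+ (2 * K).+1) (\prod_(m < K) _) (\prod_(i < 2 * K) _) (1 - q) => a b c d e.
move: (q ^+ K.+1) => x e0 x0 c0 b0.
by field; rewrite ?e0 ?x0 ?c0 ?b0.
Qed.

Lemma prod_T3 (q : F) K : (forall n, 1 - q ^+ n.+1 != 0) ->
  \prod_(m < K) ((1 + q ^+ m.+1 + q ^+ m.+1 ^+ 2) * (1 - q ^+ (3 * m + 4)) * (1 - q ^+ (3 * m + 2))) =
  ((\prod_(m < 3 * K) (1 - q ^+ m.+1)) / \prod_(m < K) (1 - q ^+ m.+1)) * (1 - q ^+ (3 * K).+1) / (1 - q).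
Proof.
move=> h; elim: K => [|K IH].
  by rewrite !big_ord0 invr1 mulr1 mul1r expr1 divff // -[q in 1 - q]expr1 h.
have P0 n : \prod_(m < n) (1 - q ^+ m.+1) != 0 by apply/prodf_neq0 => i _.
rewrite big_ord_recr /= IH.
have -> : (3 * K.+1 = (3 * K).+3)%N by lia.
rewrite !big_ord_recr /=.
have := P0 K; have := h K; have := h 0%N; rewrite expr1.
have -> : (3 * K + 4 = (3 * K).+4)%N by lia.
have -> : (3 * K + 2 = (3 * K).+2)%N by lia.
have -> : 1 - q ^+ (3 * K).+3 = (1 - q ^+ K.+1) * (1 + q ^+ K.+1 + q ^+ K.+1 ^+ 2).
  have -> : ((3 * K).+3 = K.+1 + K.+1 + K.+1)%N by lia.
  by rewrite !exprD; ring.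
move: (1 - q ^+ (3 * K).+4) (1 - q ^+ (3 * K).+2) (1 - q ^+ (3 * K).+1) (\prod_(m < K) _) (\prod_(i < 3 * K) _) (1 - q) => a b b' c d e.
move: (q ^+ K.+1) => x e0 x0 c0.
by field; rewrite ?e0 ?x0 ?c0.
Qed.

(* Row of the lattice product: [Q = q^m], [v2 = q^(1/2)], [v3 = q^(1/3)] and
   [w] is a primitive cube root of unity. *)
Lemma comb_row (Q q v2 v3 w : F) : v2 != 0 -> v3 != 0 -> w != 0 -> 1 - Q != 0 ->
  v2 ^+ 2 = q -> v3 ^+ 3 = q -> 1 + w + w ^+ 2 = 0 ->
  let g u := (1 - Q * u) * (1 - Q / u) / (1 - Q) ^+ 2 in
  (g (-1) * g v2) ^+ 2 * g (- v2) * g (- v2^-1) /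
    (g w * g v3 * g (w * v3) * g (w / v3)) ^+ 3 =
  (1 - Q) ^+ 12 * ((1 + Q) ^+ 2 * (1 - Q ^+ 2 * q) * (1 - Q ^+ 2 / q)) ^+ 2
    / ((1 + Q + Q ^+ 2) * (1 - Q ^+ 3 * q) * (1 - Q ^+ 3 / q)) ^+ 3.
Proof.
move=> v20 v30 w0 Q0 h2 h3 hw g.
have hw3 : w ^+ 3 = 1.
  apply/eqP; rewrite -subr_eq0; have -> : w ^+ 3 - 1 = (w - 1) * (1 + w + w ^+ 2) by ring.
  by rewrite hw mulr0.
have ew : w ^+ 2 = - 1 - w by apply/eqP; rewrite -subr_eq0 -hw; apply/eqP; ring.
have wV : w^-1 = w ^+ 2 by apply: (mulfI w0); rewrite divff // -exprS.
have key (x : F) : (1 - x) * (1 - x * w) * (1 - x / w) = 1 - x ^+ 3.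
  have -> : (1 - x) * (1 - x * w) * (1 - x / w) = (1 - x) * (1 - x * (w + w^-1) + x ^+ 2 * (w / w)) by ring.
  rewrite divff // wV ew; ring.
have q0 : q != 0 by rewrite -h2 expf_neq0.
have N2 : (g (-1) * g v2) ^+ 2 * g (- v2) * g (- v2^-1) =
   ((1 + Q) ^+ 2 * (1 - Q ^+ 2 * q) * (1 - Q ^+ 2 / q)) ^+ 2 / (1 - Q) ^+ 12.
  have -> : g (-1) = (1 + Q) ^+ 2 / (1 - Q) ^+ 2 by rewrite /g invrN1; ring.
  have -> : g (- v2) = (1 + Q * v2) * (1 + Q / v2) / (1 - Q) ^+ 2 by rewrite /g invrN; ring.
  have -> : g (- v2^-1) = (1 + Q * v2) * (1 + Q / v2) / (1 - Q) ^+ 2.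
    by rewrite /g invrN invrK; ring.
  by rewrite /g -h2; field; rewrite ?v20 ?Q0.
have N3 : g w * g v3 * g (w * v3) * g (w / v3) =
   ((1 + Q + Q ^+ 2) * (1 - Q ^+ 3 * q) * (1 - Q ^+ 3 / q)) / (1 - Q) ^+ 8.
  have -> : g w * g v3 * g (w * v3) * g (w / v3) =
    ((1 - Q * w) * (1 - Q / w)) *
    ((1 - Q * v3) * (1 - (Q * v3) * w) * (1 - (Q * v3) / w)) *
    ((1 - Q / v3) * (1 - (Q / v3) * w) * (1 - (Q / v3) / w)) / (1 - Q) ^+ 8.
    by rewrite /g; field; rewrite v30 w0 Q0.
  rewrite !key !expr_div_n !exprMn h3; congr (_ * _ * _ / _).
  have -> : (1 - Q * w) * (1 - Q / w) = 1 - Q * (w + w^-1) + Q ^+ 2 * (w / w) by ring.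
  rewrite divff // wV ew; ring.
rewrite N2 N3 expr_div_n invf_div -exprM.
have -> : (1 - Q) ^+ (8 * 3) = (1 - Q) ^+ 12 * (1 - Q) ^+ 12 by rewrite -exprD.
move: ((1 - Q) ^+ 12) (expf_neq0 12 Q0) (_ ^+ 2) ((_ ^+ 3)^-1) => d d0 a b.
by field.
Qed.

End TorsionCombination.

(** * Absolute convergence of the product over the lattice *)

Section LatticeBounds.
Variable R : realType.
Local Notation C := R[i].
Variable tau : C.
Hypothesis tau_im : 0 < complex.Im tau.

(** The imaginary part controls [x], and then [y] is a difference of two controlled terms. *)
Lemma lattice_lower : exists2 c : R, 0 < c &
  forall x y : R, c * (`|x| + `|y|) <= cmod (x%:C * tau + y%:C).
Proof.
set I := complex.Im tau; have I0 : 0 < I := tau_im.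
have K0 : 0 < I^-1 + 1 + cmod tau / I.
  by rewrite ltr_wpDr ?divr_ge0 ?cmod_ge0 ?(ltW I0) // addr_gt0 ?invr_gt0.
exists (I^-1 + 1 + cmod tau / I)^-1; first by rewrite invr_gt0.
move=> x y; rewrite mulrC ler_pdivrMr //.
set w := x%:C * tau + y%:C.
have hx : `|x| <= cmod w / I.
  rewrite ler_pdivlMr // -[X in _ * X](gtr0_norm I0) -normrM.
  have -> : x * I = complex.Im w by rewrite /w /I; case: (tau) => a b /=; ring.
  exact: cmod_Im.
have hy : `|y| <= cmod w + `|x| * cmod tau.
  rewrite -cmod_real -(cmod_real x) -cmodM.
  have -> : y%:C = w - x%:C * tau by rewrite /w addrC addKr.
  exact: cmodB.
have := ler_wpM2r (cmod_ge0 tau) hx; move: hx hy.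
rewrite !mulrDr mulr1 mulrA [cmod w / I * cmod tau]mulrAC; lra.
Qed.

Lemma lattice_upper (x y : R) : cmod (x%:C * tau + y%:C) <= (1 + cmod tau) * (`|x| + `|y|).
Proof.
rewrite (le_trans (cmodD _ _)) // cmodM !cmod_real.
have := cmod_ge0 tau; have := normr_ge0 x; have := normr_ge0 y; nra.
Qed.

Lemma int_dist (m : int) (a : R) : `|a| <= 1 / 2 -> `|m%:~R| / 2 <= `|m%:~R - a|.
Proof.
move=> ha; have [->|m0] := eqVneq m 0; first by rewrite normr0 mul0r.
have m1 : 1 <= `|m%:~R : R| by rewrite -intr_norm ler1z; lia.
have := ler_distD (m%:~R : R) 0 a; have := lerB_dist (m%:~R : R) a; lra.
Qed.

(** 1 - z^2/w^2 = (w - z)(w + z)/w^2, and coordinates of [z] at most 1/2 keep it away from every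
    nonzero lattice point ([int_dist]). The bound is uniform because such factors occur in the
    denominator of [Rtors]. *)
Lemma lattice_factor_lower : exists2 d : R, 0 < d &
  forall (a b : R) (m n : int), `|a| <= 1 / 2 -> `|b| <= 1 / 2 -> (m != 0) || (n != 0) ->
  d <= cmod (1 - (a%:C * tau + b%:C) ^+ 2 / (m%:~R * tau + n%:~R) ^+ 2).
Proof.
have [c c0 hc] := lattice_lower.
set K := 1 + cmod tau; have K0 : 0 < K by rewrite ltr_wpDr ?cmod_ge0.
exists ((c / 2 / K) ^+ 2) => [|a b m n ha hb mn].
  by rewrite exprn_gt0 // divr_gt0 // divr_gt0.
set w := m%:~R * tau + n%:~R; set z := a%:C * tau + b%:C.
have cI (k : int) : (k%:~R : C) = (k%:~R : R)%:C by rewrite rmorph_int.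
set S := `|m%:~R : R| + `|n%:~R : R|.
have S0 : 0 < S.
  case/orP: mn => h; first by rewrite ltr_wpDr // normr_gt0 intr_eq0.
  by rewrite ltr_wpDl // normr_gt0 intr_eq0.
have hw : cmod w <= K * S by rewrite /w !cI lattice_upper.
have w0 : 0 < cmod w by rewrite /w !cI (lt_le_trans _ (hc _ _)) // mulr_gt0.
have h1 : c / 2 * S <= cmod (w - z).
  have -> : w - z = (m%:~R - a)%:C * tau + (n%:~R - b)%:C.
    by rewrite /w /z !cI !rmorphB /=; ring.
  apply: le_trans (hc _ _); rewrite -mulrA ler_wpM2l ?(ltW c0) //.
  have := int_dist m ha; have := int_dist n hb; rewrite /S; lra.
have h2 : c / 2 * S <= cmod (w + z).
  have -> : w + z = (m%:~R - (- a))%:C * tau + (n%:~R - (- b))%:C.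
    by rewrite /w /z !cI !rmorphB !rmorphN /=; ring.
  apply: le_trans (hc _ _); rewrite -mulrA ler_wpM2l ?(ltW c0) //.
  rewrite -normrN in ha; rewrite -normrN in hb.
  have := int_dist m ha; have := int_dist n hb; rewrite /S; lra.
have wn0 : w != 0 by rewrite -cmod_gt0.
have -> : 1 - z ^+ 2 / w ^+ 2 = (w - z) / w * ((w + z) / w) by field.
have key x : c / 2 * S <= x -> c / 2 / K <= x / cmod w.
  move=> hx; rewrite ler_pdivlMr //; apply: le_trans hx.
  rewrite mulrAC ler_pdivrMr // -(mulrA (c / 2) S K) ler_wpM2l ?divr_ge0 ?(ltW c0) //.
  by rewrite (mulrC S).
have p0 : 0 <= c / 2 / K by rewrite divr_ge0 ?divr_ge0 ?(ltW c0) ?(ltW K0).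
by rewrite cmodM !(cmodM _ w^-1) !cmodV expr2 ler_pM ?key.
Qed.

Lemma prod_1B_expand (s : seq C) (T : R) : 0 <= T -> exists2 M : R, 0 <= M &
  forall t : C, cmod t <= T ->
  cmod (\prod_(c <- s) (1 - c * t) - (1 - (\sum_(c <- s) c) * t)) <= M * cmod t ^+ 2.
Proof.
move=> T0; elim: s => [|c s [M M0 IH]].
  by exists 0 => // t _; rewrite !big_nil mul0r subr0 subrr cmod0 mul0r.
exists ((1 + cmod c * T) * M + cmod c * cmod (\sum_(c <- s) c)).
  by rewrite addr_ge0 ?mulr_ge0 ?addr_ge0 ?mulr_ge0 ?cmod_ge0.
move=> t ht; rewrite !big_cons; have := IH t ht.
move: (\prod_(_ <- s) _) (\sum_(_ <- s) _) => P S h.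
have -> : (1 - c * t) * P - (1 - (c + S) * t) = (1 - c * t) * (P - (1 - S * t)) + c * S * t ^+ 2 by ring.
rewrite (le_trans (cmodD _ _)) // [leRHS]mulrDl (cmodM (1 - c * t)) (cmodM (c * S)) (cmodM c) cmodX lerD //.
rewrite -mulrA ler_pM ?cmod_ge0 //.
by rewrite (le_trans (cmodB _ _)) // cmod1 cmodM lerD2l ler_wpM2l ?cmod_ge0.
Qed.

Definition tors2_list : seq C :=
  [:: 2^-1; tau / 2; 2^-1; tau / 2; (1 + tau) / 2; (1 - tau) / 2].
Definition tors3_list : seq C := [:: 3^-1; tau / 3; (1 + tau) / 3; (1 - tau) / 3].

Lemma tors2E (g : C -> C) : tors2 tau g = \prod_(z <- tors2_list) g z.
Proof. by rewrite /tors2 !big_cons big_nil mulr1 expr2 !mulrA. Qed.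
Lemma tors3E (g : C -> C) : tors3 tau g = \prod_(z <- tors3_list) g z.
Proof. by rewrite /tors3 !big_cons big_nil mulr1 !mulrA. Qed.

Lemma tors_listP z : z \in tors2_list ++ tors3_list ->
  exists a b : R, [/\ `|a| <= 1 / 2, `|b| <= 1 / 2 & z = a%:C * tau + b%:C].
Proof.
have E (n : nat) : (n%:R^-1 : C) = (n%:R^-1 : R)%:C by rewrite fmorphV rmorph_nat.
have E' (n : nat) : (- n%:R^-1 : C) = (- n%:R^-1 : R)%:C by rewrite rmorphN /= -E.
have n2 : `|2^-1 : R| <= 1 / 2 by rewrite ger0_norm //; lra.
have n2' : `|- 2^-1 : R| <= 1 / 2 by rewrite normrN.
have n3 : `|3^-1 : R| <= 1 / 2 by rewrite ger0_norm //; lra.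
have n3' : `|- 3^-1 : R| <= 1 / 2 by rewrite normrN.
have n0 : `|0 : R| <= 1 / 2 by rewrite normr0.
rewrite mem_cat !inE => /orP[|].
  case/or4P => [/eqP->|/eqP->|/eqP->|/or3P[/eqP->|/eqP->|/eqP->]].
  - by exists 0, 2^-1; split => //; rewrite -E mul0r add0r.
  - by exists 2^-1, 0; split => //; rewrite -E mulrC addr0.
  - by exists 0, 2^-1; split => //; rewrite -E mul0r add0r.
  - by exists 2^-1, 0; split => //; rewrite -E mulrC addr0.
  - by exists 2^-1, 2^-1; split => //; rewrite -E; ring.
  - by exists (- 2^-1), 2^-1; split => //; rewrite -E -E'; ring.
case/or4P => /eqP->.
- by exists 0, 3^-1; split => //; rewrite -E mul0r add0r.
- by exists 3^-1, 0; split => //; rewrite -E mulrC addr0.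
- by exists 3^-1, 3^-1; split => //; rewrite -E; ring.
- by exists (- 3^-1), 3^-1; split => //; rewrite -E -E'; ring.
Qed.

(** In t = w^-2, numerator and denominator are both 1 - s t + O(t^2), where s is the weighted sum of
    squares of the torsion points; [eS] says that s is the same for both, namely 1 + tau^2. The
    linear terms cancel. *)
Lemma Rtors_bound : exists2 K : R, 0 <= K &
  forall m n : int, (m != 0) || (n != 0) ->
    Rtors tau (m%:~R * tau + n%:~R) != 0 /\
    cmod (Rtors tau (m%:~R * tau + n%:~R) - 1) <= K / (`|m%:~R| + `|n%:~R|) ^+ 4.
Proof.
have [c c0 hc] := lattice_lower.
have [d d0 hd] := lattice_factor_lower.
set T := (c ^+ 2)^-1; have T0 : 0 <= T by rewrite invr_ge0 exprn_ge0 ?(ltW c0).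
set sA := [seq z ^+ 2 | z <- tors2_list].
set l3 := tors3_list ++ tors3_list ++ tors3_list.
set sB := [seq z ^+ 2 | z <- l3].
have [M1 M10 h1] := prod_1B_expand sA T0; have [M2 M20 h2] := prod_1B_expand sB T0.
have eS : \sum_(c <- sA) c = \sum_(c <- sB) c.
  by rewrite /sA /sB /l3 /= !big_cons !big_nil; field.
exists ((M1 + M2) / d ^+ 12 / c ^+ 4).
  by rewrite !divr_ge0 ?exprn_ge0 ?addr_ge0 ?(ltW c0) ?(ltW d0).
move=> m n mn; set w := m%:~R * tau + n%:~R.
set S := `|m%:~R : R| + `|n%:~R : R|.
have S1 : 1 <= S.
  case/orP: mn => h; first by rewrite ler_wpDr // -intr_norm ler1z; lia.
  by rewrite ler_wpDl // -intr_norm ler1z; lia.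
have hw : c * S <= cmod w.
  have cI (k : int) : (k%:~R : C) = (k%:~R : R)%:C by rewrite rmorph_int.
  by rewrite /w !cI hc.
have w0 : 0 < cmod w by apply: lt_le_trans hw; rewrite mulr_gt0 // (lt_le_trans ltr01).
pose t := (w ^+ 2)^-1.
have ht : cmod t <= (c ^+ 2)^-1 / S ^+ 2.
  rewrite /t cmodV cmodX -invfM lef_pV2 ?posrE ?exprn_gt0 ?mulr_gt0 ?exprn_gt0 // ?(lt_le_trans ltr01) //.
  by rewrite -exprMn lerXn2r ?nnegrE ?mulr_ge0 ?cmod_ge0 ?(ltW c0) // (le_trans ler01).
have htT : cmod t <= T.
  rewrite (le_trans ht) // ler_piMr // invf_le1 ?exprn_ege1 // exprn_gt0 // (lt_le_trans ltr01) //.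
pose g z := 1 - z ^+ 2 / w ^+ 2.
have hg z : z \in tors2_list ++ tors3_list -> d <= cmod (g z).
  by move=> /tors_listP[a [b [ha hb ->]]]; apply: hd.
have eA : tors2 tau g = \prod_(c <- sA) (1 - c * t).
  by rewrite tors2E big_map.
have eB : tors3 tau g ^+ 3 = \prod_(c <- sB) (1 - c * t).
  by rewrite tors3E big_map /l3 !big_cat /= !exprS expr0 mulr1.
have g0 z : z \in tors2_list ++ tors3_list -> g z != 0.
  by move=> /hg h; rewrite -cmod_gt0 (lt_le_trans d0).
have B0 : d ^+ 12 <= cmod (tors3 tau g ^+ 3).
  rewrite cmodX (_ : 12 = 4 * 3)%N // exprM lerXn2r ?nnegrE ?exprn_ge0 ?cmod_ge0 ?(ltW d0) //.
  rewrite /tors3 !cmodM !exprS expr0 mulr1 !mulrA.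
  have in3 z : z \in tors3_list -> d <= cmod (g z) by move=> hz; rewrite hg // mem_cat hz orbT.
  by rewrite !ler_pM ?mulr_ge0 ?cmod_ge0 ?(ltW d0) ?in3 // !inE eqxx ?orbT.
have B1 : tors3 tau g ^+ 3 != 0 by rewrite -cmod_gt0 (lt_le_trans _ B0) // exprn_gt0.
have -> : Rtors tau w = tors2 tau g / tors3 tau g ^+ 3 by [].
split.
  rewrite mulf_neq0 ?invr_eq0 // tors2E; rewrite prodf_seq_neq0; apply/allP.
  by move=> z hz; rewrite /= g0 // mem_cat hz.
have -> : tors2 tau g / tors3 tau g ^+ 3 - 1 = (tors2 tau g - tors3 tau g ^+ 3) / tors3 tau g ^+ 3 by rewrite mulrBl divff.
rewrite cmodM cmodV ler_pdivrMr ?cmod_gt0 //.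
apply: (@le_trans _ _ ((M1 + M2) * cmod t ^+ 2)).
  rewrite eA eB mulrDl (le_trans (cmod_trans _ (1 - (\sum_(c <- sA) c) * t) _)) // lerD ?h1 //.
  by rewrite cmod_distC eS h2.
have ht2 : cmod t ^+ 2 <= (c ^+ 4)^-1 / S ^+ 4.
  have -> : (c ^+ 4)^-1 / S ^+ 4 = ((c ^+ 2)^-1 / S ^+ 2) ^+ 2.
    by rewrite expr_div_n exprVn -!exprM.
  by rewrite lerXn2r ?nnegrE ?cmod_ge0 // (le_trans (cmod_ge0 t)).
apply: (@le_trans _ _ ((M1 + M2) / d ^+ 12 / c ^+ 4 / S ^+ 4 * d ^+ 12)); last first.
  rewrite ler_wpM2l // !divr_ge0 ?exprn_ge0 ?addr_ge0 ?(ltW c0) ?(ltW d0) // (le_trans ler01) //.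
have -> : (M1 + M2) / d ^+ 12 / c ^+ 4 / S ^+ 4 * d ^+ 12 = (M1 + M2) * ((c ^+ 4)^-1 / S ^+ 4).
  have d12 : d ^+ 12 != 0 by rewrite expf_neq0 // gt_eqF.
  by rewrite mulrAC [_ / c ^+ 4 * _]mulrAC divfK // -mulrA.
by rewrite ler_wpM2l // addr_ge0.
Qed.

End LatticeBounds.

(** * Evaluation of the lattice product by rows and the transformation of eta^12 *)

Section EtaInversion.
Variable R : realType.
Local Notation C := R[i].
Implicit Types (tau z q : C).

Definition qprod q K : C := \prod_(m < K) (1 - q ^+ m.+1).
Definition euler q : C := climn (qprod q).

Lemma qprod_bound q : cmod q < 1 -> forall n, cmod (- q ^+ n.+1) <= cmod q * cmod q ^+ n.
Proof. by move=> q1 n; rewrite cmodN cmodX exprS. Qed.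

Lemma qprod_summable q : cmod q < 1 -> summable (fun n => cmod q * cmod q ^+ n).
Proof.
by move=> q1; apply: summableZ; [exact: cmod_ge0|apply: summable_geom; rewrite cmod_ge0].
Qed.

Lemma one_sub_neq0 q : cmod q < 1 -> 1 - q != 0.
Proof.
move=> q1; apply/eqP => /eqP; rewrite subr_eq0 => /eqP e.
by move: q1; rewrite -e cmod1 ltxx.
Qed.

Lemma one_subX_neq0 q n : cmod q < 1 -> 1 - q ^+ n.+1 != 0.
Proof.
by move=> q1; apply: one_sub_neq0; rewrite cmodX exprn_ilt1 ?cmod_ge0.
Qed.

Lemma euler_lim q : cmod q < 1 -> clim (qprod q) (euler q).
Proof.
move=> q1; have [l hl] := prod_cvg (qprod_bound q1) (qprod_summable q1).
by rewrite /euler (climn_clim hl).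
Qed.

Lemma euler_neq0 q : cmod q < 1 -> euler q != 0.
Proof.
move=> q1; apply: (prod_lim_neq0 (qprod_bound q1) (qprod_summable q1)); last exact: euler_lim.
by move=> n; rewrite one_subX_neq0.
Qed.

Lemma clim_geom q (phi : nat -> nat) : cmod q < 1 -> (forall n, (n <= phi n)%N) ->
  clim (fun n => q ^+ phi n) 0.
Proof.
move=> q1 hphi; apply: (clim_sub (u := fun n => q ^+ n) hphi) => e e0.
have [q0|q0] := eqVneq (cmod q) 0.
  exists 1%N => -[//|n] _; rewrite subr0 cmodX q0 expr0n /= ltW //.
have : summable (fun n => cmod q ^+ n) by apply: summable_geom; rewrite cmod_ge0.
have h0 n : 0 <= cmod q ^+ n by rewrite exprn_ge0 ?cmod_ge0.
move=> /(summable_tail h0)/(_ e0)[K hK].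
by exists K => n Kn; have := hK n n.+1 Kn; rewrite big_nat1 subr0 cmodX.
Qed.

(** The 12th power of eta, whose prefactor q^(1/24) becomes q^(1/2). *)
Definition eta12 tau : C := ce (tau / 2) * euler (ce tau) ^+ 12.

Lemma comb_lim tau (g : nat -> C -> C) (h : C -> C) :
  (forall z, z \in tors3_list tau -> h z != 0) ->
  (forall z, z \in tors2_list tau ++ tors3_list tau -> clim (fun n => g n z) (h z)) ->
  clim (fun n => comb tau (g n)) (comb tau h).
Proof.
move=> h0 hg.
have hin z : z \in tors2_list tau ++ tors3_list tau -> clim (fun n => g n z) (h z) by exact: hg.
apply: climM.
  rewrite /tors2; do !apply: climM; do ?apply: climX; do ?apply: climM; apply: hin;
    by rewrite mem_cat !inE eqxx ?orbT.
apply: climV.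
  by rewrite expf_neq0 // tors3E prodf_seq_neq0; apply/allP => z hz; rewrite /= h0.
apply: climX; rewrite /tors3; do !apply: climM; apply: hin; by rewrite mem_cat !inE eqxx ?orbT.
Qed.

Lemma cmod_ce_lt1 tau : 0 < complex.Im tau -> cmod (ce tau) < 1.
Proof.
move=> h; by rewrite cmod_ce -expR0 ltr_expR oppr_lt0 !mulr_gt0 // pi_gt0.
Qed.

(** [Rtors] is even, so one point of each pair w, -w is taken in the square of half-side [K] with
    the origin removed: two half-axes and two quadrants. *)
Definition latprod tau K : C :=
  (\prod_(n < K) Rtors tau n.+1%:R) * (\prod_(m < K) Rtors tau (m.+1%:R * tau)) *
  \prod_(m < K) \prod_(n < K)
     (Rtors tau (m.+1%:R * tau + n.+1%:R) * Rtors tau (m.+1%:R * tau - n.+1%:R)).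

(* The square-shaped partial products are exactly invariant, because the set of
   torsion points is permuted by the inversion and [Rtors] is homogeneous. *)
Lemma latprod_inv tau K : tau != 0 -> (forall m n : nat, m.+1%:R * tau + n.+1%:R != 0) ->
  (forall m n : nat, m.+1%:R * tau - n.+1%:R != 0) ->
  latprod (- tau^-1) K = latprod tau K.
Proof.
move=> t0 h1 h2; have c2 : (2 : C) != 0 by rewrite pnatr_eq0.
have c3 : (3 : C) != 0 by rewrite pnatr_eq0.
have n0 n : (n.+1%:R : C) != 0 by rewrite pnatr_eq0.
rewrite /latprod; congr (_ * _); last first.
  rewrite exchange_big; apply: eq_bigr => m _; apply: eq_bigr => n _.
  rewrite -(Rtors_inv c2 c3 t0 (h1 m n)) -(Rtors_inv c2 c3 t0 (h2 m n)) mulrC.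
  congr (_ * _).
    by rewrite -Rtors_even; congr Rtors; field.
  by congr Rtors; field.
rewrite mulrC; congr (_ * _); apply: eq_bigr => n _.
  rewrite -(Rtors_inv c2 c3 t0 (n0 n)) -Rtors_even; congr Rtors; field.
  by [].
rewrite -(Rtors_inv c2 c3 t0 (w := n.+1%:R * tau)) ?mulf_neq0 //; congr Rtors; field.
by [].
Qed.

Section Rows.
Variable tau : C.
Hypothesis tau_im : 0 < complex.Im tau.
Local Notation q := (ce tau).
Let q1 : cmod q < 1. Proof. exact: cmod_ce_lt1. Qed.
Let q0 : q != 0. Proof. exact: ce_neq0. Qed.

Definition sn z : C := ce (z / 2) - ce (- (z / 2)).

Lemma snE z : sn z = - ce (- (z / 2)) * (1 - ce z).
Proof.
have -> : ce z = ce (z / 2) * ce (z / 2) by rewrite -ceD -splitr.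
by rewrite /sn ceN; have := ce_neq0 (z / 2); move: (ce _) => x x0; field.
Qed.

Lemma sn_neq0 z : ce z != 1 -> sn z != 0.
Proof. by move=> h; rewrite snE mulf_neq0 ?oppr_eq0 ?ce_neq0 // subr_eq0 eq_sym. Qed.

Lemma ce_tors3_neq1 z : z \in tors3_list tau -> ce z != 1.
Proof.
have key (y : C) : complex.Im y != 0 -> ce y != 1.
  move=> h; apply/eqP => e1; have := congr1 (@cmod R) e1; rewrite cmod1 cmod_ce => e2.
  have : expR (- (2 * pi * complex.Im y)) = expR 0 by rewrite expR0.
  move/expR_inj/eqP; rewrite oppr_eq0 mulf_eq0 (negPf h) orbF gt_eqF //.
  by rewrite mulr_gt0 // pi_gt0.
have E : (3^-1 : C) = (3^-1 : R)%:C by rewrite fmorphV rmorph_nat.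
rewrite !inE => /or4P[]/eqP->.
- by rewrite E ce_real_neq1 //; apply/andP; split; lra.
- apply: key; rewrite E; case: (tau) tau_im => a b /= h.
  by rewrite mulr0 add0r mulf_neq0 // gt_eqF.
- apply: key; rewrite E; case: (tau) tau_im => a b /= h.
  by rewrite mulr0 !add0r mulf_neq0 // gt_eqF.
- apply: key; rewrite E; case: (tau) tau_im => a b /= h.
  by rewrite mulr0 !add0r mulf_neq0 // oppr_eq0 gt_eqF.
Qed.

Lemma tors_neq0 z : z \in tors2_list tau ++ tors3_list tau -> z != 0.
Proof.
have key (y : C) : complex.Im y != 0 -> y != 0.
  by move=> h; apply/eqP => e; move: h; rewrite e eqxx.
have E2 : (2^-1 : C) = (2^-1 : R)%:C by rewrite fmorphV rmorph_nat.
have E : (3^-1 : C) = (3^-1 : R)%:C by rewrite fmorphV rmorph_nat.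
have c2 : (2^-1 : C) != 0 by rewrite invr_eq0 pnatr_eq0.
have c3 : (3^-1 : C) != 0 by rewrite invr_eq0 pnatr_eq0.
have t0 : tau != 0 by rewrite key // gt_eqF.
have t1 : 1 + tau != 0 by rewrite key //; case: (tau) tau_im => a b /= h; rewrite add0r gt_eqF.
have t2 : 1 - tau != 0.
  by rewrite key //; case: (tau) tau_im => a b /= h; rewrite add0r oppr_eq0 gt_eqF.
rewrite mem_cat !inE => /orP[|].
  by case/or4P => [|||/or3P[||]] /eqP-> //; rewrite mulf_neq0.
by case/or4P => /eqP-> //; rewrite mulf_neq0.
Qed.

Lemma sine_product_quot z : z != 0 ->
  clim (fun K => \prod_(k < K) (1 - z ^+ 2 / k.+1%:R ^+ 2)) (sn z / twopii R / z).
Proof.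
move=> z0; have := climZ z^-1 (sine_product z); rewrite mulrC.
by apply: clim_ext => n; rewrite mulKf.
Qed.

Lemma axis_lim :
  clim (fun K => \prod_(n < K) Rtors tau n.+1%:R) (comb tau (fun z => sn z / twopii R / z)).
Proof.
have tp0 := twopii_neq0 R.
apply: (clim_ext (u := fun K => comb tau (fun z => \prod_(n < K) (1 - z ^+ 2 / n.+1%:R ^+ 2)))).
  by move=> K; rewrite (comb_prod _ _ (fun n z => 1 - z ^+ 2 / n.+1%:R ^+ 2)).
apply: comb_lim => z hz.
  have z0 : z != 0 by apply: tors_neq0; rewrite mem_cat hz orbT.
  by rewrite !mulf_neq0 ?invr_eq0 // sn_neq0 ?ce_tors3_neq1.
by apply: sine_product_quot; exact: tors_neq0.
Qed.

Lemma lattice_neq0 (m n : int) : (m != 0) || (n != 0) -> m%:~R * tau + n%:~R != 0.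
Proof.
move=> mn; have E (k : int) : (k%:~R : C) = (k%:~R : R)%:C by rewrite rmorph_int.
have [m0|m0] := eqVneq m 0.
  by move: mn; rewrite m0 eqxx /= mul0r add0r intr_eq0.
apply/eqP => /(congr1 (@complex.Im R)); rewrite !E; case: (tau) tau_im => a b /= h /eqP.
by rewrite mul0r !addr0 mulf_eq0 intr_eq0 (negPf m0) (gt_eqF h).
Qed.

Definition rowg Q u : C := (1 - Q * u) * (1 - Q / u) / (1 - Q) ^+ 2.

(** The row of points w + n, n an integer, gives sin(pi(w + z)) sin(pi(w - z)) / sin(pi w)^2.
    Already at finite [N] the terms regroup exactly into partial sine products at w + z, w - z and
    w. *)
Lemma row_factor_lim m z :
  clim (fun N => (1 - z ^+ 2 / (m.+1%:R * tau) ^+ 2) *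
    \prod_(n < N) ((1 - z ^+ 2 / (m.+1%:R * tau + n.+1%:R) ^+ 2) *
                   (1 - z ^+ 2 / (m.+1%:R * tau - n.+1%:R) ^+ 2)))
    (rowg (q ^+ m.+1) (ce z)).
Proof.
set w := m.+1%:R * tau; have tp0 := twopii_neq0 R.
have eQ : q ^+ m.+1 = ce w by rewrite -ceMn.
have w0 : w != 0 by have := @lattice_neq0 m.+1 0 isT; rewrite addr0.
have wp n : w + n.+1%:R != 0 by exact: (@lattice_neq0 m.+1 n.+1 isT).
have wm n : w - n.+1%:R != 0.
  by have := @lattice_neq0 m.+1 (- n.+1%:Z) isT; rewrite rmorphN.
have Q1 : 1 - ce w != 0 by rewrite -eQ one_subX_neq0.
have snw : sn w / twopii R != 0 by rewrite mulf_neq0 ?invr_eq0 // sn_neq0 // eq_sym -subr_eq0.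
pose S (x : C) N := x * \prod_(k < N) (1 - x ^+ 2 / k.+1%:R ^+ 2).
have hS x : clim (S x) (sn x / twopii R) by exact: sine_product.
have := climM (climM (hS (w + z)) (hS (w - z))) (climV (expf_neq0 2 snw) (climX 2 (hS w))).
have -> : sn (w + z) / twopii R * (sn (w - z) / twopii R) / (sn w / twopii R) ^+ 2 =
  rowg (q ^+ m.+1) (ce z).
  rewrite /rowg eQ !snE ceD ceB.
  have e2 : ce (- ((w + z) / 2)) * ce (- ((w - z) / 2)) = ce (- (w / 2)) ^+ 2.
    by rewrite expr2 -!ceD; congr ce; field.
  have := ce_neq0 z; have := ce_neq0 (- (w / 2)); move: Q1 e2 tp0.
  move: (ce w) (ce z) (ce (- (w / 2))) (twopii R) (ce (- ((w + z) / 2))) (ce (- ((w - z) / 2))).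
  move=> Q u v p a b Q1 ab p0 v0 u0.
  have -> : - a * (1 - Q * u) / p * (- b * (1 - Q / u) / p) = (a * b) * (1 - Q * u) * (1 - Q / u) / p ^+ 2.
    by field; rewrite p0 u0.
  by rewrite ab; field; rewrite p0 v0 u0 Q1.
apply: clim_ext => N; rewrite /S.
have nn n : (n.+1%:R : C) != 0 by rewrite pnatr_eq0.
have -> : \prod_(n < N) ((1 - z ^+ 2 / (w + n.+1%:R) ^+ 2) * (1 - z ^+ 2 / (w - n.+1%:R) ^+ 2)) =
  (\prod_(k < N) (1 - (w + z) ^+ 2 / k.+1%:R ^+ 2)) * (\prod_(k < N) (1 - (w - z) ^+ 2 / k.+1%:R ^+ 2))
    / (\prod_(k < N) (1 - w ^+ 2 / k.+1%:R ^+ 2)) ^+ 2.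
  rewrite -prodrXl -prodfV -!big_split /=; apply: eq_bigr => k _.
  have := wp k; have := wm k; have := nn k; move: (k.+1%:R : C) => x x0 hm hp.
  have -> : 1 - w ^+ 2 / x ^+ 2 = - ((w + x) * (w - x)) / x ^+ 2 by field.
  by field; rewrite x0 hm hp.
have P0 : \prod_(k < N) (1 - w ^+ 2 / k.+1%:R ^+ 2) != 0.
  apply/prodf_neq0 => k _; have := wp k; have := wm k; have := nn k.
  move: (k.+1%:R : C) => x x0 hm hp.
  have -> : 1 - w ^+ 2 / x ^+ 2 = - ((w + x) * (w - x)) / x ^+ 2 by field.
  by rewrite !mulf_neq0 ?invr_eq0 ?oppr_eq0 ?expf_neq0 // mulf_neq0.
set P := \prod_(k < N) (1 - w ^+ 2 / k.+1%:R ^+ 2) in P0 *.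
set P1 := \prod_(k < N) (1 - (w + z) ^+ 2 / k.+1%:R ^+ 2).
set P2 := \prod_(k < N) (1 - (w - z) ^+ 2 / k.+1%:R ^+ 2).
by field; rewrite w0 P0.
Qed.

Lemma row_lim m :
  clim (fun N => Rtors tau (m.+1%:R * tau) *
    \prod_(n < N) (Rtors tau (m.+1%:R * tau + n.+1%:R) * Rtors tau (m.+1%:R * tau - n.+1%:R)))
    (comb tau (fun z => rowg (q ^+ m.+1) (ce z))).
Proof.
apply: (clim_ext (u := fun N => comb tau (fun z => (1 - z ^+ 2 / (m.+1%:R * tau) ^+ 2) *
    \prod_(n < N) ((1 - z ^+ 2 / (m.+1%:R * tau + n.+1%:R) ^+ 2) *
                   (1 - z ^+ 2 / (m.+1%:R * tau - n.+1%:R) ^+ 2))))).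
  move=> N; rewrite combM; congr (_ * _).
  rewrite (comb_prod _ _ (fun n z => (1 - z ^+ 2 / (m.+1%:R * tau + n.+1%:R) ^+ 2) *
                   (1 - z ^+ 2 / (m.+1%:R * tau - n.+1%:R) ^+ 2))).
  by apply: eq_bigr => n _; rewrite combM.
apply: comb_lim => z hz; last exact: row_factor_lim.
have iw : complex.Im tau <= complex.Im (m.+1%:R * tau).
  rewrite -[m.+1%:R](rmorph_nat (real_complex R)) mulrC; case: (tau) tau_im => a b /= h.
  by rewrite mulr0 add0r ler_peMr ?(ltW h) // ler1n.
have iz : `|complex.Im z| < complex.Im tau.
  have E : (3^-1 : C) = (3^-1 : R)%:C by rewrite fmorphV rmorph_nat.
  move: hz; rewrite !inE E => /or4P[]/eqP->; case: (tau) tau_im => a b /= h.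
  - by rewrite normr0.
  - rewrite mulr0 add0r gtr0_norm ?mulr_gt0 ?invr_gt0 //; lra.
  - rewrite mulr0 !add0r gtr0_norm ?mulr_gt0 ?invr_gt0 //; lra.
  - rewrite mulr0 !add0r mulNr normrN gtr0_norm ?mulr_gt0 ?invr_gt0 //; lra.
have h1 : 1 - q ^+ m.+1 * ce z != 0.
  rewrite -ceMn -ceD; apply: one_sub_neq0; apply: cmod_ce_lt1; rewrite raddfD /=.
  have := ler_norm (- complex.Im z); rewrite normrN; lra.
have h2 : 1 - q ^+ m.+1 / ce z != 0.
  rewrite -ceMn -ceB; apply: one_sub_neq0; apply: cmod_ce_lt1; rewrite raddfB /=.
  have := ler_norm (complex.Im z); lra.
by rewrite /rowg !mulf_neq0 ?invr_eq0 ?expf_neq0 // one_subX_neq0.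
Qed.

Lemma cube_root_sum : 1 + ce 3^-1 + ce 3^-1 ^+ 2 = 0 :> C.
Proof.
have p3 := @prim_root_ce R 3 isT; set w := ce _ in p3 *.
have : (w - 1) * (1 + w + w ^+ 2) = 0.
  have -> : (w - 1) * (1 + w + w ^+ 2) = w ^+ 3 - 1 by ring.
  by rewrite (prim_expr_order p3) subrr.
move/eqP; rewrite mulf_eq0 subr_eq0 => /orP[w1|/eqP //].
by have := prim_order_dvd p3 1; rewrite expr1 w1.
Qed.

Lemma comb_rowE m :
  comb tau (fun z => rowg (q ^+ m.+1) (ce z)) =
  (1 - q ^+ m.+1) ^+ 12 *
  ((1 + q ^+ m.+1) ^+ 2 * (1 - q ^+ (2 * m + 3)) * (1 - q ^+ (2 * m + 1))) ^+ 2 /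
  ((1 + q ^+ m.+1 + q ^+ m.+1 ^+ 2) * (1 - q ^+ (3 * m + 4)) * (1 - q ^+ (3 * m + 2))) ^+ 3.
Proof.
have h2 : ce (tau / 2) ^+ 2 = q by rewrite -ceMn; congr ce; field.
have h3 : ce (tau / 3) ^+ 3 = q by rewrite -ceMn; congr ce; field.
have := comb_row (ce_neq0 (tau / 2)) (ce_neq0 (tau / 3)) (ce_neq0 3^-1) (one_subX_neq0 m q1) h2 h3 cube_root_sum.
rewrite /= -!exprM -![_ * q]exprSr -[_ / q]/(_ * _).
have -> : q ^+ (m.+1 * 2) / q = q ^+ (2 * m + 1).
  have -> : (m.+1 * 2 = (2 * m + 1).+1)%N by lia.
  by rewrite exprS mulrAC mulfV // mul1r.
have -> : q ^+ (m.+1 * 3) / q = q ^+ (3 * m + 2).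
  have -> : (m.+1 * 3 = (3 * m + 2).+1)%N by lia.
  by rewrite exprS mulrAC mulfV // mul1r.
have -> : ((m.+1 * 2).+1 = 2 * m + 3)%N by lia.
have -> : ((m.+1 * 3).+1 = 3 * m + 4)%N by lia.
move=> <-; rewrite /comb /tors2 /tors3 /rowg ce_half.
have -> : ce ((1 + tau) / 2) = - ce (tau / 2) by rewrite mulrDl ceD mul1r ce_half mulN1r.
have -> : ce ((1 - tau) / 2) = - (ce (tau / 2))^-1 by rewrite mulrBl ceB mul1r ce_half mulN1r.
have -> : ce ((1 + tau) / 3) = ce 3^-1 * ce (tau / 3) by rewrite mulrDl ceD mul1r.
by have -> : ce ((1 - tau) / 3) = ce 3^-1 / ce (tau / 3) by rewrite mulrBl ceB mul1r.
Qed.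

(** In [prod_T2] and [prod_T3] the Euler products cancel in the limit and leave 1/(1 - q) each;
    raised to the powers 2 and -3, they leave one factor 1 - q beside [euler q ^+ 12]. *)
Lemma rows_lim :
  clim (fun K => \prod_(m < K) comb tau (fun z => rowg (q ^+ m.+1) (ce z)))
    (euler q ^+ 12 * (1 - q)).
Proof.
have E0 := euler_neq0 q1; have hE := euler_lim q1.
have Q1 := one_sub_neq0 q1.
have g2 : clim (fun K => 1 - q ^+ (2 * K).+1) 1.
  rewrite -[X in clim _ X]subr0; apply: climD; first exact: clim_cst.
  rewrite -mulN1r; apply: clim_ext (climZ (-1) (clim_geom (phi := fun K => (2 * K).+1) q1 _)) => [n|n].
    by rewrite mulN1r.
  lia.
have g3 : clim (fun K => 1 - q ^+ (3 * K).+1) 1.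
  rewrite -[X in clim _ X]subr0; apply: climD; first exact: clim_cst.
  rewrite -mulN1r; apply: clim_ext (climZ (-1) (clim_geom (phi := fun K => (3 * K).+1) q1 _)) => [n|n].
    by rewrite mulN1r.
  lia.
have e2 : clim (fun K => qprod q (2 * K)) (euler q) by apply: clim_sub hE => n; lia.
have e3 : clim (fun K => qprod q (3 * K)) (euler q) by apply: clim_sub hE => n; lia.
have T2 := climM (climM (climX 2 (climM e2 (climV E0 hE))) g2) (clim_cst (1 - q)^-1).
have T3 := climM (climM (climM e3 (climV E0 hE)) g3) (clim_cst (1 - q)^-1).
have c3 : euler q / euler q * 1 * (1 - q)^-1 != 0.
  by rewrite divff // !mul1r invr_eq0.
have := climM (climM (climX 12 hE) (climX 2 T2)) (climV (expf_neq0 3 c3) (climX 3 T3)).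
rewrite divff // expr1n !mul1r.
have -> : euler q ^+ 12 * (1 - q)^-1 ^+ 2 / (1 - q)^-1 ^+ 3 = euler q ^+ 12 * (1 - q).
  by field.
apply: clim_ext => K.
under [RHS]eq_bigr => m _ do rewrite comb_rowE.
rewrite big_split /= big_split /= !prodrXl prodfV prodrXl.
have hn n := one_subX_neq0 n q1.
by rewrite (prod_T2 K hn) (prod_T3 K hn).
Qed.

(** Contribution of the row m = 0; its denominator 1 - q cancels the factor left by [rows_lim]. *)
Lemma comb_sn : comb tau sn = 4 * ce (tau / 2) / (sn 3^-1 ^+ 3 * (1 - q)).
Proof.
set c3 := sn 3^-1.
have c30 : c3 != 0 by rewrite sn_neq0 // ce_tors3_neq1 // !inE eqxx.
have e2 : tors2 tau sn = 4 * (ce (tau / 2) - (ce (tau / 2))^-1) ^+ 2.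
  rewrite /tors2 /sn !ceN.
  have -> : ce (tau / 2) = ce (tau / 2 / 2) ^+ 2 by rewrite -ceMn; congr ce; field.
  have -> : ce ((1 + tau) / 2 / 2) = ce (2^-1 / 2) * ce (tau / 2 / 2) by rewrite -ceD; congr ce; field.
  have -> : ce ((1 - tau) / 2 / 2) = ce (2^-1 / 2) / ce (tau / 2 / 2) by rewrite -ceB; congr ce; field.
  have j2 : ce (2^-1 / 2) ^+ 2 = -1 :> C by rewrite -ceMn -ce_half; congr ce; field.
  have := ce_neq0 (tau / 2 / 2); have := ce_neq0 (2^-1 / 2 : C).
  move: j2; move: (ce (2^-1 / 2)) (ce (tau / 2 / 2)) => j y j2 j0 y0.
  have jV : j^-1 = - j by apply: (mulfI j0); rewrite divff // mulrN -expr2 j2 opprK.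
  have -> : ((j - j^-1) * (y - y^-1)) ^+ 2 * (j * y - (j * y)^-1) * (j / y - (j / y)^-1) =
     ((j - j^-1) * (y - y^-1)) ^+ 2 * (j ^+ 2 * (y / y) - y ^+ 2 * (j / j) - (y^-1) ^+ 2 * (j / j) + j^-1 ^+ 2 * (y / y)).
    by rewrite !invfM invrK; ring.
  rewrite !divff // jV sqrrN j2 exprMn opprK.
  have -> : (j + j) ^+ 2 = 4 * j ^+ 2 by ring.
  by rewrite j2; field.
have e3 : tors3 tau sn = - (c3 * (ce (tau / 2) - (ce (tau / 2))^-1)).
  rewrite /tors3 -/c3 -!(mulrA c3) -mulrN; congr (_ * _); rewrite /sn !ceN.
  have -> : ce (tau / 2) = ce (tau / 3 / 2) ^+ 3 by rewrite -ceMn; congr ce; field.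
  have -> : ce ((1 + tau) / 3 / 2) = ce (3^-1 / 2) * ce (tau / 3 / 2) by rewrite -ceD; congr ce; field.
  have -> : ce ((1 - tau) / 3 / 2) = ce (3^-1 / 2) / ce (tau / 3 / 2) by rewrite -ceB; congr ce; field.
  have w2 : ce (3^-1 / 2) ^+ 2 = ce 3^-1 :> C by rewrite -ceMn; congr ce; field.
  have hw := cube_root_sum; rewrite -w2 in hw.
  have := ce_neq0 (tau / 3 / 2); have := ce_neq0 (3^-1 / 2 : C).
  move: hw; move: (ce (3^-1 / 2)) (ce (tau / 3 / 2)) => o h ho o0 h0.
  have ho' : o ^+ 2 + o^-1 ^+ 2 = -1.
    rewrite exprVn; move: (o ^+ 2) (expf_neq0 2 o0) ho => x x0 hx.
    apply: (mulfI x0); rewrite mulrDr divff // mulrN1; apply/eqP.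
    by rewrite -subr_eq0 opprK -hx; apply/eqP; ring.
  have -> : (h - h^-1) * (o * h - (o * h)^-1) * (o / h - (o / h)^-1) =
    (h - h^-1) * ((o ^+ 2 + o^-1 ^+ 2) * (h / h) - (h ^+ 2 + h^-1 ^+ 2) * (o / o)).
    by rewrite !invfM invrK; ring.
  by rewrite !divff // ho'; field.
rewrite /comb e2 e3.
have -> : 1 - q = 1 - ce (tau / 2) ^+ 2 by rewrite -ceMn; congr (1 - ce _); field.
have := one_sub_neq0 q1; have -> : q = ce (tau / 2) ^+ 2 by rewrite -ceMn; congr ce; field.
have := ce_neq0 (tau / 2); move: (ce (tau / 2)) => H H0 H1.
have -> : H - H^-1 = - (1 - H ^+ 2) / H by field.
by field; rewrite ?H0 ?c30 ?H1.
Qed.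

(** Independent of tau, so it drops out when tau and -1/tau are compared. *)
Definition eta_const : C := 4 / sn 3^-1 ^+ 3 * twopii R ^+ 6.

Lemma axis_constE :
  comb tau (fun z => sn z / twopii R / z) * (euler q ^+ 12 * (1 - q)) =
  eta_const * eta12 tau / comb tau id.
Proof.
have tp0 := twopii_neq0 R; have Q1 := one_sub_neq0 q1.
rewrite combM (combM _ sn) comb_sn.
rewrite (combV tau id).
have -> : comb tau (fun=> (twopii R)^-1) = twopii R ^+ 6.
  by rewrite /comb /tors2 /tors3; field.
rewrite /eta_const /eta12 invfM; move: (comb tau id)^-1 (sn 3^-1 ^+ 3)^-1 => a b.
by field.
Qed.

Lemma latprod_lim : clim (latprod tau) (eta_const * eta12 tau / comb tau id).
Proof.
have [K K0 hK] := Rtors_bound tau_im.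
have E (n : nat) : (n%:R : C) = (n : int)%:~R by [].
(* A product of two factors of [Rtors] differs from 1 by at most (K^2 + 2K)/(x + y)^4. The extra 1
   gives L <= L^2, and (x + y)^4 >= (xy)^2 splits the bound as [beta m * beta n]. *)
pose L := K * (K + 2) + 1.
have L0 : 0 <= L by rewrite addr_ge0 ?mulr_ge0 ?addr_ge0.
pose beta (n : nat) : R := L * (n.+1%:R ^+ 2)^-1.
have b0 n : 0 <= beta n by rewrite mulr_ge0 ?invr_ge0 ?exprn_ge0.
have sb : summable beta by apply: summableZ; [|exact: summable_invsq].
have L1 : K <= L by rewrite /L; nra.
have pn (n : nat) : 1 <= n.+1%:R :> R by rewrite ler1n.
have inv4 (x : R) : 1 <= x -> K / x ^+ 4 <= L / x ^+ 2.
  move=> x1; have x0 : 0 < x by lra.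
  rewrite ler_pM ?invr_ge0 ?exprn_ge0 ?(ltW x0) // lef_pV2 ?posrE ?exprn_gt0 //.
  by rewrite ler_weXn2l.
have haxis n : cmod (Rtors tau n.+1%:R - 1) <= beta n.
  have [_] := hK 0 n.+1 isT; rewrite mul0r add0r normr0 add0r normr_nat.
  by move/le_trans; apply; apply: inv4.
have haxis' m : cmod (Rtors tau (m.+1%:R * tau) - 1) <= beta m.
  have [_] := hK m.+1 0 isT; rewrite normr0 !addr0 normr_nat.
  by move/le_trans; apply; apply: inv4.
have naxis' m : Rtors tau (m.+1%:R * tau) != 0.
  by have [] := hK m.+1 0 isT; rewrite addr0.
pose r m n := Rtors tau (m.+1%:R * tau + n.+1%:R) * Rtors tau (m.+1%:R * tau - n.+1%:R) - 1.
have hr m n : cmod (r m n) <= beta m * beta n.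
  have [_ h1] := hK m.+1 n.+1 isT; have [_ h2] := hK m.+1 (- n.+1%:Z) isT.
  move: h1 h2; rewrite rmorphN normrN normr_nat /=.
  rewrite -[n.+1%:~R]/(n.+1%:R) -[m.+1%:~R]/(m.+1%:R) normr_nat.
  have := pn m; have := pn n; rewrite /beta /r.
  move: (m.+1%:R : R) (n.+1%:R : R) => x y y1 x1.
  move: (Rtors _ _) (Rtors _ _) => b a ha hb.
  set D := (x + y) ^+ 4; have D1 : 1 <= D by rewrite exprn_ege1 //; lra.
  have D0 : 0 < D by lra.
  have xyD : (x * y) ^+ 2 <= D.
    rewrite /D (_ : 4 = 2 * 2)%N // exprM lerXn2r ?nnegrE //; nra.
  have -> : a * b - 1 = (a - 1) * (b - 1) + ((a - 1) + (b - 1)) by ring.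
  have t1 : cmod ((a - 1) * (b - 1) + ((a - 1) + (b - 1))) <= K / D * (K / D) + (K / D + K / D).
    rewrite (le_trans (cmodD _ _)) // cmodM lerD ?ler_pM ?cmod_ge0 //.
    by rewrite (le_trans (cmodD _ _)) // lerD.
  apply: (le_trans t1); apply: (@le_trans _ _ (L / D)).
    have KD : K / D <= K by rewrite ler_pdivrMr // ler_peMr.
    have KD0 : 0 <= K / D by rewrite divr_ge0 // ltW.
    have -> : L / D = K / D * K + (K / D + K / D) + D^-1 by rewrite /L; ring.
    by rewrite ler_wpDr ?invr_ge0 ?(ltW D0) // lerD2r ler_wpM2l.
  have -> : L / x ^+ 2 * (L / y ^+ 2) = L * L / (x * y) ^+ 2 by rewrite mulf_div -exprMn.
  have xy0 : 0 < (x * y) ^+ 2 by rewrite exprn_gt0 // mulr_gt0; lra.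
  rewrite ler_pM ?invr_ge0 ?(ltW D0) // ?lef_pV2 ?posrE //.
  by rewrite ler_peMr //; rewrite /L; nra.
have [La hLa] := prod_cvg haxis' sb.
have addK (x : C) : 1 + (x - 1) = x by rewrite addrC subrK.
have hLa' : clim (fun K => \prod_(m < K) Rtors tau (m.+1%:R * tau)) La.
  by apply: clim_ext hLa => N; apply: eq_bigr => i _; rewrite addK.
have La0 : La != 0.
  by apply: (prod_lim_neq0 haxis' sb) => [n|]; [rewrite addK | exact: hLa].
(* [row_lim] includes the point n = 0 of the row, which [latprod] collects in a separate product; it
   is divided out here, hence the need for [La0]. *)
pose p m := comb tau (fun z => rowg (q ^+ m.+1) (ce z)) / Rtors tau (m.+1%:R * tau).
have hp m : clim (fun N => \prod_(n < N) (1 + r m n)) (p m).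
  rewrite /p [_ / Rtors _ _]mulrC.
  apply: clim_ext (climZ (Rtors tau (m.+1%:R * tau))^-1 (row_lim m)) => N.
  rewrite mulKf //; apply: eq_bigr => n _.
  by rewrite /r addK.
have hpl : clim (fun K => \prod_(m < K) p m) (euler q ^+ 12 * (1 - q) / La).
  apply: clim_ext (climM rows_lim (climV La0 hLa')) => N.
  by rewrite -prodfV -big_split.
have := climM (climM axis_lim hLa') (double_prod hr b0 sb hp hpl).
have -> : comb tau (fun z => sn z / twopii R / z) * La * (euler q ^+ 12 * (1 - q) / La) =
  eta_const * eta12 tau / comb tau id.
  by rewrite -axis_constE; move: (comb _ _) (_ * (1 - q)) => a b; field.
apply: clim_ext => N; rewrite /latprod; congr (_ * _).
by apply: eq_bigr => m _; apply: eq_bigr => n _; rewrite /r addK.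
Qed.

End Rows.

Lemma Im_invN tau : 0 < complex.Im tau -> 0 < complex.Im (- tau^-1).
Proof.
case: tau => a b /= h; rewrite opprK divr_gt0 //.
by rewrite ltr_wpDl ?sqr_ge0 // exprn_gt0.
Qed.

Lemma eta_const_neq0 : eta_const != 0.
Proof.
have E : (3^-1 : C) = (3^-1 : R)%:C by rewrite fmorphV rmorph_nat.
rewrite /eta_const mulf_neq0 ?expf_neq0 ?twopii_neq0 // mulf_neq0 ?pnatr_eq0 // invr_eq0 expf_neq0 //.
by rewrite sn_neq0 // E ce_real_neq1 //; apply/andP; split; lra.
Qed.

(** By [latprod_inv] a single sequence has both limits given by [latprod_lim], at tau and at -1/tau;
    the ratio of the two elementary factors is [comb_id_inv]. *)
Lemma eta12_inv tau : 0 < complex.Im tau -> eta12 (- tau^-1) = - tau ^+ 6 * eta12 tau.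
Proof.
move=> h; have h' := Im_invN h.
have t0 : tau != 0 by apply/eqP => e; move: h; rewrite e ltxx.
have t2 : 1 - tau ^+ 2 != 0.
  have -> : 1 - tau ^+ 2 = (1 - tau) * (1 + tau) by ring.
  have E1 : (1%:~R : C) = 1 by [].
  have := @lattice_neq0 tau h 1 1 isT; have := @lattice_neq0 tau h 1 (-1) isT.
  rewrite rmorphN E1 !mul1r => n1 n2; rewrite mulf_neq0 //; last by rewrite addrC.
  by rewrite -oppr_eq0 opprB.
have c2 : (2 : C) != 0 by rewrite pnatr_eq0.
have c3 : (3 : C) != 0 by rewrite pnatr_eq0.
have E (n : nat) : (n%:R : C) = (n : int)%:~R by [].
have e : eta_const * eta12 (- tau^-1) / comb (- tau^-1) id = eta_const * eta12 tau / comb tau id.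
  apply: clim_uniq (latprod_lim h') _; apply: clim_ext (latprod_lim h) => K.
  rewrite latprod_inv // => m n; first exact: (@lattice_neq0 tau h m.+1 n.+1 isT).
  by have := @lattice_neq0 tau h m.+1 (- n.+1%:Z) isT; rewrite rmorphN.
have z0 : comb tau id != 0.
  rewrite /comb mulf_neq0 ?invr_eq0 ?expf_neq0 // ?tors2E ?tors3E prodf_seq_neq0; apply/allP => z hz /=.
    by apply: (tors_neq0 h); rewrite mem_cat hz.
  by apply: (tors_neq0 h); rewrite mem_cat hz orbT.
have k0 := eta_const_neq0.
move: e; rewrite comb_id_inv //; move: z0 k0.
move: (comb tau id) (eta_const) (eta12 (- tau^-1)) (eta12 tau) => Z k a b Z0 k0 e.
have -> : a = (k * a / (- tau ^+ 6 * Z)) * (- tau ^+ 6 * Z) / k.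
  by field; rewrite k0 t0 Z0.
by rewrite e; field; rewrite k0 Z0.
Qed.

Definition Delta tau : C := ce tau * euler (ce tau) ^+ 24.

Lemma DeltaE tau : Delta tau = ce tau * euler (ce tau) ^+ 24.
Proof. by []. Qed.

Lemma Delta_eta12 tau : Delta tau = eta12 tau ^+ 2.
Proof.
have e : ce tau = ce (tau / 2) ^+ 2 by rewrite -ceMn; congr ce; field.
by rewrite /Delta /eta12 exprMn -exprM -e.
Qed.

Lemma Delta_inv tau : 0 < complex.Im tau -> Delta (- tau^-1) = tau ^+ 12 * Delta tau.
Proof. by move=> h; rewrite !Delta_eta12 eta12_inv // exprMn sqrrN -exprM. Qed.

Lemma Delta_addn tau : Delta (tau + 1) = Delta tau.
Proof. by rewrite /Delta ceD ce1 mulr1. Qed.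

Lemma Delta_neq0 tau : 0 < complex.Im tau -> Delta tau != 0.
Proof. move=> h; apply: mulf_neq0; first exact: ce_neq0.
by apply: expf_neq0; apply: euler_neq0; exact: cmod_ce_lt1. Qed.

End EtaInversion.

(** * Integral q-expansions and modular functions of level one *)

Section AlgebraicIntegers.
Variable R : realType.
Local Notation C := R[i].
Implicit Types (z w : C).

Lemma alg_integerE z : alg_integer z <-> integralOver (intr : int -> C) z.
Proof. by split => [[p [mp rp]]|[p mp rp]]; exists p. Qed.

Lemma alg_integer_int (k : int) : alg_integer (k%:~R : C).
Proof. by apply/alg_integerE; apply: (integral_id (intr : {rmorphism int -> C})). Qed.

Lemma alg_integer0 : alg_integer (0 : C). Proof. exact: (alg_integer_int 0). Qed.
Lemma alg_integer1 : alg_integer (1 : C). Proof. exact: (alg_integer_int 1). Qed.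
Lemma alg_integer_nat (n : nat) : alg_integer (n%:R : C). Proof. exact: (alg_integer_int n). Qed.

Lemma alg_integerD z w : alg_integer z -> alg_integer w -> alg_integer (z + w).
Proof.
move=> /alg_integerE hz /alg_integerE hw; apply/alg_integerE.
exact: (@integral_add _ _ (intr : {rmorphism int -> C})).
Qed.

Lemma alg_integerM z w : alg_integer z -> alg_integer w -> alg_integer (z * w).
Proof.
move=> /alg_integerE hz /alg_integerE hw; apply/alg_integerE.
exact: (@integral_mul _ _ (intr : {rmorphism int -> C})).
Qed.

Lemma alg_integerN z : alg_integer z -> alg_integer (- z).
Proof.
move=> /alg_integerE hz; apply/alg_integerE.
exact: (@integral_opp _ _ (intr : {rmorphism int -> C})).
Qed.

Lemma alg_integerX z n : alg_integer z -> alg_integer (z ^+ n).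
Proof.
by move=> h; elim: n => [|n IH]; [exact: alg_integer1|rewrite exprS; apply: alg_integerM].
Qed.

Lemma alg_integer_sum (I : Type) (s : seq I) (F : I -> C) :
  (forall i, alg_integer (F i)) -> alg_integer (\sum_(i <- s) F i).
Proof.
by move=> h; elim/big_ind: _ => [|x y|i _]; [exact: alg_integer0|exact: alg_integerD|].
Qed.

Lemma alg_integer_root_monic z (p : {poly C}) :
  p \is monic -> root p z -> (forall k, alg_integer p`_k) -> alg_integer z.
Proof.
move=> mp rp hp; apply/alg_integerE.
apply: (@integral_root_monic _ _ (intr : {rmorphism int -> C}) _ _ mp rp).
by move=> x /(nthP 0)[k _ <-]; apply/alg_integerE.
Qed.

Lemma alg_integer_root z (n : nat) : (0 < n)%N -> alg_integer (z ^+ n) -> alg_integer z.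
Proof.
move=> n0 h; apply: (@alg_integer_root_monic _ ('X^n - (z ^+ n)%:P)).
- exact: monicXnsubC.
- by rewrite /root !hornerE subrr.
move=> k; rewrite coefB coefXn coefC; apply: alg_integerD; first exact: alg_integer_nat.
by apply: alg_integerN; case: ifP => _; [|exact: alg_integer0].
Qed.

Lemma alg_integer_unit_root z (n : nat) : (0 < n)%N -> z ^+ n = 1 -> alg_integer z.
Proof. by move=> n0 h; apply: (alg_integer_root n0); rewrite h; exact: alg_integer1. Qed.

Lemma alg_integer_ce_frac (k n : nat) : (0 < n)%N -> alg_integer (ce (k%:R / n%:R) : C).
Proof.
move=> n0; apply: (alg_integer_unit_root n0); rewrite -ceMn mulrC divfK ?ce_nat //.
by rewrite pnatr_eq0 -lt0n.
Qed.

Lemma alg_integer_coprime z (m n : nat) : coprime m n ->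
  alg_integer (m%:R * z) -> alg_integer (n%:R * z) -> alg_integer z.
Proof.
case: (posnP m) => [->|m0]; first by rewrite /coprime gcd0n => /eqP-> _; rewrite mul1r.
move=> /eqP cop hm hn; have [u v e _] := egcdnP n m0.
have -> : z = u%:R * (m%:R * z) - v%:R * (n%:R * z).
  by rewrite !mulrA -mulrBl -!natrM e cop natrD addrAC subrr add0r mul1r.
by apply: alg_integerD; [|apply: alg_integerN]; apply: alg_integerM => //; exact: alg_integer_nat.
Qed.

End AlgebraicIntegers.

(** * Calculus of q-expansions and Cauchy's estimate *)

Section QExpansions.
Variable R : realType.
Local Notation C := R[i].
Implicit Types (F G : C -> C) (a b : nat -> C) (N m L k : nat) (r e : R) (tau z : C).

(* [F(tau) x^m = sum_k a_k x^k] with [x = exp(2 pi i tau / N)], phrased as a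
   uniform polynomial approximation on every disc [|x| <= r < 1]. *)
Definition qexp N m a F := forall L r e, 0 <= r < 1 -> 0 < e ->
  exists P : {poly C}, (forall k, (k < L)%N -> P`_k = a k) /\
  forall tau, 0 < complex.Im tau -> cmod (ce (tau / N%:R)) <= r ->
    cmod (F tau * ce (tau / N%:R) ^+ m - P.[ce (tau / N%:R)]) <= e.

Definition conv a b k := \sum_(i < k.+1) a i * b (k - i)%N.
Definition shift t a k := if (k < t)%N then 0 else a (k - t)%N.

Lemma qexp_ext N m a F G : (forall tau, 0 < complex.Im tau -> F tau = G tau) ->
  qexp N m a F -> qexp N m a G.
Proof.
move=> h hF L r e r01 e0; have [P [h1 h2]] := hF L r e r01 e0.
by exists P; split => // tau ht hr; rewrite -h // h2.
Qed.

Lemma eq_qexp N m a b F : a =1 b -> qexp N m a F -> qexp N m b F.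
Proof.
move=> h hF L r e r01 e0; have [P [h1 h2]] := hF L r e r01 e0.
by exists P; split => // k hk; rewrite h1.
Qed.

Lemma qexp_cst N (c : C) : qexp N 0 (fun k => if k == 0%N then c else 0) (fun=> c).
Proof.
move=> L r e _ e0; exists c%:P; split => [k _|tau _ _]; first by rewrite coefC.
by rewrite hornerC expr0 mulr1 subrr cmod0 ltW.
Qed.

Lemma qexpD N m a b F G : qexp N m a F -> qexp N m b G ->
  qexp N m (fun k => a k + b k) (fun tau => F tau + G tau).
Proof.
move=> hF hG L r e r01 e0; have e2 : 0 < e / 2 by rewrite divr_gt0.
have [P [h1 h2]] := hF L r _ r01 e2; have [Q [h3 h4]] := hG L r _ r01 e2.
exists (P + Q); split => [k hk|tau ht hr]; first by rewrite coefD h1 // h3.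
rewrite hornerD mulrDl opprD addrACA (le_trans (cmodD _ _)) //.
by rewrite (splitr e) lerD ?h2 ?h4.
Qed.

Lemma horner_cmod_le (P : {poly C}) (z : C) : cmod z <= 1 ->
  cmod P.[z] <= \sum_(i < size P) cmod P`_i.
Proof.
move=> z1; rewrite horner_coef (le_trans (cmod_sum _ _ _)) //.
by apply: ler_sum => i _; rewrite cmodM cmodX ler_piMr ?cmod_ge0 // exprn_ile1 ?cmod_ge0.
Qed.

Lemma qexp_bounded N m a F r : qexp N m a F -> 0 <= r < 1 -> exists2 B : R, 0 < B &
  forall tau, 0 < complex.Im tau -> cmod (ce (tau / N%:R)) <= r ->
    cmod (F tau * ce (tau / N%:R) ^+ m) <= B.
Proof.
move=> hF r01; have [P [_ h]] := hF 0%N r 1 r01 ltr01.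
exists (1 + \sum_(i < size P) cmod P`_i).
  by rewrite ltr_wpDr // sumr_ge0 // => i _; exact: cmod_ge0.
move=> tau ht hr; rewrite -(subrK P.[ce (tau / N%:R)] (_ * _)) (le_trans (cmodD _ _)) //.
rewrite lerD ?h // horner_cmod_le // (le_trans hr) // ltW //; by case/andP: r01.
Qed.

Lemma qexpM N m1 m2 a b F G : qexp N m1 a F -> qexp N m2 b G ->
  qexp N (m1 + m2) (conv a b) (fun tau => F tau * G tau).
Proof.
move=> hF hG L r e r01 e0.
have [A A0 hA] := qexp_bounded hG r01.
have e2 : 0 < e / 2 by rewrite divr_gt0.
have [P [h1 h2]] := hF L r _ r01 (divr_gt0 e2 A0).
pose B := 1 + \sum_(i < size P) cmod P`_i.
have B0 : 0 < B by rewrite ltr_wpDr // sumr_ge0 // => i _; exact: cmod_ge0.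
have [Q [h3 h4]] := hG L r _ r01 (divr_gt0 e2 B0).
exists (P * Q); split => [k hk|tau ht hr].
  rewrite coefM; apply: eq_bigr => i _; rewrite h1 ?h3 //.
    by rewrite (leq_ltn_trans (leq_subr _ _)).
  by rewrite (leq_ltn_trans _ hk) // -ltnS.
set x := ce (tau / N%:R) in hr *.
have x1 : cmod x <= 1 by rewrite (le_trans hr) // ltW //; case/andP: r01.
rewrite hornerM exprD.
have -> : F tau * G tau * (x ^+ m1 * x ^+ m2) - P.[x] * Q.[x] =
  (F tau * x ^+ m1 - P.[x]) * (G tau * x ^+ m2) + P.[x] * (G tau * x ^+ m2 - Q.[x]) by ring.
have b1 : cmod ((F tau * x ^+ m1 - P.[x]) * (G tau * x ^+ m2)) <= e / 2.
  rewrite cmodM; apply: (le_trans (ler_pM _ _ (h2 _ ht hr) (hA _ ht hr))); rewrite ?cmod_ge0 //.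
  by rewrite divfK // gt_eqF.
have b2 : cmod (P.[x] * (G tau * x ^+ m2 - Q.[x])) <= e / 2.
  have hP : cmod P.[x] <= B by rewrite (le_trans (horner_cmod_le _ x1)) // lerDr.
  rewrite cmodM; apply: (le_trans (ler_pM _ _ hP (h4 _ ht hr))); rewrite ?cmod_ge0 //.
  by rewrite mulrC divfK // gt_eqF.
by rewrite (le_trans (cmodD _ _)) // (splitr e) lerD.
Qed.

Lemma qexp_shift t N m a F : qexp N m a F -> qexp N (m + t) (shift t a) F.
Proof.
move=> hF L r e r01 e0; have [P [h1 h2]] := hF L r e r01 e0.
exists (P * 'X^t); split => [k hk|tau ht hr].
  by rewrite coefMXn /shift; case: ifP => // _; rewrite h1 // (leq_ltn_trans (leq_subr _ _)).
rewrite hornerM hornerXn exprD mulrA -mulrBl cmodM cmodX.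
apply: le_trans (h2 _ ht hr); rewrite ler_piMr ?cmod_ge0 // exprn_ile1 ?cmod_ge0 //.
by rewrite (le_trans hr) // ltW //; case/andP: r01.
Qed.

Lemma exists_ce_eq (r : R) : 0 < r < 1 -> exists2 t : C, 0 < complex.Im t & ce t = r%:C.
Proof.
move=> /andP[r0 r1]; have p0 := pi_gt0 R.
exists (0 +i* (- ln r / (2 * pi))).
  by rewrite /= divr_gt0 ?mulr_gt0 // oppr_gt0 ln_lt0 // r0.
rewrite /ce ce_arg /cexp /= mulr0 cos0 sin0.
have -> : - (2 * pi * (- ln r / (2 * pi))) = ln r by rewrite mulrC divfK ?opprK // gt_eqF // mulr_gt0.
by rewrite lnK // mulr1.
Qed.

(* Cauchy's estimate, from averaging [P] over the points [r zeta^j]. *)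
Lemma poly_cauchy N (P : {poly C}) r (B : R) k : (0 < N)%N -> 0 < r < 1 ->
  (forall tau, 0 < complex.Im tau -> cmod (ce (tau / N%:R)) = r -> cmod P.[ce (tau / N%:R)] <= B) ->
  cmod P`_k * r ^+ k <= B.
Proof.
move=> N0 r01 hP; have [t t0 et] := exists_ce_eq r01; have /andP[r0 r1] := r01.
have N0' : (N%:R : C) != 0 by rewrite pnatr_eq0 -lt0n.
have hP' (y : R) : cmod P.[r%:C * ce y%:C] <= B.
  have := hP (N%:R * (t + y%:C)); rewrite mulrAC divff // mul1r ceD et; apply.
    rewrite -(rmorph_nat (real_complex R)); case: (t) t0 => a b /= h.
    by rewrite mul0r !addr0 mulr_gt0 // ltr0n.
  by rewrite cmodM cmod_real gtr0_norm // cmod_ce /= mulr0 oppr0 expR0 mulr1.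
have [kP|kP] := leqP (size P) k.
  rewrite nth_default // cmod0 mul0r; exact: le_trans (cmod_ge0 _) (hP' 0).
set K := size P; have K0 : (0 < K)%N by rewrite (leq_ltn_trans _ kP).
have K0' : (K%:R : C) != 0 by rewrite pnatr_eq0 -lt0n.
pose zeta : C := ce K%:R^-1; have pz : K.-primitive_root zeta by exact: prim_root_ce.
have z0 : zeta != 0 by exact: ce_neq0.
have key : K%:R * (P`_k * r%:C ^+ k) = \sum_(j < K) P.[r%:C * zeta ^+ j] / zeta ^+ (k * j).
  under eq_bigr => j _ do rewrite horner_coef mulr_suml.
  rewrite exchange_big /= (bigD1 (Ordinal kP)) //= [X in _ + X]big1 ?addr0.
    under eq_bigr => j _ do rewrite exprMn -exprM [(j * k)%N]mulnC mulrA mulfK ?expf_neq0 //.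
    by rewrite sumr_const card_ord mulr_natl.
  move=> i ik; pose u := zeta ^+ i / zeta ^+ k.
  have u1 : u - 1 != 0.
    rewrite subr_eq0; apply: contra ik => /eqP e; apply/eqP/val_inj => /=.
    have /eqP : zeta ^+ i = zeta ^+ k by rewrite -[zeta ^+ i](divfK (expf_neq0 k z0)) -/u e mul1r.
    by rewrite (eq_prim_root_expr pz) !modn_small // => /eqP.
  have -> : \sum_(j < K) P`_i * (r%:C * zeta ^+ j) ^+ i / zeta ^+ (k * j) =
     P`_i * r%:C ^+ i * \sum_(j < K) u ^+ j.
    rewrite mulr_sumr; apply: eq_bigr => j _.
    by rewrite exprMn /u expr_div_n -!exprM [(j * i)%N]mulnC; ring.
  have : (u - 1) * \sum_(j < K) u ^+ j = 0.
    rewrite -subrX1 /u expr_div_n -!exprM ![(_ * K)%N]mulnC !exprM (prim_expr_order pz).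
    by rewrite !expr1n divr1 subrr.
  by move=> /eqP; rewrite mulf_eq0 (negPf u1) /= => /eqP ->; rewrite mulr0.
have : cmod (K%:R * (P`_k * r%:C ^+ k)) <= K%:R * B.
  rewrite key (le_trans (cmod_sum _ _ _)) //.
  have -> : K%:R * B = \sum_(j < K) B by rewrite sumr_const card_ord mulr_natl.
  apply: ler_sum => j _; rewrite cmodM cmodV cmodX.
  have -> : cmod zeta = 1.
    have -> : zeta = ce (K%:R^-1 : R)%:C by rewrite /zeta fmorphV rmorph_nat.
    by rewrite cmod_ce /= mulr0 oppr0 expR0.
  rewrite expr1n invr1 mulr1.
  have -> : zeta ^+ j = ce (j%:R / K%:R : R)%:C.
    by rewrite -ceMn; congr ce; rewrite rmorphM fmorphV !rmorph_nat.
  exact: hP'.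
by rewrite !cmodM cmod_nat cmodX cmod_real gtr0_norm // ler_pM2l // ltr0n.
Qed.

End QExpansions.

Section IntegralExpansions.
Variable R : realType.
Local Notation C := R[i].
Implicit Types (F G : C -> C) (a b : nat -> C) (N m L k : nat) (r e : R) (tau z c : C).

(** [c] is the coefficient of x^(-m) and may be 0, as [m] only bounds the pole order. It is recorded
    because [alg_integer_hecke2] needs a leading coefficient that is a unit. *)
Definition iqexp N m c F :=
  exists a, [/\ forall k, alg_integer (a k), a 0%N = c & qexp N m a F].

Lemma iqexp_ext N m c F G : (forall tau, 0 < complex.Im tau -> F tau = G tau) ->
  iqexp N m c F -> iqexp N m c G.
Proof. by move=> h [a [h1 h2 h3]]; exists a; split => //; exact: qexp_ext h h3. Qed.

Lemma iqexp_cst N c : alg_integer c -> iqexp N 0 c (fun=> c).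
Proof.
move=> hc; exists (fun k => if k == 0%N then c else 0); split => //; last exact: qexp_cst.
by move=> k; case: ifP => // _; exact: alg_integer0.
Qed.

Lemma iqexpD N m c d F G : iqexp N m c F -> iqexp N m d G ->
  iqexp N m (c + d) (fun tau => F tau + G tau).
Proof.
move=> [a [h1 h2 h3]] [b [h4 h5 h6]]; exists (fun k => a k + b k); split.
- by move=> k; exact: alg_integerD.
- by rewrite h2 h5.
exact: qexpD.
Qed.

Lemma alg_integer_conv a b k : (forall k, alg_integer (a k)) -> (forall k, alg_integer (b k)) ->
  alg_integer (conv a b k).
Proof. by move=> ha hb; apply: alg_integer_sum => i; exact: alg_integerM. Qed.

Lemma iqexpM N m1 m2 c d F G : iqexp N m1 c F -> iqexp N m2 d G ->
  iqexp N (m1 + m2) (c * d) (fun tau => F tau * G tau).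
Proof.
move=> [a [h1 h2 h3]] [b [h4 h5 h6]]; exists (conv a b); split.
- by move=> k; exact: alg_integer_conv.
- by rewrite /conv big_ord1 h2 h5.
exact: qexpM.
Qed.

Lemma iqexpZ N m c d F : alg_integer d -> iqexp N m c F ->
  iqexp N m (d * c) (fun tau => d * F tau).
Proof. by move=> hd hF; have := iqexpM (iqexp_cst N hd) hF; rewrite add0n. Qed.

Lemma iqexpX N m c F n : iqexp N m c F -> iqexp N (n * m) (c ^+ n) (fun tau => F tau ^+ n).
Proof.
move=> hF; elim: n => [|n IH].
  rewrite mul0n expr0; apply: iqexp_ext (iqexp_cst N (alg_integer1 R)) => tau _.
  by rewrite expr0.
rewrite mulSn exprS; apply: iqexp_ext (iqexpM hF IH) => tau _.
by rewrite exprS.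
Qed.

Lemma iqexp_shift t N m c F : iqexp N m c F ->
  iqexp N (m + t) (if t == 0%N then c else 0) F.
Proof.
move=> [a [h1 h2 h3]]; exists (shift t a); split; last exact: qexp_shift.
  by move=> k; rewrite /shift; case: ifP => _ //; exact: alg_integer0.
by case: t => [|t] //; rewrite /shift subn0.
Qed.

Lemma iqexp_prod (I : Type) (s : seq I) N (m : I -> nat) (c : I -> C) (F : I -> C -> C) :
  (forall i, iqexp N (m i) (c i) (F i)) ->
  iqexp N (\sum_(i <- s) m i) (\prod_(i <- s) c i) (fun tau => \prod_(i <- s) F i tau).
Proof.
move=> h; elim: s => [|i s IH].
  rewrite !big_nil; apply: iqexp_ext (iqexp_cst N (alg_integer1 R)) => tau _.
  by rewrite big_nil.
rewrite !big_cons; apply: iqexp_ext (iqexpM (h i) IH) => tau _.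
by rewrite big_cons.
Qed.

Lemma iqexp0 N m : iqexp N m 0 (fun=> 0).
Proof.
exists (fun=> 0); split => // [k|]; first exact: alg_integer0.
move=> L r e _ e0; exists 0; split => [k _|tau _ _]; first by rewrite coef0.
by rewrite horner0 mul0r subrr cmod0 ltW.
Qed.

Lemma iqexp_sum (I : Type) (s : seq I) N m (c : I -> C) (F : I -> C -> C) :
  (forall i, iqexp N m (c i) (F i)) ->
  iqexp N m (\sum_(i <- s) c i) (fun tau => \sum_(i <- s) F i tau).
Proof.
move=> h; elim: s => [|i s IH].
  rewrite !big_nil; apply: iqexp_ext (iqexp0 N m) => tau _.
  by rewrite big_nil.
rewrite !big_cons; apply: iqexp_ext (iqexpD (h i) IH) => tau _.
by rewrite big_cons.
Qed.

Lemma iqexp_monom N m t c F : alg_integer c ->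
  (forall tau, 0 < complex.Im tau -> F tau * ce (tau / N%:R) ^+ m = c * ce (tau / N%:R) ^+ t) ->
  iqexp N m (if t == 0%N then c else 0) F.
Proof.
move=> hc hF; exists (fun k => if k == t then c else 0); split.
- by move=> k; case: ifP => // _; exact: alg_integer0.
- by rewrite eq_sym.
move=> L r e _ e0; exists (c *: 'X^t); split => [k _|tau ht _].
  by rewrite coefZ coefXn; case: ifP => _; rewrite ?mulr1 ?mulr0.
by rewrite hF // hornerZ hornerXn subrr cmod0 ltW.
Qed.

(** Substitution of zeta x^k for the variable. The pole part involves negative powers of [zeta], so
    its inverse must be integral too. *)
Lemma iqexp_comp N N' m c F (g : C -> C) (zeta : C) k : (0 < k)%N ->
  cmod zeta = 1 -> alg_integer zeta -> alg_integer zeta^-1 ->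
  (forall tau, 0 < complex.Im tau -> 0 < complex.Im (g tau)) ->
  (forall tau, ce (g tau / N%:R) = zeta * ce (tau / N'%:R) ^+ k) ->
  iqexp N m c F -> iqexp N' (k * m) (zeta^-1 ^+ m * c) (fun tau => F (g tau)).
Proof.
move=> k0 z1 hz hz' hg hce [a [h1 h2 h3]].
have z0 : zeta != 0 by rewrite -cmod_gt0 z1.
exists (fun j => if (k %| j)%N then zeta^-1 ^+ m * (zeta ^+ (j %/ k) * a (j %/ k)%N) else 0); split.
- move=> j; case: ifP => _; last exact: alg_integer0.
  by apply: alg_integerM; [|apply: alg_integerM] => //; apply: alg_integerX.
- by rewrite dvdn0 div0n expr0 mul1r h2.
move=> L r e r01 e0; have [P [hP1 hP2]] := h3 L r e r01 e0.
pose Q := \poly_(i < size P) (zeta ^+ i * P`_i).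
have QE x : Q.[x] = P.[zeta * x].
  rewrite horner_poly horner_coef; apply: eq_bigr => i _; rewrite exprMn; ring.
exists (zeta^-1 ^+ m *: (Q \Po 'X^k)); split => [j hj|tau ht hr].
  rewrite coefZ coef_comp_poly_Xn //; case: ifP => hkj; last by rewrite mulr0.
  rewrite coef_poly; case: ltnP => hs; first by rewrite hP1 // (leq_ltn_trans _ hj) // leq_div.
  by rewrite -hP1 ?nth_default ?mulr0 // (leq_ltn_trans _ hj) // leq_div.
rewrite hornerZ horner_comp hornerXn QE -hce exprM.
have -> : F (g tau) * (ce (tau / N'%:R) ^+ k) ^+ m = zeta^-1 ^+ m * (F (g tau) * ce (g tau / N%:R) ^+ m).
  have e1 : zeta^-1 ^+ m * zeta ^+ m = 1 by rewrite -exprMn mulVf // expr1n.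
  by rewrite hce (exprMn m zeta) (mulrCA _ (F _)) (mulrA (zeta^-1 ^+ m)) e1 mul1r.
rewrite -mulrBr cmodM cmodX cmodV z1 invr1 expr1n mul1r hP2 ?hg //.
rewrite hce cmodM z1 mul1r cmodX (le_trans _ hr) //.
rewrite -[leRHS]expr1 ler_wiXn2l ?cmod_ge0 // (le_trans hr) // ltW //; by case/andP: r01.
Qed.

(** Averaging the approximating polynomial over the translates tau + b, b < N, removes the exponents
    not divisible by [N]; by periodicity every translate approximates the same value of [F]. *)
Lemma qexp_descend N m a F : (0 < N)%N ->
  (forall tau, 0 < complex.Im tau -> F (tau + 1) = F tau) ->
  qexp N (N * m) a F -> qexp 1 m (fun k => a (N * k)%N) F.
Proof.
move=> N0 hT hF L r e /andP[r0 r1] e0.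
have NR : (0 : R) < N%:R by rewrite ltr0n.
have N0' : (N%:R : C) != 0 by rewrite pnatr_eq0 -lt0n.
(* A substitute for the N-th root of [r]: Bernoulli's inequality gives r <= r'^N, so |q| <= r
   implies |q^(1/N)| <= r'. *)
pose r' := 1 - (1 - r) / N%:R.
have q1 : (1 - r) / N%:R <= 1 - r by rewrite ler_pdivrMr // ler_peMr ?subr_ge0 ?(ltW r1) // ler1n.
have q0 : 0 < (1 - r) / N%:R by rewrite divr_gt0 // subr_gt0.
have r'01 : 0 <= r' < 1 by rewrite /r'; apply/andP; split; lra.
have r'N : r <= r' ^+ N.
  have bern n (x : R) : 0 <= x <= 1 -> 1 - n%:R * x <= (1 - x) ^+ n.
    move=> /andP[x0 x1]; elim: n => [|n IH]; first by rewrite mul0r subr0.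
    rewrite exprS (le_trans _ (ler_wpM2l _ IH)) ?subr_ge0 // -natr1.
    have : 0 <= n%:R * x * x by rewrite !mulr_ge0.
    lra.
  have e1 : N%:R * ((1 - r) / N%:R) = 1 - r by rewrite mulrC divfK ?gt_eqF.
  have h01 : 0 <= (1 - r) / N%:R <= 1 by apply/andP; split; lra.
  by have := bern N _ h01; rewrite e1 subKr.
have [P [h1 h2]] := hF (N * L)%N r' e r'01 e0.
exists (\poly_(i < size P) P`_(N * i)); split => [k hk|tau ht].
  rewrite coef_poly; case: ltnP => hs; first by rewrite h1 // ltn_pmul2l.
  by rewrite -h1 ?ltn_pmul2l // nth_default // (leq_trans hs) // leq_pmull.
rewrite divr1 => hr; set x := ce (tau / N%:R).
have xN : x ^+ N = ce tau by rewrite -ceMn mulrC divfK.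
pose zeta : C := ce N%:R^-1; have pz : N.-primitive_root zeta by exact: prim_root_ce.
have xr : cmod x <= r'.
  rewrite leNgt; apply/negP => lt; move: hr; rewrite -xN cmodX leNgt => /negP; apply.
  apply: (le_lt_trans r'N); rewrite ltrXn2r ?nnegrE ?cmod_ge0 -?lt0n //.
  by case/andP: r'01.
have hb (b : nat) : cmod (F tau * ce tau ^+ m - P.[zeta ^+ b * x]) <= e.
  have hFb : F (tau + b%:R) = F tau.
    elim: b => [|b IH]; first by rewrite addr0.
    rewrite -natr1 addrA hT // -(rmorph_nat (real_complex R)).
    by case: (tau) ht => u v /= hv; rewrite addr0.
  have eb : ce ((tau + b%:R) / N%:R) = zeta ^+ b * x.
    by rewrite mulrDl ceD mulrC -ceMn.
  have htb : 0 < complex.Im (tau + b%:R).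
    by rewrite -(rmorph_nat (real_complex R)); case: (tau) ht => u v /= hv; rewrite addr0.
  have ez : (zeta ^+ b) ^+ N = 1 by rewrite -exprM mulnC exprM (prim_expr_order pz) expr1n.
  have := h2 _ htb; rewrite eb hFb exprM (exprMn N (zeta ^+ b)) ez mul1r xN; apply.
  rewrite cmodM cmodX /zeta; have -> : cmod (ce N%:R^-1 : C) = 1.
    have -> : N%:R^-1 = (N%:R^-1 : R)%:C by rewrite fmorphV rmorph_nat.
    by rewrite cmod_ce /= mulr0 oppr0 expR0.
  by rewrite expr1n mul1r.
have avg : N%:R * (\poly_(i < size P) P`_(N * i)).[ce tau] = \sum_(b < N) P.[zeta ^+ b * x].
  have hs : (size P <= size P * N)%N by rewrite leq_pmulr.
  under eq_bigr => b _ do rewrite (horner_coef_wide _ hs).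
  rewrite exchange_big /= horner_poly.
  have inner i : \sum_(b < N) P`_i * (zeta ^+ b * x) ^+ i =
      if (N %| i)%N then N%:R * (P`_i * x ^+ i) else 0.
    case: ifP => hi.
      have zi : zeta ^+ i = 1 by apply/eqP; rewrite -(prim_order_dvd pz).
      under eq_bigr => b _ do rewrite exprMn -exprM [(b * i)%N]mulnC exprM zi expr1n mul1r.
      by rewrite sumr_const card_ord mulr_natl.
    have u1 : zeta ^+ i - 1 != 0.
      by rewrite subr_eq0 -(prim_order_dvd pz) hi.
    have : (zeta ^+ i - 1) * \sum_(b < N) (zeta ^+ i) ^+ b = 0.
      by rewrite -subrX1 -exprM mulnC exprM (prim_expr_order pz) expr1n subrr.
    move=> /eqP; rewrite mulf_eq0 (negPf u1) /= => /eqP e1.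
    transitivity (P`_i * x ^+ i * \sum_(b < N) (zeta ^+ i) ^+ b); last by rewrite e1 mulr0.
    rewrite mulr_sumr; apply: eq_bigr => b _; rewrite exprMn -!exprM [(b * i)%N]mulnC; ring.
  under [RHS]eq_bigr => i _ do rewrite inner.
  rewrite mulr_sumr -[RHS](big_mkord xpredT (fun i => if (N %| i)%N then N%:R * (P`_i * x ^+ i) else 0)).
  elim: (size P) => [|s IH]; first by rewrite mul0n big_geq // big_ord0.
  have hs1 : (s * N <= s.+1 * N)%N by rewrite leq_mul2r leqnSn orbT.
  rewrite big_ord_recr /= IH (big_cat_nat (leq0n _) hs1) /=; congr (_ + _).
  rewrite -{1}[(s * N)%N]add0n big_addn mulSn addnK big_ltn //= add0n dvdn_mull //.
  rewrite [(s * N)%N]mulnC exprM xN.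
  rewrite [X in _ + X]big1_seq ?addr0 // => i /andP[_]; rewrite mem_index_iota => /andP[i1 i2].
  by rewrite dvdn_addl ?dvdn_mulr // gtnNdvd.
rewrite -(ler_pM2l NR) -cmod_nat -cmodM mulrBr avg.
have -> : N%:R * (F tau * ce tau ^+ m) = \sum_(b < N) F tau * ce tau ^+ m.
  by rewrite sumr_const card_ord mulr_natl.
rewrite -sumrB (le_trans (cmod_sum _ _ _)) //.
rewrite (le_trans (ler_sum _ (fun (b : 'I_N) _ => hb b))) //.
by rewrite sumr_const card_ord cmod_nat mulr_natl.
Qed.

Lemma iqexp_descend N m c F : (0 < N)%N ->
  (forall tau, 0 < complex.Im tau -> F (tau + 1) = F tau) ->
  iqexp N (N * m) c F -> iqexp 1 m c F.
Proof.
move=> N0 hT [a [h1 h2 h3]]; exists (fun k => a (N * k)%N); split => //.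
  by rewrite muln0.
exact: qexp_descend.
Qed.

Fixpoint prod_coef (g : nat -> nat -> C) K : nat -> C :=
  if K is K'.+1 then conv (prod_coef g K') (g K') else fun k => (k == 0%N)%:R.

(** Factor [n] is 1 + O(q^(n+1)), so the coefficient of q^k no longer changes after [k] factors; the
    diagonal [prod_coef g k k] is thus the limit. *)
Lemma iqexp_iprod (g : nat -> nat -> C) (h : nat -> C -> C) F :
  (forall n k, alg_integer (g n k)) -> (forall n, g n 0%N = 1) ->
  (forall n k, (0 < k <= n)%N -> g n k = 0) ->
  (forall n, qexp 1 0 (g n) (h n)) ->
  (forall r, 0 <= r < 1 -> exists beta : nat -> R, summable beta /\
     forall n tau, 0 < complex.Im tau -> cmod (ce tau) <= r -> cmod (h n tau - 1) <= beta n) ->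
  (forall tau, 0 < complex.Im tau -> clim (fun K => \prod_(n < K) h n tau) (F tau)) ->
  iqexp 1 0 1 F.
Proof.
move=> hA h1 h0 hq hb hF.
have alg K k : alg_integer (prod_coef g K k).
  elim: K k => [|K IH] k /=; first exact: alg_integer_nat.
  exact: alg_integer_conv.
have stepK K k : (k <= K)%N -> prod_coef g K.+1 k = prod_coef g K k.
  move=> kK /=; rewrite /conv big_ord_recr /= subnn h1 mulr1 big1 ?add0r // => i _.
  rewrite h0 ?mulr0 // subn_gt0 ltn_ord /= (leq_trans (leq_subr _ _)) //.
have stab K k : (k <= K)%N -> prod_coef g K k = prod_coef g k k.
  elim: K => [|K IH]; first by rewrite leqn0 => /eqP ->.
  rewrite leq_eqVlt => /orP[/eqP -> //|]; rewrite ltnS => kK.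
  by rewrite stepK // IH.
have fin K : qexp 1 0 (prod_coef g K) (fun tau => \prod_(n < K) h n tau).
  elim: K => [|K IH].
    apply: (qexp_ext (F := fun=> 1)) => [tau _|]; first by rewrite big_ord0.
    by apply: (eq_qexp _ (qexp_cst 1 1)) => k /=; case: eqP.
  apply: (qexp_ext (F := fun tau => (\prod_(n < K) h n tau) * h K tau)) => [tau _|].
    by rewrite big_ord_recr.
  by rewrite -[0%N]/(0 + 0)%N; exact: qexpM.
exists (fun k => prod_coef g k k); split => // L r e r01 e0.
have [beta [[S hS] hbeta]] := hb r r01.
have sb : summable beta by exists S.
have e2 : 0 < e / 2 by rewrite divr_gt0.
(* A point of the disc is needed to see that [beta] is nonnegative. For r = 0 there is none, but
   then the approximation is vacuous because [ce] never vanishes. *)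
have [t0 ht0] : exists t0 : C, 0 < complex.Im t0 /\ cmod (ce t0) <= r \/ r = 0.
  case/andP: r01 => r0 r1; have [->|rn] := eqVneq r 0; first by exists 0; right.
  have [t t1 t2] : exists2 t : C, 0 < complex.Im t & ce t = r%:C.
    by apply: exists_ce_eq; rewrite lt_def rn r0 r1.
  by exists t; left; split => //; rewrite t2 cmod_real ger0_norm.
have [r_eq0|rn0] := eqVneq r 0.
  have [P [hP1 _]] := fin L L r e r01 e0.
  exists P; split => [k hk|tau ht]; first by rewrite hP1 // stab // ltnW.
  by rewrite divr1 r_eq0 => hz; have := ce_neq0 tau; rewrite -cmod_gt0 ltNge hz.
case: ht0 => [[t0i t0r]|re0]; last by rewrite re0 eqxx in rn0.
have b0 n : 0 <= beta n by apply: le_trans (cmod_ge0 _) (hbeta n t0 t0i t0r).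
have [d d0 hd] := expRB1_small (divr_gt0 e2 (expR_gt0 S)).
have [K0 hK0] := summable_tail b0 sb d0.
pose K := maxn L K0.
have [P [hP1 hP2]] := fin K L r _ r01 e2.
exists P; split => [k hk|tau ht].
  by rewrite hP1 // stab // (leq_trans (ltnW hk)) // leq_maxl.
move=> hr; have := hP2 tau ht hr; rewrite divr1 in hr *; rewrite !expr0 !mulr1 => hP.
pose b n := h n tau - 1.
have hbn n : cmod (b n) <= beta n by exact: hbeta.
have E n : 1 + b n = h n tau by rewrite /b addrC subrK.
have hl : clim (fun N => \prod_(n < N) (1 + b n)) (F tau).
  by apply: clim_ext (hF tau ht) => N; apply: eq_bigr => n _; rewrite E.
have := prod_lim_tail (M := K) hbn hl (hS K) (fun N => hK0 K N (leq_maxr _ _)).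
have -> : \prod_(n < K) (1 + b n) = \prod_(n < K) h n tau by apply: eq_bigr => n _; rewrite E.
move=> t1; rewrite (le_trans (cmod_trans _ (\prod_(n < K) h n tau) _)) // (splitr e) lerD //.
by rewrite (le_trans t1) // mulrC -ler_pdivlMr ?expR_gt0 // hd.
Qed.

End IntegralExpansions.

(** * Expansions of the Euler product, its inverse, and quotients of Delta *)

Section EulerExpansion.
Variable R : realType.
Local Notation C := R[i].
Implicit Types (F G : C -> C) (tau : C).

Lemma cmod_expS_le (z : C) (r : R) n : cmod z <= r -> 0 <= r < 1 ->
  cmod (z ^+ n.+1) <= r * r ^+ n.
Proof. by move=> zr /andP[r0 r1]; rewrite cmodX -exprS lerXn2r ?nnegrE ?cmod_ge0. Qed.

Lemma one_sub_ge (z : C) (r : R) n : cmod z <= r -> 0 <= r < 1 ->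
  1 - r <= cmod (1 - z ^+ n.+1).
Proof.
move=> zr r01; have := cmodB_ge 1 (z ^+ n.+1); rewrite cmod1 => h.
apply: le_trans h; rewrite lerD2l lerN2 (le_trans (cmod_expS_le n zr r01)) //.
by case/andP: r01 => r0 r1; rewrite ler_piMr // exprn_ile1 // ltW.
Qed.

Lemma iqexp_euler : iqexp 1 0 1 (fun tau : C => euler (ce tau)).
Proof.
pose g (n k : nat) : C := (k == 0%N)%:R - (k == n.+1)%:R.
apply: (@iqexp_iprod _ g (fun n tau => 1 - ce tau ^+ n.+1)).
- by move=> n k; apply: alg_integerD; [|apply: alg_integerN]; exact: alg_integer_nat.
- by move=> n; rewrite /g /= subr0.
- move=> n k /andP[k0 kn]; rewrite /g (gtn_eqF k0) ltn_eqF ?subrr // ltnS.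
- move=> n L r e _ e0; exists (1 - 'X^(n.+1)); split => [k _|tau _ _].
    by rewrite coefB coefXn coef1.
  by rewrite divr1 expr0 mulr1 hornerD hornerN hornerXn -polyC1 hornerC subrr cmod0 ltW.
- move=> r r01; exists (fun n => r * r ^+ n); split.
    by apply: summableZ; [case/andP: r01|exact: summable_geom].
  by move=> n tau _ hr; rewrite addrAC subrr add0r cmodN cmod_expS_le.
move=> tau ht; exact: (euler_lim (cmod_ce_lt1 ht)).
Qed.

(** Each inverse factor is a geometric series with coefficients 0 and 1; this is why division by
    Delta preserves integrality of coefficients. *)
Lemma iqexp_eulerV : iqexp 1 0 1 (fun tau : C => (euler (ce tau))^-1).
Proof.
pose g (n k : nat) : C := (n.+1 %| k)%:R.
apply: (@iqexp_iprod _ g (fun n tau => (1 - ce tau ^+ n.+1)^-1)).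
- by move=> n k; exact: alg_integer_nat.
- by move=> n; rewrite /g dvdn0.
- by move=> n k /andP[k0 kn]; rewrite /g gtnNdvd.
- move=> n L r e r01 e0; have /andP[r0 r1] := r01.
  have r1' : 0 < 1 - r by rewrite subr_gt0.
  have h0 j : 0 <= r ^+ j by rewrite exprn_ge0.
  have [K hK] := summable_tail h0 (summable_geom r01) (mulr_gt0 e0 r1').
  pose J := (maxn L K).+1; exists ((\poly_(j < J) 1) \Po 'X^(n.+1)); split => [k hk|tau ht].
    rewrite coef_comp_poly_Xn // /g; case: ifP => // _; rewrite coef_poly.
    by rewrite ltnS (leq_trans (leq_div _ _)) // (leq_trans (ltnW hk)) // leq_maxl.
  rewrite divr1 expr0 mulr1 horner_comp hornerXn horner_poly => hr.
  set y := ce tau ^+ n.+1.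
  have y1 : 1 - r <= cmod (1 - y) by exact: one_sub_ge.
  have y0 : 1 - y != 0 by rewrite -cmod_gt0 (lt_le_trans r1').
  under eq_bigr => j _ do rewrite mul1r.
  have -> : (1 - y)^-1 - \sum_(j < J) y ^+ j = y ^+ J / (1 - y).
    have := subrX1 y J => e1; apply: (mulfI y0); rewrite mulrBr divff //.
    have -> : (1 - y) * \sum_(i < J) y ^+ i = 1 - y ^+ J by rewrite -[1 - y]opprB mulNr -e1 opprB.
    by rewrite subKr mulrCA mulfV // mulr1.
  rewrite cmodM cmodV ler_pdivrMr; last by rewrite (lt_le_trans r1').
  apply: (@le_trans _ _ (e * (1 - r))); last by rewrite ler_pM2l.
  rewrite cmodX; apply: (@le_trans _ _ (r ^+ J)).
    rewrite lerXn2r ?nnegrE ?cmod_ge0 // (le_trans (cmod_expS_le n hr r01)) //.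
    by rewrite ler_piMr // exprn_ile1 // ltW.
  have KJ : (K <= J)%N by rewrite /J (leq_trans (leq_maxr L K)).
  by have := hK J J.+1 KJ; rewrite big_nat1.
- move=> r r01; exists (fun n => r / (1 - r) * r ^+ n); have /andP[r0 r1] := r01; split.
    by apply: summableZ; [rewrite divr_ge0 // subr_ge0 ltW|exact: summable_geom].
  move=> n tau _ hr; have h1 := one_sub_ge n hr r01.
  have r1' : 0 < 1 - r by rewrite subr_gt0.
  have y0 : 1 - ce tau ^+ n.+1 != 0 by rewrite -cmod_gt0 (lt_le_trans r1').
  have -> : (1 - ce tau ^+ n.+1)^-1 - 1 = ce tau ^+ n.+1 / (1 - ce tau ^+ n.+1).
    by move: (ce tau ^+ n.+1) y0 => y y0; field.
  rewrite cmodM cmodV mulrAC ler_pM ?invr_ge0 ?cmod_ge0 ?cmod_expS_le //.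
  by rewrite lef_pV2 ?posrE // (lt_le_trans r1').
move=> tau ht; have q1 := cmod_ce_lt1 ht.
by apply: clim_ext (climV (euler_neq0 q1) (euler_lim q1)) => K; rewrite prodfV.
Qed.

Lemma Im_affine (a b d : nat) tau : (0 < a)%N -> (0 < d)%N -> 0 < complex.Im tau ->
  0 < complex.Im ((a%:R * tau + b%:R) / d%:R).
Proof.
move=> a0 d0; have E (k : nat) : (k%:R : C) = (k%:R : R)%:C by rewrite rmorph_nat.
rewrite !E -fmorphV; case: tau => u v /= h.
by rewrite !(mul0r, mulr0, addr0, add0r) !mulr_gt0 // ?invr_gt0 ltr0n.
Qed.

Lemma cmod_ce_frac (b d : nat) : cmod (ce (b%:R / d%:R) : C) = 1.
Proof.
have -> : (b%:R / d%:R : C) = (b%:R / d%:R : R)%:C by rewrite rmorphM fmorphV !rmorph_nat.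
by rewrite cmod_ce /= mulr0 oppr0 expR0.
Qed.

Lemma alg_integer_ce_fracV (k n : nat) : (0 < n)%N -> alg_integer (ce (k%:R / n%:R) : C)^-1.
Proof.
move=> n0; apply: (alg_integer_unit_root n0); rewrite exprVn -ceMn mulrC divfK ?ce_nat ?invr1 //.
by rewrite pnatr_eq0 -lt0n.
Qed.

(** Since a/d = a^2/(ad), all matrices of determinant n = ad share the variable x = q^(1/n). *)
Lemma ce_affine (a b d : nat) tau : (0 < a)%N -> (0 < d)%N ->
  ce ((a%:R * tau + b%:R) / d%:R) = ce (b%:R / d%:R) * ce (tau / (a * d)%:R) ^+ (a * a).
Proof.
move=> a0 d0; have a0' : (a%:R : C) != 0 by rewrite pnatr_eq0 -lt0n.
have d0' : (d%:R : C) != 0 by rewrite pnatr_eq0 -lt0n.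
by rewrite -ceMn -ceD; congr ce; rewrite !natrM; field; rewrite a0' d0'.
Qed.

Lemma iqexp_affine (a b d m : nat) c F : (0 < a)%N -> (0 < d)%N -> iqexp 1 m c F ->
  iqexp (a * d) (a * a * m) ((ce (b%:R / d%:R))^-1 ^+ m * c)
    (fun tau => F ((a%:R * tau + b%:R) / d%:R)).
Proof.
move=> a0 d0; apply: iqexp_comp; rewrite ?muln_gt0 ?a0 ?cmod_ce_frac //.
- exact: alg_integer_ce_frac.
- exact: alg_integer_ce_fracV.
- by move=> tau; exact: Im_affine.
by move=> tau; rewrite divr1 ce_affine.
Qed.

Lemma iqexp_level (n m : nat) c F : (0 < n)%N -> iqexp 1 m c F -> iqexp n (n * m) c F.
Proof.
move=> n0 hF; rewrite -[c]mul1r -{1}(expr1n _ m) -[1 in X in X ^+ m]invr1.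
apply: (iqexp_comp (g := id)) hF; rewrite ?cmod1 ?invr1 //; try exact: alg_integer1.
by move=> tau; rewrite mul1r ?divr1 ?mulr1 -ceMn mulrC divfK // pnatr_eq0 -lt0n.
Qed.

(** The leading power is q / q^(a/d) = x^(ad - a^2), up to a root of unity. A bound [m] strictly
    above a^2 - ad is allowed and has leading coefficient 0. *)
Lemma iqexp_euler_quot (D : C) (e a b d m : nat) : alg_integer D ->
  (0 < a)%N -> (0 < d)%N -> (a * a <= m + a * d)%N ->
  iqexp (a * d) m (if (m + a * d == a * a)%N then D * (ce (b%:R / d%:R))^-1 else 0)
    (fun tau => D * (ce tau * euler (ce tau) ^+ e) /
       (ce ((a%:R * tau + b%:R) / d%:R) * euler (ce ((a%:R * tau + b%:R) / d%:R)) ^+ e)).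
Proof.
move=> hD a0 d0 hm; have n0 : (0 < a * d)%N by rewrite muln_gt0 a0.
set z : C := ce (b%:R / d%:R); set c := D * z^-1.
have hc : alg_integer c by apply: alg_integerM => //; exact: alg_integer_ce_fracV.
have h1 : iqexp (a * d) m (if (m + a * d - a * a == 0)%N then c else 0)
    (fun tau => D * ce tau / ce ((a%:R * tau + b%:R) / d%:R)).
  apply: iqexp_monom => // tau _; rewrite ce_affine // -/z.
  have -> : ce tau = ce (tau / (a * d)%:R) ^+ (a * d).
    by rewrite -ceMn mulrC divfK // pnatr_eq0 -lt0n.
  have := ce_neq0 (tau / (a * d)%:R); move: (ce (tau / _)) (ce_neq0 (b%:R / d%:R) : z != 0) => x z0 x0.
  have e1 : x ^+ (m + a * d - a * a) * x ^+ (a * a) = x ^+ m * x ^+ (a * d).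
    by rewrite -!exprD subnK.
  have -> : x ^+ (m + a * d - a * a) = x ^+ m * x ^+ (a * d) / x ^+ (a * a).
    by rewrite -e1 mulfK // expf_neq0.
  rewrite /c; move: (x ^+ m) (x ^+ (a * d)) (x ^+ (a * a)) (expf_neq0 (a * a) x0).
  by move=> u v p p0; field; rewrite z0 p0.
have h2 := iqexpX e (iqexp_level n0 iqexp_euler).
have h3 := iqexpX e (iqexp_affine b a0 d0 iqexp_eulerV).
have := iqexpM h1 (iqexpM h2 h3).
rewrite !muln0 !addn0 expr0 !mul1r !expr1n !mulr1 subn_eq0.
have -> : (m + a * d <= a * a)%N = (m + a * d == a * a)%N by rewrite eqn_leq hm andbT.
apply: iqexp_ext => tau _; rewrite exprVn [in RHS]invfM.
by move: (euler (ce tau) ^+ e) ((euler _ ^+ e)^-1) => u v; ring.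
Qed.

Lemma iqexp_Delta_quot (a b d m : nat) : (0 < a)%N -> (0 < d)%N -> (a * a <= m + a * d)%N ->
  iqexp (a * d) m (if (m + a * d == a * a)%N then d%:R ^+ 12 * (ce (b%:R / d%:R))^-1 else 0)
    (fun tau => d%:R ^+ 12 * Delta tau / Delta ((a%:R * tau + b%:R) / d%:R) : C).
Proof.
move=> a0 d0 hm; apply: iqexp_euler_quot => //.
by apply: alg_integerX; exact: alg_integer_nat.
Qed.

End EulerExpansion.

(** * Modular functions of level one as polynomials in J *)

Section LevelOne.
Variable R : realType.
Local Notation C := R[i].
Implicit Types (F J : C -> C) (tau : C) (a : nat -> C).

Definition modular F := forall tau, 0 < complex.Im tau ->
  F (tau + 1) = F tau /\ F (- tau^-1) = F tau.

Lemma Im_addr tau (x : R) : complex.Im (tau + x%:C) = complex.Im tau.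
Proof. by case: tau => u v /=; rewrite addr0. Qed.

Lemma modular_addz F tau (k : int) : modular F -> 0 < complex.Im tau -> F (tau + k%:~R) = F tau.
Proof.
move=> hF; have E (j : int) : (j%:~R : C) = (j%:~R : R)%:C by rewrite rmorph_int.
have nat_case t (n : nat) : 0 < complex.Im t -> F (t + n%:R) = F t.
  move=> ht; elim: n => [|n IH]; first by rewrite addr0.
  rewrite -natr1 addrA (proj1 (hF _ _)) //.
  by rewrite -(rmorph_nat (real_complex R)) Im_addr.
move=> ht; case: k => n; first exact: nat_case.
rewrite NegzE rmorphN /= -pmulrn -[in RHS](subrK n.+1%:R tau) nat_case //.
by rewrite -(rmorph_nat (real_complex R)) -rmorphN /= Im_addr.
Qed.

(* Inverting a translate with [|Re| <= 1/2] at least doubles an imaginary part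
   below [1/2]. *)
Lemma modular_reduce tau : 0 < complex.Im tau -> exists2 t : C, 1 / 2 <= complex.Im t &
  forall F, modular F -> F tau = F t.
Proof.
move=> h0; have [k hk] : exists k, 1 / 2 <= complex.Im tau * 2 ^+ k.
  have := truncnS_gt (1 / complex.Im tau); set n := (Num.truncn _).+1 => hn; exists n.
  have h1 : (n%:R : R) <= 2 ^+ n by rewrite -natrX ler_nat ltnW // ltn_expl.
  have h2 : 1 <= complex.Im tau * n%:R by rewrite mulrC -ler_pdivrMr // ltW.
  have := ler_wpM2l (ltW h0) h1; lra.
elim: k tau h0 hk => [|k IH] tau h0 hk.
  by exists tau => //; rewrite expr0 mulr1 in hk.
have [big|small] := lerP (1 / 2) (complex.Im tau); first by exists tau.
pose m := Num.floor (complex.Re tau + 1 / 2).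
pose s := tau + (- m)%:~R.
have E (j : int) : (j%:~R : C) = (j%:~R : R)%:C by rewrite rmorph_int.
have si : complex.Im s = complex.Im tau by rewrite /s E Im_addr.
have s0 : 0 < complex.Im s by rewrite si.
have sr : complex.Re s ^+ 2 <= 1 / 4.
  have -> : complex.Re s = complex.Re tau - m%:~R.
    by rewrite /s E; case: (tau) => u v /=; rewrite rmorphN.
  have := floor_le_tmp (complex.Re tau + 1 / 2); have := floorD1_gt (complex.Re tau + 1 / 2).
  rewrite -/m rmorphD /= => h1 h2; nra.
have i0 := Im_invN s0.
have hi : complex.Im tau * 2 <= complex.Im (- s^-1).
  move: s0 sr; rewrite -si; case: (s) si => u v /= si v0 u2; rewrite opprK.
  have D0 : 0 < u ^+ 2 + v ^+ 2 by rewrite ltr_wpDl ?sqr_ge0 // exprn_gt0.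
  by rewrite ler_pdivlMr //; move: small; rewrite -si => small; nra.
have hk' : 1 / 2 <= complex.Im (- s^-1) * 2 ^+ k.
  by rewrite (le_trans hk) // exprS mulrA ler_pM2r ?exprn_gt0.
have [t ht hF] := IH _ i0 hk'; exists t => // F mF.
by rewrite -hF // (proj2 (mF _ s0)) /s modular_addz.
Qed.

(** The square of e^(pi/2) >= 1 + pi/2 >= 2. *)
Lemma expR_Npi_le : expR (- pi) <= 1 / 4 :> R.
Proof.
have p2 := pi_ge2 R; rewrite expRN -[leRHS]mul1r mul1r div1r lef_pV2 ?posrE ?expR_gt0 //.
have h : 1 + pi / 2 <= expR (pi / 2 : R) by exact: expR_ge1Dx.
have -> : expR pi = expR (pi / 2 : R) ^+ 2.
  by rewrite -expRM_natl; congr expR; field.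
rewrite expr2; nra.
Qed.

Lemma cmod_ce_le4 tau : 1 / 2 <= complex.Im tau -> cmod (ce tau) <= 1 / 4.
Proof.
move=> h; rewrite cmod_ce (le_trans _ expR_Npi_le) // ler_expR lerN2.
have := pi_gt0 R; nra.
Qed.

Lemma sum_tail_geom (s : R) (m n : nat) : 0 <= s <= 1 / 3 ->
  \sum_(k < n | (m < k)%N) s ^+ k <= s ^+ m.+1 * (3 / 2).
Proof.
move=> /andP[s0 s1].
have geo j : \sum_(i < j) s ^+ i <= 3 / 2.
  have := subrX1 s j; have : 0 <= s ^+ j by rewrite exprn_ge0.
  move: (s ^+ j) (\sum_(i < j) s ^+ i) => x y x0 e; nra.
have [nm|mn] := leqP n m.+1.
  rewrite big_pred0 ?mulr_ge0 ?exprn_ge0 // => k.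
  by apply/negbTE; rewrite -leqNgt -ltnS (leq_trans (ltn_ord k)).
rewrite (le_trans _ (ler_wpM2l _ (geo (n - m.+1)%N))) ?exprn_ge0 //.
rewrite mulr_sumr -(big_mkord (fun k => m < k)%N (fun k => s ^+ k)).
rewrite (big_cat_nat (leq0n m.+1) (ltnW mn)) /= big_nat_cond big_pred0; last first.
  by move=> k; rewrite andbC ltnS; case: ltnP => //= h; rewrite andbF.
rewrite add0r big_nat_cond -{1}[m.+1]add0n big_addn big_mkord.
rewrite big_mkcond; apply: ler_sum => i _; case: ifP => _; rewrite -exprD addnC //.
exact: exprn_ge0.
Qed.

(* A bound [K] for [|F|] on [Im tau >= 1/2], hence on the whole upper half
   plane, improves to [K / 2] when the first [m + 1] coefficients vanish. *)
Lemma modular_contract F m a (B : R) : qexp 1 m a F -> (forall k, (k <= m)%N -> a k = 0) ->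
  (forall tau, 0 < complex.Im tau -> cmod (ce tau) = 3 / 4 -> cmod (F tau * ce tau ^+ m) <= B) ->
  forall tau, 1 / 2 <= complex.Im tau -> cmod (F tau) <= B / (3 / 4) ^+ m / 2.
Proof.
move=> hF ha hB tau hi; have i0 : 0 < complex.Im tau by rewrite (lt_le_trans _ hi).
have x4 := cmod_ce_le4 hi; set x := ce tau in x4 *.
have x0 : 0 < cmod x by rewrite cmod_gt0 ce_neq0.
(* With |x| <= 1/4 the ratio s = |x|/r is at most 1/3, and the tail bound s^(m+1) * 3/2 is at most
   s^m / 2: this is the factor 2 gained. *)
set r : R := 3 / 4; have r0 : 0 < r by rewrite divr_gt0.
have r01 : 0 < r < 1 by rewrite r0 /r; lra.
have r01' : 0 <= r < 1 by rewrite ltW //; case/andP: r01.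
have rm0 : 0 < r ^+ m by rewrite exprn_gt0.
have xm0 : 0 < cmod x ^+ m by rewrite exprn_gt0.
apply/ler_addgt0Pr => d d0.
(* The approximation error [e] enters divided by |x|^m and by 2 r^m; with [e = d / W] the total
   stays below [d]. *)
set W := (cmod x ^+ m)^-1 + (r ^+ m)^-1; have W0 : 0 < W by rewrite addr_gt0 ?invr_gt0.
set e := d / W; have e0 : 0 < e by rewrite divr_gt0.
have [P [hP1 hP2]] := hF m.+1 r e r01' e0.
have hc k : cmod P`_k * r ^+ k <= e + B.
  apply: (@poly_cauchy _ 1 P r (e + B) k isT r01) => t ht hr.
  have := hP2 t ht; rewrite hr lexx => /(_ isT); rewrite !divr1 in hr * => h1.
  have h2 := hB t ht hr.
  rewrite -(subrK (F t * ce t ^+ m) P.[ce t]) (le_trans (cmodD _ _)) // lerD //.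
  by rewrite cmod_distC.
have eB0 : 0 <= e + B by apply: le_trans (hc 0%N); rewrite mulr_ge0 ?cmod_ge0 ?exprn_ge0 ?ltW.
set s := cmod x / r.
have s13 : 0 <= s <= 1 / 3.
  apply/andP; split; first by rewrite divr_ge0 ?cmod_ge0 // ltW.
  by rewrite ler_pdivrMr // /r; lra.
have hPx : cmod P.[x] <= (e + B) * (s ^+ m.+1 * (3 / 2)).
  rewrite horner_coef (bigID (fun k : 'I_(size P) => (m < k)%N)) /= addrC big1 ?add0r; last first.
    by move=> k; rewrite -leqNgt => km; rewrite hP1 // ha // mul0r.
  rewrite (le_trans (cmod_sum _ _ _)) // (le_trans _ (ler_wpM2l eB0 (sum_tail_geom m (size P) s13))) //.
  rewrite mulr_sumr; apply: ler_sum => k _; rewrite cmodM cmodX.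
  have rk0 : 0 < r ^+ k by rewrite exprn_gt0.
  rewrite /s expr_div_n mulrA ler_pdivlMr // mulrAC ler_wpM2r ?exprn_ge0 ?cmod_ge0 //.
have := hP2 tau i0; rewrite divr1 -/x => /(_ _) h3.
have {}h3 : cmod (F tau * x ^+ m - P.[x]) <= e by apply: h3; rewrite /r; lra.
have h4 : cmod (F tau) * cmod x ^+ m <= e + (e + B) * (s ^+ m.+1 * (3 / 2)).
  rewrite -cmodX -cmodM -(subrK P.[x] (F tau * _)) (le_trans (cmodD _ _)) //.
  by rewrite lerD.
have h5 : cmod (F tau) <= e / cmod x ^+ m + (e + B) / r ^+ m / 2.
  rewrite -(ler_pM2r xm0) (le_trans h4) // [leRHS]mulrDl divfK ?gt_eqF // lerD2l.
  rewrite -!mulrA ler_wpM2l // exprS mulrA.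
  have -> : s ^+ m = (r ^+ m)^-1 * cmod x ^+ m by rewrite /s expr_div_n mulrC.
  have : 0 <= (r ^+ m)^-1 * cmod x ^+ m by rewrite mulr_ge0 ?invr_ge0 ?ltW.
  rewrite [_ / 2 * _]mulrAC; move: ((r ^+ m)^-1 * cmod x ^+ m) => y y0.
  by case/andP: s13 => s0 s1; nra.
rewrite (le_trans h5) //.
have : e * W = d by rewrite /e divfK // gt_eqF.
have : 0 <= e * (r ^+ m)^-1 by rewrite mulr_ge0 ?invr_ge0 ?ltW.
rewrite /W mulrDr !mulrDl; lra.
Qed.

(** Takes the place of the maximum principle. A bound on the half plane holds on |q| = 3/4, is
    halved on Im tau >= 1/2 by [modular_contract], and spreads back by [modular_reduce]; iteration
    drives it to 0. *)
Lemma modular_vanish F m a : modular F -> qexp 1 m a F -> (forall k, (k <= m)%N -> a k = 0) ->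
  forall tau, 0 < complex.Im tau -> F tau = 0.
Proof.
move=> mF hF ha.
have r01 : 0 <= (3 / 4 : R) < 1 by apply/andP; split; lra.
have rm0 : 0 < (3 / 4 : R) ^+ m by rewrite exprn_gt0.
have [B B0 hB] := qexp_bounded hF r01.
have ext (K : R) : (forall tau, 1 / 2 <= complex.Im tau -> cmod (F tau) <= K) ->
   forall tau, 0 < complex.Im tau -> cmod (F tau) <= K.
  by move=> h tau ht; have [t t2 e] := modular_reduce ht; rewrite (e F mF) h.
pose K0 := B / (3 / 4) ^+ m / 2.
have h0 : forall tau, 0 < complex.Im tau -> cmod (F tau) <= K0.
  apply: ext; apply: (modular_contract hF ha) => tau ht hr.
  by have := hB tau ht; rewrite !divr1 hr lexx => /(_ isT).
have hn n : forall tau, 0 < complex.Im tau -> cmod (F tau) <= K0 / 2 ^+ n.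
  elim: n => [|n IH]; first by rewrite expr0 divr1.
  apply: ext => tau ht.
  have -> : K0 / 2 ^+ n.+1 = K0 / 2 ^+ n * (3 / 4) ^+ m / (3 / 4) ^+ m / 2.
    by rewrite mulfK ?gt_eqF // exprSr invfM mulrA.
  apply: (modular_contract hF ha) => // t h1 h2.
  by rewrite cmodM cmodX h2 ler_pM2r // IH.
move=> tau ht; apply/eqP; rewrite -cmod_eq0 eq_le cmod_ge0 andbT.
apply/ler_addgt0Pr => e e0; rewrite add0r.
have K00 : 0 <= K0 by apply: le_trans (h0 tau ht); exact: cmod_ge0.
set n := (Num.truncn (K0 / e)).+1; apply: le_trans (hn n tau ht) _.
rewrite ler_pdivrMr ?exprn_gt0 // mulrC -ler_pdivrMr //.
by rewrite (le_trans (ltW (truncnS_gt _))) // -/n -natrX ler_nat ltnW // ltn_expl.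
Qed.

(** Since J = q^-1 + ..., subtracting integral multiples of J^m, ..., J^0 clears the coefficients of
    q^-m, ..., q^0 in turn, without division; what remains is 0 by [modular_vanish]. *)
Lemma modular_poly J F m c : modular J -> iqexp 1 1 1 J -> modular F -> iqexp 1 m c F ->
  exists P : {poly C}, [/\ forall k, alg_integer P`_k, (size P <= m.+1)%N, P`_m = c &
    forall tau, 0 < complex.Im tau -> F tau = P.[J tau]].
Proof.
move=> mJ hJ mF [a [a1 a2 a3]].
have modP (P : {poly C}) : modular (fun tau => F tau - P.[J tau]).
  by move=> tau ht; rewrite !(proj1 (mF _ ht), proj1 (mJ _ ht), proj2 (mF _ ht), proj2 (mJ _ ht)).
(* The clause for [t = 0] lets the first subtraction, that of c J^m, fix the top coefficient of [P];
   later ones touch lower degrees only. *)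
have step t : (t <= m.+1)%N -> exists P : {poly C}, exists b : nat -> C,
    [/\ forall k, alg_integer P`_k, (size P <= m.+1)%N, ((0 < t)%N -> P`_m = c) &
     [/\ (t = 0%N -> P = 0 /\ b 0%N = c), forall k, alg_integer (b k), forall k, (k < t)%N -> b k = 0 &
     qexp 1 m b (fun tau => F tau - P.[J tau])]].
  elim: t => [_|t IH tm].
    exists 0, a; split; rewrite ?size_poly0 //.
      by move=> k; rewrite coef0; exact: alg_integer0.
    by split => //; apply: qexp_ext a3 => tau _; rewrite horner0 subr0.
  have [P [b [P1 P2 P3 [b0 b1 b2 b3]]]] := IH (ltnW tm).
  have [j [j1 j2 j3]] := iqexpX (m - t) hJ.
  have dm : (m - t + t = m)%N by rewrite subnK // -ltnS.
  rewrite muln1 in j3; have := qexp_shift t j3; rewrite dm expr1n in j2 * => j4.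
  have := qexpD b3 (qexpM (qexp_cst 1 (- b t)) j4) => h.
  exists (P + b t *: 'X^(m - t)), (fun k => b k - b t * shift t j k); split.
  - move=> k; rewrite coefD coefZ coefXn; apply: alg_integerD => //.
    by apply: alg_integerM => //; exact: alg_integer_nat.
  - rewrite (leq_trans (size_polyD _ _)) // geq_max P2 (leq_trans (size_scale_leq _ _)) //.
    by rewrite size_polyXn ltnS leq_subr.
  - move=> _; rewrite coefD coefZ coefXn; case: t tm {IH} P3 b0 b1 b2 b3 j1 j2 j3 dm j4 h => [|t] tm P3 b0 *.
      by have [-> ->] := b0 erefl; rewrite coef0 add0r subn0 eqxx mulr1.
    rewrite P3 // gtn_eqF ?mulr0 ?addr0 //.
    by have := tm; lia.
  split => //.
  - move=> k; apply: alg_integerD => //; apply: alg_integerN; apply: alg_integerM => //.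
    by rewrite /shift; case: ifP => _; [exact: alg_integer0|exact: j1].
  - move=> k; rewrite ltnS leq_eqVlt => /orP[/eqP ->|kt].
      by rewrite /shift ltnn subnn j2 mulr1 subrr.
    by rewrite b2 // /shift kt mulr0 subr0.
  apply: qexp_ext (eq_qexp _ h) => [tau _|k].
    by rewrite hornerD hornerZ hornerXn mulNr opprD addrA.
  rewrite /conv big_ord_recl /= subn0 big1 ?addr0 ?mulNr // => i _.
  by rewrite mul0r.
have [P [b [P1 P2 P3 [_ _ b2 b3]]]] := step m.+1 (leqnn _).
exists P; split => //; first exact: P3.
move=> tau ht; apply/eqP; rewrite -subr_eq0; apply/eqP.
by apply: (modular_vanish (modP P) b3 _ ht) => k km; exact: b2.
Qed.

End LevelOne.

Lemma int_mul_eq1 (p s : int) : p * s = 1 -> (p = 1 /\ s = 1) \/ (p = -1 /\ s = -1).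
Proof.
move=> h; have : (`|p| * `|s| = 1)%N by rewrite -abszM h.
move=> /eqP; rewrite muln_eq1 => /andP[/eqP p1 /eqP s1].
have : p = 1 \/ p = -1 by lia.
by case=> e; move: h; rewrite e; lia.
Qed.

(** * Hecke correspondences and complex multiplication *)

Section LatticeFunctions.
Variable R : realType.
Local Notation C := R[i].
Implicit Types (phi : C -> C -> C) (w tau : C).

(* A function of the basis [(w1, w2)] of a lattice, invariant under generators
   of SL_2(Z). *)
Definition lattice_fun phi := forall w1 w2, 0 < complex.Im (w1 / w2) ->
  phi (w1 + w2) w2 = phi w1 w2 /\ phi (- w2) w1 = phi w1 w2.

Lemma Im_gt0_neq0 w1 w2 : 0 < complex.Im (w1 / w2) -> w2 != 0 /\ w1 != 0.
Proof.
by move=> h; split; apply/eqP => e; move: h; rewrite e ?invr0 ?mulr0 ?mul0r ltxx.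
Qed.

Lemma lattice_funN phi w1 w2 : lattice_fun phi -> 0 < complex.Im (w1 / w2) ->
  phi (- w1) (- w2) = phi w1 w2.
Proof.
move=> hp h; have [n2 n1] := Im_gt0_neq0 h.
have h' : 0 < complex.Im (- w2 / w1).
  by have := Im_invN h; rewrite invf_div mulNr.
by rewrite (proj2 (hp _ _ h')) (proj2 (hp _ _ h)).
Qed.

Lemma lattice_fun_addz phi w1 w2 (k : int) : lattice_fun phi -> 0 < complex.Im (w1 / w2) ->
  phi (w1 + k%:~R * w2) w2 = phi w1 w2.
Proof.
move=> hp h; have [n2 _] := Im_gt0_neq0 h.
have E (j : int) : (j%:~R : C) = (j%:~R : R)%:C by rewrite rmorph_int.
have shift_im w (j : int) : complex.Im ((w + j%:~R * w2) / w2) = complex.Im (w / w2).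
  by rewrite mulrDl mulfK // E Im_addr.
have nat_case w (n : nat) : 0 < complex.Im (w / w2) -> phi (w + n%:R * w2) w2 = phi w w2.
  move=> hw; elim: n => [|n IH]; first by rewrite mul0r addr0.
  rewrite -natr1 mulrDl mul1r addrA (proj1 (hp _ _ _)) //.
  by rewrite (shift_im w n).
case: k => n; first exact: nat_case.
rewrite NegzE -[in RHS](subrK (n.+1%:R * w2) w1) nat_case; last first.
  by have := shift_im w1 (- n.+1%:Z); rewrite rmorphN mulNr => ->.
by rewrite rmorphN mulNr.
Qed.

Lemma Im_moebius (a b c d : int) tau : 0 < a * d - b * c -> 0 < complex.Im tau ->
  0 < complex.Im ((a%:~R * tau + b%:~R) / (c%:~R * tau + d%:~R)).
Proof.
move=> hD ht; have E (j : int) : (j%:~R : C) = (j%:~R : R)%:C by rewrite rmorph_int.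
have cd : (c != 0) || (d != 0).
  by rewrite -negb_and; apply/negP => /andP[/eqP c0 /eqP d0]; move: hD; rewrite c0 d0 !mulr0 subrr ltxx.
have den := lattice_neq0 ht cd.
have hD' : 0 < (a%:~R * d%:~R - b%:~R * c%:~R : R) by rewrite -!rmorphM -rmorphB ltr0z.
move: den; rewrite !E; case: (tau) ht => u v /= h.
set w := _ +i* _ => den.
have N0 : 0 < (c%:~R * u - 0 * v + d%:~R) ^+ 2 + (c%:~R * v + 0 * u + 0) ^+ 2.
  rewrite lt_def addr_ge0 ?sqr_ge0 // andbT paddr_eq0 ?sqr_ge0 // !sqrf_eq0.
  by move: den; rewrite eq_complex /=.
move: N0; set X := _ - _ + _; set Y := c%:~R * v + _ + _ => N0.
set A := a%:~R * u - _ + _; set B := a%:~R * v + _ + _.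
have -> : A * - (Y / (X ^+ 2 + Y ^+ 2)) + B * (X / (X ^+ 2 + Y ^+ 2)) =
    (a%:~R * d%:~R - b%:~R * c%:~R) * v / (X ^+ 2 + Y ^+ 2).
  by rewrite mulrN !mulrA -mulNr -mulrDl; congr (_ / _); rewrite /A /B /X /Y; ring.
by rewrite divr_gt0 // mulr_gt0.
Qed.

Lemma Im_moebius2 (a b c d : int) w1 w2 : 0 < a * d - b * c -> 0 < complex.Im (w1 / w2) ->
  0 < complex.Im ((a%:~R * w1 + b%:~R * w2) / (c%:~R * w1 + d%:~R * w2)).
Proof.
move=> hD h; have [n2 _] := Im_gt0_neq0 h; have := Im_moebius hD h.
have -> : (a%:~R * (w1 / w2) + b%:~R) / (c%:~R * (w1 / w2) + d%:~R) =
  (a%:~R * w1 + b%:~R * w2) / (c%:~R * w1 + d%:~R * w2); last by [].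
have -> : a%:~R * (w1 / w2) + b%:~R = (a%:~R * w1 + b%:~R * w2) / w2 by field.
have -> : c%:~R * (w1 / w2) + d%:~R = (c%:~R * w1 + d%:~R * w2) / w2 by field.
by rewrite invf_div mulrA divfK.
Qed.

(** Euclid's algorithm on the first column (p, r), by induction on |r|: a translation reduces [p]
    modulo [r], the inversion exchanges them, and r = 0 leaves a translation up to sign. *)
Lemma lattice_fun_sl2 phi (p q r s : int) w1 w2 : lattice_fun phi -> p * s - q * r = 1 ->
  0 < complex.Im (w1 / w2) ->
  phi (p%:~R * w1 + q%:~R * w2) (r%:~R * w1 + s%:~R * w2) = phi w1 w2.
Proof.
move=> hp; have [m] := ubnP `|r|%N; elim: m => // m IH in p q r s w1 w2 *.
rewrite ltnS => rm det h; have det0 : 0 < p * s - q * r by rewrite det.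
have [r0|rn0] := eqVneq r 0.
  rewrite r0 mul0r add0r; move: det; rewrite r0 mulr0 subr0 => ps.
  case: (int_mul_eq1 ps) => [[-> ->]|[-> ->]]; first by rewrite !mul1r lattice_fun_addz.
  rewrite rmorphN !mulN1r -(lattice_fun_addz (- q) hp h) -[RHS]lattice_funN //.
    by congr phi; rewrite rmorphN; ring.
  have [n2 _] := Im_gt0_neq0 h.
  have E (j : int) : (j%:~R : C) = (j%:~R : R)%:C by rewrite rmorph_int.
  by rewrite mulrDl mulfK // E Im_addr.
set k := (p %/ r)%Z.
have hp1 : (p %% r)%Z = p - k * r by rewrite /k {2}(divz_eq p r) addrC addKr.
have lt_pr : (`|(p %% r)%Z| < m)%N.
  have h1 := modz_ge0 p rn0; have h2 := ltz_mod p rn0; lia.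
have imM := Im_moebius2 det0 h.
rewrite -(lattice_fun_addz (- k) hp imM).
set x := (_ + (- k)%:~R * _); set y := (r%:~R * w1 + s%:~R * w2).
have ex : x = (p - k * r)%:~R * w1 + (q - k * s)%:~R * w2.
  by rewrite /x !rmorphB !rmorphM rmorphN /=; ring.
have det1 : (p - k * r) * s - (q - k * s) * r = 1 by rewrite -det; ring.
have imx : 0 < complex.Im (x / y) by rewrite ex; apply: Im_moebius2 => //; rewrite det1.
rewrite -(proj2 (hp _ _ imx)) ex -hp1.
have -> : - y = (- r)%:~R * w1 + (- s)%:~R * w2 by rewrite /y !rmorphN; ring.
apply: IH => //; rewrite hp1 -det; ring.
Qed.

(** The gcd of the first column becomes [a'], its Bezout coefficients complete a unimodular matrix,
    and a Euclidean division reduces [b'] modulo [d']. *)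
Lemma hermite_form (a b c d : int) (n : nat) : (0 < n)%N -> a * d - b * c = n ->
  exists a' d' b' : nat, [/\ (a' * d' = n)%N, (b' < d')%N &
    exists p q r s : int, [/\ p * s - q * r = 1, a = p * a', b = p * b' + q * d', c = r * a' & d = r * b' + s * d']].
Proof.
move=> n0 det; have det0 : 0 < a * d - b * c by rewrite det.
have [[u v] [g0 e]] : exists uv : int * int, 0 < gcdz a c /\ uv.1 * a + uv.2 * c = gcdz a c.
  have [u [v e]] := Bezoutz a c; exists (u, v); split => //.
  rewrite lt_def gcdz_eq0; apply/andP; split; last by [].
  by apply/negP => /andP[/eqP a0 /eqP c0]; move: det0; rewrite a0 c0 mul0r mulr0 subrr ltxx.
move: e => /= e; set g := gcdz a c in g0 e.
have [a1 ea] : exists a1, a = a1 * g by apply/dvdzP; exact: dvdz_gcdl.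
have [c1 ec] : exists c1, c = c1 * g by apply/dvdzP; exact: dvdz_gcdr.
have uv1 : u * a1 + v * c1 = 1.
  apply: (mulIf (lt0r_neq0 g0)); rewrite mul1r -[RHS]e ea ec; ring.
pose b2 := u * b + v * d; pose d2 := a1 * d - c1 * b.
have gd : g * d2 = n by rewrite -det ea ec /d2; ring.
have d20 : 0 < d2 by rewrite -(pmulr_rgt0 _ g0) gd.
have eb : b = a1 * b2 - v * d2.
  by rewrite /b2 /d2 -[b in LHS]mul1r -uv1; ring.
have ed : d = c1 * b2 + u * d2.
  by rewrite /b2 /d2 -[d in LHS]mul1r -uv1; ring.
set k := (b2 %/ d2)%Z; set b3 := (b2 %% d2)%Z.
have hb3 : b2 = k * d2 + b3 by exact: divz_eq.
have b30 : 0 <= b3 by apply: modz_ge0; rewrite gt_eqF.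
have b3d : b3 < d2 by apply: ltz_pmod.
exists `|g|%N, `|d2|%N, `|b3|%N; split; [by lia|by lia|].
exists a1, (a1 * k - v), c1, (c1 * k + u).
have -> : (`|g|%N : int) = g by lia.
have -> : (`|d2|%N : int) = d2 by lia.
have -> : (`|b3|%N : int) = b3 by lia.
split => //.
- by rewrite -uv1; ring.
- by rewrite eb hb3; ring.
- by rewrite ed hb3; ring.
Qed.

Lemma hermite_uniq (a b d a' b' d' : nat) (p q r s : int) : p * s - q * r = 1 ->
  (0 < a)%N -> (0 < a')%N -> (b < d)%N -> (b' < d')%N ->
  a%:Z = p * a' -> b%:Z = p * b' + q * d' -> 0 = r * a' -> d%:Z = r * b' + s * d' ->
  [/\ a = a', b = b' & d = d'].
Proof.
move=> det a0 a'0 bd bd' ea eb er ed.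
have r0 : r = 0 by nia.
rewrite r0 mulr0 subr0 in det; rewrite r0 mul0r add0r in ed.
have [p1 s1] : p = 1 /\ s = 1.
  by case: (int_mul_eq1 det) => // -[p1 s1]; move: ea; rewrite p1; lia.
rewrite p1 mul1r in ea eb; rewrite s1 mul1r in ed.
have q0 : q = 0 by nia.
by rewrite q0 mul0r addr0 in eb; split; lia.
Qed.

End LatticeFunctions.

Local Opaque Delta.

Lemma mulf_divA (K : fieldType) (u v w : K) : u * v / w = v / (w / u).
Proof. by rewrite invf_div mulrCA mulrA. Qed.

Section FieldIdentities.
Variable K : fieldType.
Implicit Types u v w x y : K.

Lemma mulf_swap_den x y v : x != 0 -> x / y * v / x = v / y.
Proof. by move=> x0; rewrite mulrAC [x / y]mulrC mulfK // mulrC. Qed.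

Lemma mulf_divCA u v w : w / (v / u) = u * (w / v).
Proof. by rewrite invf_div mulrCA. Qed.

Lemma mulf_cancelX x v w (n : nat) : x != 0 -> x ^+ n * v / (x ^+ n * w) = v / w.
Proof. by move=> x0; rewrite -mulf_div divff ?mul1r // expf_neq0. Qed.

End FieldIdentities.

(** * Permutation of the matrices of determinant n by the modular group *)

Section Hecke.
Variable R : realType.
Local Notation C := R[i].
Implicit Types (F J : C -> C) (phi : C -> C -> C) (tau : C) (n : nat).

(* The matrix (a b; 0 d) with a * d = n and b < d is encoded as ((a, d), b). *)
Definition herm n := {x : 'I_n.+1 * 'I_n.+1 * 'I_n.+1 | (x.1.1 * x.1.2 == n)%N && (x.2 < x.1.2)%N}.
Definition ha n (x : herm n) : nat := (val x).1.1.
Definition hd n (x : herm n) : nat := (val x).1.2.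
Definition hb n (x : herm n) : nat := (val x).2.

Lemma herm_det n (x : herm n) : (ha x * hd x = n)%N.
Proof. by case/andP: (valP x) => /eqP. Qed.

Lemma herm_lt n (x : herm n) : (hb x < hd x)%N.
Proof. by case/andP: (valP x). Qed.

Lemma herm_pos n (x : herm n) : (0 < n)%N -> (0 < ha x)%N /\ (0 < hd x)%N.
Proof. by rewrite -{1}(herm_det x) muln_gt0 => /andP[]. Qed.

Lemma herm_inj n (x y : herm n) : ha x = ha y -> hb x = hb y -> hd x = hd y -> x = y.
Proof.
rewrite /ha /hb /hd => h1 h2 h3; apply/val_inj.
case: (val x) h1 h2 h3 => [[a d] b]; case: (val y) => [[a' d'] b'] /=.
by move=> /val_inj -> /val_inj -> /val_inj ->.
Qed.

Lemma herm_ex n (a b d : nat) : (0 < n)%N -> (a * d = n)%N -> (b < d)%N ->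
  exists x : herm n, [/\ ha x = a, hb x = b & hd x = d].
Proof.
move=> n0 e bd; have a0 : (0 < a)%N by move: n0; rewrite -e muln_gt0 => /andP[].
have dn : (d < n.+1)%N by rewrite ltnS -e leq_pmull.
have an : (a < n.+1)%N by rewrite ltnS -e leq_pmulr // (leq_ltn_trans _ bd).
have bn : (b < n.+1)%N by exact: ltn_trans bd dn.
have h : (Ordinal an * Ordinal dn == n)%N && (Ordinal bn < Ordinal dn)%N by rewrite /= e eqxx.
by exists (Sub (Ordinal an, Ordinal dn, Ordinal bn) h); rewrite /ha /hb /hd SubK.
Qed.

(** Reduced matrices represent the classes modulo left multiplication by SL_2(Z), which right
    multiplication by [g] permutes; [s x] is the representative of x g. *)
Lemma herm_right_mul n (g1 g2 g3 g4 : int) : (0 < n)%N -> g1 * g4 - g2 * g3 = 1 ->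
  exists2 s : herm n -> herm n, injective s & forall x, exists p q r t : int,
    [/\ p * t - q * r = 1, (ha x)%:Z * g1 + (hb x)%:Z * g3 = p * ha (s x),
        (ha x)%:Z * g2 + (hb x)%:Z * g4 = p * hb (s x) + q * hd (s x),
        (hd x)%:Z * g3 = r * ha (s x) & (hd x)%:Z * g4 = r * hb (s x) + t * hd (s x)].
Proof.
move=> n0 det.
have /boolp.choice[s hs] : forall x : herm n, exists y : herm n, exists p q r t : int,
    [/\ p * t - q * r = 1, (ha x)%:Z * g1 + (hb x)%:Z * g3 = p * ha y,
        (ha x)%:Z * g2 + (hb x)%:Z * g4 = p * hb y + q * hd y,
        (hd x)%:Z * g3 = r * ha y & (hd x)%:Z * g4 = r * hb y + t * hd y].
  move=> x.
  have e : ((ha x)%:Z * g1 + (hb x)%:Z * g3) * ((hd x)%:Z * g4) -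
           ((ha x)%:Z * g2 + (hb x)%:Z * g4) * ((hd x)%:Z * g3) = n.
    rewrite -[n in RHS](herm_det x) PoszM -[RHS]mulr1 -det; ring.
  have [a [d [b [h1 h2 [p [q [r [t [h3 h4 h5 h6 h7]]]]]]]]] := hermite_form n0 e.
  have [y [e1 e2 e3]] := herm_ex n0 h1 h2.
  by exists y, p, q, r, t; rewrite e1 e2 e3.
exists s => // x x' exx.
have [p [q [r [t [h1 h2 h3 h4 h5]]]]] := hs x.
have [p' [q' [r' [t' [k1 k2 k3 k4 k5]]]]] := hs x'.
rewrite -exx in k2 k3 k4 k5.
have [a0 d0] := herm_pos x n0; have [a0' d0'] := herm_pos x' n0.
move: h2 h3 h4 h5 k2 k3 k4 k5.
set A := (ha (s x))%:Z; set B := (hb (s x))%:Z; set D := (hd (s x))%:Z.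
move=> h2 h3 h4 h5 k2 k3 k4 k5.
(* [u] is the matrix (s x) g^-1. Both [x] and [x'] are unimodular left multiples of it, hence of
   each other, and [hermite_uniq] identifies them. *)
pose u1 := A * g4 - B * g3; pose u2 := B * g1 - A * g2; pose u3 := - D * g3; pose u4 := D * g1.
have inv1 (z w : int) : (z * g1 + w * g3) * g4 - (z * g2 + w * g4) * g3 = z.
  by rewrite -[RHS]mulr1 -det; ring.
have inv2 (z w : int) : (z * g2 + w * g4) * g1 - (z * g1 + w * g3) * g2 = w.
  by rewrite -[RHS]mulr1 -det; ring.
have ea : (ha x)%:Z = p * u1 + q * u3 by rewrite -(inv1 (ha x) (hb x)) h2 h3 /u1 /u3; ring.
have eb : (hb x)%:Z = p * u2 + q * u4 by rewrite -(inv2 (ha x) (hb x)) h2 h3 /u2 /u4; ring.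
have ec : 0 = r * u1 + t * u3.
  by rewrite -[LHS](inv1 0 (hd x)) !mul0r !add0r h4 h5 /u1 /u3; ring.
have ed : (hd x)%:Z = r * u2 + t * u4.
  by rewrite -[LHS](inv2 0 (hd x)) !mul0r !add0r h4 h5 /u2 /u4; ring.
have ea' : (ha x')%:Z = p' * u1 + q' * u3 by rewrite -(inv1 (ha x') (hb x')) k2 k3 /u1 /u3; ring.
have eb' : (hb x')%:Z = p' * u2 + q' * u4 by rewrite -(inv2 (ha x') (hb x')) k2 k3 /u2 /u4; ring.
have ec' : 0 = r' * u1 + t' * u3.
  by rewrite -[LHS](inv1 0 (hd x')) !mul0r !add0r k4 k5 /u1 /u3; ring.
have ed' : (hd x')%:Z = r' * u2 + t' * u4.
  by rewrite -[LHS](inv2 0 (hd x')) !mul0r !add0r k4 k5 /u2 /u4; ring.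
have [] := @hermite_uniq (ha x) (hb x) (hd x) (ha x') (hb x') (hd x')
  (p * t' - q * r') (q * p' - p * q') (r * t' - t * r') (t * p' - r * q').
- by rewrite -[RHS]mulr1 -{1}h1 -k1; ring.
- exact: a0.
- exact: a0'.
- exact: herm_lt.
- exact: herm_lt.
- rewrite ea -[LHS]mulr1 -k1 ea'.
  by rewrite -[RHS]addr0 -[X in _ = _ + X](mulr0 (q * p' - p * q')) ec'; ring.
- by rewrite eb eb' ed' -[LHS]mulr1 -k1; ring.
- rewrite ea' ec -[LHS]mulr1 -k1.
  by rewrite -[RHS]addr0 -[X in _ = _ + X](mulr0 (t * p' - r * q')) ec'; ring.
- by rewrite ed eb' ed' -[LHS]mulr1 -k1; ring.
by move=> e1 e2 e3; exact: herm_inj.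
Qed.

Definition herm_val phi n (x : herm n) w1 w2 : C :=
  phi ((ha x)%:R * w1 + (hb x)%:R * w2) ((hd x)%:R * w2).

Lemma herm_val_right_mul phi n (g1 g2 g3 g4 : int) : (0 < n)%N -> g1 * g4 - g2 * g3 = 1 ->
  lattice_fun phi -> exists2 s : herm n -> herm n, injective s &
   forall x w1 w2, 0 < complex.Im (w1 / w2) ->
     herm_val phi x (g1%:~R * w1 + g2%:~R * w2) (g3%:~R * w1 + g4%:~R * w2) =
     herm_val phi (s x) w1 w2.
Proof.
move=> n0 det hp; have [s s1 s2] := herm_right_mul n0 det; exists s => // x w1 w2 h.
have [p [q [r [t [h1 h2 h3 h4 h5]]]]] := s2 x.
have det' : 0 < (ha (s x))%:Z * (hd (s x))%:Z - (hb (s x))%:Z * 0.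
  by rewrite mulr0 subr0 -PoszM herm_det.
have := Im_moebius2 det' h; rewrite mul0r add0r => h'.
rewrite /herm_val -(lattice_fun_sl2 hp h1 h').
have E (i j k l : int) (z w : C) : i%:~R * (j%:~R * z + k%:~R * w) + l%:~R * w = (i * j)%:~R * z + (i * k + l)%:~R * w.
  by rewrite rmorphD !rmorphM /=; ring.
congr phi.
  transitivity (((ha x)%:Z * g1 + (hb x)%:Z * g3)%:~R * w1 + ((ha x)%:Z * g2 + (hb x)%:Z * g4)%:~R * w2).
    by rewrite !rmorphD !rmorphM /=; ring.
  by rewrite h2 h3 rmorphD !rmorphM /=; ring.
transitivity (((hd x)%:Z * g3)%:~R * w1 + ((hd x)%:Z * g4)%:~R * w2).
  by rewrite !rmorphM /=; ring.
by rewrite h4 h5 rmorphD !rmorphM /=; ring.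
Qed.

Definition permuted (I : finType) (F : I -> C -> C) :=
  (exists2 s : I -> I, injective s & forall i tau, 0 < complex.Im tau -> F i (tau + 1) = F (s i) tau) /\
  (exists2 s : I -> I, injective s & forall i tau, 0 < complex.Im tau -> F i (- tau^-1) = F (s i) tau).

Lemma herm_val_permuted phi n : (0 < n)%N -> lattice_fun phi ->
  (exists2 s : herm n -> herm n, injective s &
     forall x tau, 0 < complex.Im tau -> herm_val phi x (tau + 1) 1 = herm_val phi (s x) tau 1) /\
  (exists2 s : herm n -> herm n, injective s &
     forall x tau, 0 < complex.Im tau -> herm_val phi x (- 1) tau = herm_val phi (s x) tau 1).
Proof.
move=> n0 hp; split.
  have [s s1 s2] := @herm_val_right_mul phi n 1 1 0 1 n0 erefl hp.
  exists s => // x tau ht; rewrite -s2 ?divr1 //.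
  by rewrite !mul1r mul0r add0r.
have [s s1 s2] := @herm_val_right_mul phi n 0 (-1) 1 0 n0 erefl hp.
exists s => // x tau ht; rewrite -s2 ?divr1 //.
by rewrite !mul0r add0r addr0 mul1r mulr1 rmorphN.
Qed.

Lemma modular_lattice J : modular J -> lattice_fun (fun w1 w2 => J (w1 / w2)).
Proof.
move=> mJ w1 w2 h; have [n2 n1] := Im_gt0_neq0 h; have [h1 h2] := mJ _ h.
by rewrite mulrDl divff // h1 -h2 invf_div mulNr.
Qed.

Lemma modular_permuted J n : (0 < n)%N -> modular J ->
  permuted (fun (x : herm n) tau => J (((ha x)%:R * tau + (hb x)%:R) / (hd x)%:R)).
Proof.
move=> n0 mJ.
have [[s s1 s2] [t t1 t2]] := herm_val_permuted n0 (modular_lattice mJ).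
split; [exists s => //|exists t => //] => x tau ht.
  by have := s2 x tau ht; rewrite /herm_val !mulr1.
have := t2 x tau ht; rewrite /herm_val !mulr1 => <-; congr J.
have [_ d0] := herm_pos x n0; have d0' : ((hd x)%:R : C) != 0 by rewrite pnatr_eq0 -lt0n.
have t0 : tau != 0 by apply/eqP => e; move: ht; rewrite e ltxx.
by field; rewrite t0 d0'.
Qed.

(** Homogeneous of degree -12 in the basis: the weight 12 law of Delta becomes invariance under
    change of basis. *)
Definition Delta_lat w1 w2 : C := Delta (w1 / w2) / w2 ^+ 12.

Lemma Delta_lattice : lattice_fun Delta_lat.
Proof.
move=> w1 w2 h; have [n2 n1] := Im_gt0_neq0 h.
have e := Delta_inv h; rewrite invf_div expr_div_n in e.
have e1 : (w1 + w2) / w2 = w1 / w2 + 1 by rewrite mulrDl divff.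
have e2 : Delta ((w1 + w2) / w2) = Delta (w1 / w2) by rewrite e1; exact: Delta_addn.
have e3 : Delta (- w2 / w1) = w1 ^+ 12 / w2 ^+ 12 * Delta (w1 / w2) by rewrite mulNr.
split; first exact: (congr1 (fun z => z / w2 ^+ 12) e2).
apply: (etrans (congr1 (fun z => z / w1 ^+ 12) e3)).
exact: mulf_swap_den (expf_neq0 12 n1).
Qed.

Lemma Delta_lat_scale (u w1 w2 : C) : u != 0 ->
  Delta_lat (w1 / u) (w2 / u) = u ^+ 12 * Delta_lat w1 w2.
Proof.
move=> u0; rewrite /Delta_lat.
have -> : w1 / u / (w2 / u) = w1 / w2.
  by rewrite invf_div mulrA divfK.
by rewrite expr_div_n; exact: mulf_divCA.
Qed.

Definition Delta_quot n (x : herm n) tau : C :=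
  (hd x)%:R ^+ 12 * Delta tau / Delta (((ha x)%:R * tau + (hb x)%:R) / (hd x)%:R).

Lemma Delta_quotE n (x : herm n) tau : Delta_quot x tau = Delta tau / herm_val Delta_lat x tau 1.
Proof.
rewrite /Delta_quot /herm_val (mulr1 (hb x)%:R) (mulr1 (hd x)%:R).
exact: mulf_divA.
Qed.

Local Opaque Delta_lat Delta_quot.

Lemma Delta_quot_permuted n : (0 < n)%N -> permuted (@Delta_quot n).
Proof.
move=> n0; have [[s s1 s2] [t t1 t2]] := herm_val_permuted n0 Delta_lattice; split.
  exists s => [|x tau ht]; first exact: s1.
  by rewrite !Delta_quotE (s2 x tau ht) (Delta_addn tau).
exists t => [|x tau ht]; first exact: t1.
have t0 : tau != 0 by apply/eqP => e; move: ht; rewrite e ltxx.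
rewrite !Delta_quotE -(t2 x tau ht) (Delta_inv ht).
have -> : herm_val Delta_lat x (- tau^-1) 1 = tau ^+ 12 * herm_val Delta_lat x (-1) tau.
  rewrite /herm_val -(Delta_lat_scale _ _ t0).
  move: ((ha x)%:R : C) ((hb x)%:R : C) ((hd x)%:R : C) => a b d.
  have -> : (a * -1 + b * tau) / tau = a * - tau^-1 + b * 1 by field.
  by have -> : d * tau / tau = d * 1 by field.
exact: mulf_cancelX t0.
Qed.

Lemma permuted_modular_sum (I : finType) (F : I -> C -> C) : permuted F ->
  modular (fun tau => \sum_i F i tau).
Proof.
move=> [[s s1 s2] [t t1 t2]] tau ht; split.
  by rewrite [RHS](reindex_inj s1); apply: eq_bigr => i _; exact: s2.
by rewrite [RHS](reindex_inj t1); apply: eq_bigr => i _; exact: t2.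
Qed.

Lemma permuted_modular_prod (I : finType) (F : I -> C -> C) : permuted F ->
  modular (fun tau => \prod_i F i tau).
Proof.
move=> [[s s1 s2] [t t1 t2]] tau ht; split.
  by rewrite [RHS](reindex_inj s1); apply: eq_bigr => i _; exact: s2.
by rewrite [RHS](reindex_inj t1); apply: eq_bigr => i _; exact: t2.
Qed.

Lemma permuted_modular_coef (I : finType) (F : I -> C -> C) k : permuted F ->
  modular (fun tau => (\prod_i ('X - (F i tau)%:P))`_k).
Proof.
move=> [[s s1 s2] [t t1 t2]] tau ht; split; congr (_ _ k).
  by rewrite [in RHS](reindex_inj s1); congr polyseq; apply: eq_bigr => i _; rewrite s2.
by rewrite [in RHS](reindex_inj t1); congr polyseq; apply: eq_bigr => i _; rewrite t2.
Qed.

Lemma permutedB (I : finType) J (F : I -> C -> C) : modular J -> permuted F ->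
  permuted (fun i tau => J tau - F i tau).
Proof.
move=> mJ [[s s1 s2] [t t1 t2]].
split; [exists s => //|exists t => //] => x tau ht; have [h1 h2] := mJ _ ht.
  by rewrite h1 s2.
by rewrite h2 t2.
Qed.

Lemma iqexp_coef_prod (I : Type) (r : seq I) (F : I -> C -> C) N m k :
  (forall i, exists c, iqexp N m c (F i)) ->
  exists c, iqexp N (size r * m) c (fun tau => (\prod_(i <- r) ('X - (F i tau)%:P))`_k).
Proof.
move=> hF; elim: r k => [|i r IH] k.
  exists ((k == 0%N)%:R); rewrite mul0n.
  apply: iqexp_ext (iqexp_cst N (alg_integer_nat R (k == 0%N))) => tau _.
  by rewrite big_nil coef1.
have [c hc] := hF i; have [e he] := IH k.
have := iqexpM hc he; rewrite -mulSn => h1.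
have := iqexpZ (alg_integerN (alg_integer1 R)) h1 => h2.
have [e' he'] : exists e', iqexp N ((size r).+1 * m) e'
    (fun tau => if k == 0%N then 0 else (\prod_(i <- r) ('X - (F i tau)%:P))`_k.-1).
  case: (k) => [|j]; first by exists 0; exact: iqexp0.
  have [e1 he1] := IH j; exists (if m == 0%N then e1 else 0).
  by rewrite mulSn addnC; exact: (iqexp_shift m he1).
exists (e' + -1 * (c * e)); apply: iqexp_ext (iqexpD he' h2) => tau _.
by rewrite big_cons mulrBl coefB coefXM coefCM mulN1r.
Qed.

(** [F i tau] is a root of the monic product of the X - F_j(tau). Its coefficients are modular with
    integral expansions, hence integral polynomials in [J tau]. *)
Lemma permuted_alg_integer (I : finType) (F : I -> C -> C) J N m tau : (0 < N)%N ->
  modular J -> iqexp 1 1 1 J -> alg_integer (J tau) ->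
  permuted F -> (forall i, exists c, iqexp N m c (F i)) ->
  0 < complex.Im tau -> forall i, alg_integer (F i tau).
Proof.
move=> N0 mJ hJ aJ hF eF ht i.
apply: (@alg_integer_root_monic _ _ (\prod_i ('X - (F i tau)%:P))).
- by apply: monic_prod => j _; exact: monicXsubC.
- by rewrite rootE horner_prod (bigD1 i) //= !hornerE subrr mul0r.
move=> k; have mk := permuted_modular_coef k hF.
have [c hc] := iqexp_coef_prod (index_enum I) k eF.
set M := (_ * m)%N in hc; have := iqexp_shift (N * M - M) hc.
rewrite subnKC ?leq_pmull // => h1.
have h2 := iqexp_descend N0 (fun t ht => proj1 (mk t ht)) h1.
have [P [P1 _ _ P4]] := modular_poly mJ hJ mk h2.
rewrite P4 // horner_coef; apply: alg_integer_sum => j.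
by apply: alg_integerM => //; exact: alg_integerX.
Qed.

End Hecke.

(** * The function J and its integrality at CM points *)

Section Hauptmodul.
Variable R : realType.
Local Notation C := R[i].
Implicit Types (F J : C -> C) (tau : C) (n : nat).

Lemma Delta_quot_def n (x : herm n) tau : Delta_quot x tau =
  (hd x)%:R ^+ 12 * Delta tau / Delta (((ha x)%:R * tau + (hb x)%:R) / (hd x)%:R).
Proof. by []. Qed.

Local Opaque Delta_quot.

Lemma iqexp_herm n (x : herm n) m : (0 < n)%N -> (ha x * ha x <= m + n)%N ->
  iqexp n m (if (m + n == ha x * ha x)%N then (hd x)%:R ^+ 12 * (ce ((hb x)%:R / (hd x)%:R))^-1 else 0)
    (Delta_quot x : C -> C).
Proof.
move=> n0; have [a0 d0] := herm_pos x n0.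
have := @iqexp_Delta_quot R (ha x) (hb x) (hd x) m a0 d0.
rewrite herm_det => h hm; apply: iqexp_ext (h hm) => tau _; exact: esym (Delta_quot_def _ _).
Qed.

(* The q-expansion of [hecke2] is q^-1 + ..., so it plays the role of the j-invariant. *)
Definition hecke2 tau : C := \sum_(x : herm 2) Delta_quot x tau.

Lemma hecke2_modular : modular hecke2.
Proof. by apply: permuted_modular_sum; exact: Delta_quot_permuted. Qed.

(** In x = q^(1/2) only the matrix a = 2, d = 1 has a pole, x^-2 = q^-1 with coefficient 1; those
    with a = 1, d = 2 start at x. *)
Lemma hecke2_iqexp : iqexp 1 1 1 hecke2.
Proof.
apply: (@iqexp_descend R 2 1 1 hecke2 isT (fun tau ht => proj1 (hecke2_modular ht))).
have [x0 [a0 b0 d0]] := @herm_ex 2 2 0 1 isT erefl isT.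
have a2 (x : herm 2) : (ha x * ha x <= 2 + 2)%N.
  by have := herm_det x; have := herm_lt x; nia.
have x0P (x : herm 2) : ha x = 2%N -> x = x0.
  move=> ax; apply: herm_inj; have := herm_det x; have := herm_lt x; lia.
pose c (x : herm 2) : C := if (2 + 2 == ha x * ha x)%N then (hd x)%:R ^+ 12 * (ce ((hb x)%:R / (hd x)%:R))^-1 else 0.
have := @iqexp_sum R (herm 2) (index_enum _) 2 2 c (fun x => Delta_quot x) (fun x => @iqexp_herm 2 x 2 isT (a2 x)).
have -> : \sum_(x <- index_enum (herm 2)) c x = 1.
  rewrite (bigD1 x0) //= big1 ?addr0; last first.
    move=> x /eqP xx0; rewrite /c; case: eqP => // e; case: xx0; apply: x0P.
    by have := e; nia.
  by rewrite /c a0 b0 d0 /= mul0r ce0 invr1 expr1n mulr1.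
by [].
Qed.

Local Opaque hecke2.

(* The norm [G] of [J tau - J (M tau)] over the matrices [M] of determinant [n]
   vanishes at the CM point. As [n] is not a square, each factor has a leading
   coefficient which is a root of unity up to sign, so that [G ^+ n = P.[J]]
   with [lead_coef P] a unit. *)
Lemma alg_integer_hecke2 tau (A B D E : int) n : 0 < complex.Im tau ->
  (forall k : nat, (k * k)%N != n) -> A * E - B * D = n ->
  A%:~R * tau + B%:~R = tau * (D%:~R * tau + E%:~R) -> alg_integer (hecke2 tau).
Proof.
move=> ht nsq det cm.
have n0 : (0 < n)%N by rewrite lt0n eq_sym -(muln0 0); exact: nsq.
have mJ := hecke2_modular; have hJ := hecke2_iqexp.
pose T (x : herm n) t := hecke2 (((ha x)%:R * t + (hb x)%:R) / (hd x)%:R).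
pose G t := \prod_(x : herm n) (hecke2 t - T x t).
have mG : modular G.
  by apply: permuted_modular_prod; apply: permutedB => //; exact: modular_permuted.
have mGn : modular (fun t => G t ^+ n).
  by move=> t h; have [-> ->] := mG t h.
have hT (x : herm n) : exists mc : nat * C, [/\ iqexp n mc.1 mc.2 (fun t => hecke2 t - T x t),
    mc.2 != 0 & alg_integer mc.2^-1].
  have [a0 d0] := herm_pos x n0; set z : C := ce ((hb x)%:R / (hd x)%:R).
  have h1 : iqexp n n 1 hecke2 by have := iqexp_level n0 hJ; rewrite muln1.
  have := iqexpZ (alg_integerN (alg_integer1 R)) (iqexp_affine (hb x) a0 d0 hJ).
  rewrite -/z muln1 expr1 mulr1 herm_det => h2.
  (* In x = q^(1/n), J(t) has a pole of order n and J(Mt) one of order a^2. The larger order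
     supplies the leading coefficient, 1 or minus a root of unity; equal orders could cancel. *)
  have [lt|gt|e] := ltngtP (ha x * ha x)%N n; last by have := nsq (ha x); rewrite e eqxx.
    exists (n, 1); split; rewrite /= ?invr1 ?oner_eq0 //; last exact: alg_integer1.
    have := iqexp_shift (n - ha x * ha x) h2; rewrite subnKC ?(ltnW lt) // gtn_eqF ?subn_gt0 //.
    move=> h3; have := iqexpD h1 h3; rewrite addr0.
    by apply: iqexp_ext => t _; rewrite mulN1r.
  exists ((ha x * ha x)%N, - z^-1); split => /=.
  - have := iqexp_shift (ha x * ha x - n) h1; rewrite subnKC ?(ltnW gt) // gtn_eqF ?subn_gt0 //.
    move=> h3; have := iqexpD h3 h2; rewrite add0r mulN1r.
    by apply: iqexp_ext => t _; rewrite mulN1r.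
  - by rewrite oppr_eq0 invr_eq0 ce_neq0.
  by rewrite invrN invrK; apply: alg_integerN; exact: alg_integer_ce_frac.
have [mc hmc] := boolp.choice hT.
have hmc1 x : iqexp n (mc x).1 (mc x).2 (fun t => hecke2 t - T x t) by case: (hmc x).
(* The n-th power makes the pole order divisible by [n], as the descent requires; padding the bound
   would lose the leading coefficient. *)
have hG := iqexpX n (iqexp_prod (index_enum (herm n)) hmc1).
set M := (\sum_(x <- _) _)%N in hG; set c := \prod_(x <- _) _ in hG.
have c0 : c ^+ n != 0.
  by rewrite expf_neq0 // /c prodf_seq_neq0; apply/allP => x _; case: (hmc x).
have cV : alg_integer (c ^+ n)^-1.
  rewrite -exprVn; apply: alg_integerX; rewrite /c -prodfV.
  elim/big_ind: _ => [|u v|x _]; [exact: alg_integer1|exact: alg_integerM|by case: (hmc x)].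
have hG1 := iqexp_descend n0 (fun t ht => proj1 (mGn t ht)) hG.
have [P [P1 P2 P3 P4]] := modular_poly mJ hJ mGn hG1.
(* The CM matrix fixes tau, and its Hermite form [x] differs from it by SL_2(Z), so the factor of
   [x] in [G] is J(tau) - J(tau). *)
have G0 : G tau = 0.
  have [a [d [b [e1 e2 [p [q [r [s [h1 h2 h3 h4 h5]]]]]]]]] := hermite_form n0 det.
  have [x [xa xb xd]] := herm_ex n0 e1 e2.
  rewrite /G (bigD1 x) //= [X in X * _](_ : _ = 0) ?mul0r //.
  apply/eqP; rewrite subr_eq0; apply/eqP; rewrite /T xa xb xd.
  have [a0 d0] := herm_pos x n0; rewrite xa xd in a0 d0.
  have him := Im_affine b a0 d0 ht.
  have := lattice_fun_sl2 (modular_lattice mJ) h1 him.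
  have -> : p%:~R * (a%:R * tau + b%:R) + q%:~R * d%:R = A%:~R * tau + B%:~R.
    by rewrite h2 h3 !rmorphD !rmorphM /=; ring.
  have -> : r%:~R * (a%:R * tau + b%:R) + s%:~R * d%:R = D%:~R * tau + E%:~R.
    by rewrite h4 h5 !rmorphD !rmorphM /=; ring.
  rewrite cm mulfK //; apply: lattice_neq0 => //.
  rewrite -negb_and; apply/negP => /andP[/eqP D0 /eqP E0].
  by move: det; rewrite D0 E0 !mulr0 subrr; lia.
have Pm : lead_coef P = c ^+ n.
  rewrite lead_coefE -P3; congr P`_ _.
  have : (M < size P)%N by rewrite ltnNge; apply/negP => h; move: c0; rewrite -P3 nth_default ?eqxx.
  by move: P2; lia.
apply: (@alg_integer_root_monic _ _ ((c ^+ n)^-1 *: P)).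
- by rewrite monicE lead_coefZ Pm mulVf.
- by rewrite rootE hornerZ -P4 // G0 expr0n gtn_eqF // mulr0.
by move=> k; rewrite coefZ; exact: alg_integerM.
Qed.

Lemma alg_integer_Delta_quot tau n (x : herm n) : (0 < n)%N -> 0 < complex.Im tau ->
  alg_integer (hecke2 tau) -> alg_integer (Delta_quot x tau).
Proof.
move=> n0 ht hJ.
apply: (@permuted_alg_integer _ _ (@Delta_quot R n) _ n (n * n) tau n0 hecke2_modular hecke2_iqexp hJ) => //.
  exact: Delta_quot_permuted.
move=> y; have [_ d0] := herm_pos y n0.
have ay : (ha y <= n)%N by have := leq_pmulr (ha y) d0; rewrite herm_det.
have h : (ha y * ha y <= n * n + n)%N by rewrite (leq_trans (leq_mul ay ay)) ?leq_addr.
by eexists; exact: iqexp_herm n0 h.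
Qed.

Lemma alg_integer_Delta_div tau (p : nat) : (0 < p)%N -> 0 < complex.Im tau ->
  alg_integer (hecke2 tau) -> alg_integer (Delta tau / Delta (p%:R * tau)).
Proof.
move=> p0 ht hJ; have [x [xa xb xd]] := @herm_ex p p 0 1 p0 (muln1 p) isT.
have := alg_integer_Delta_quot x p0 ht hJ; rewrite Delta_quot_def xa xb xd.
by rewrite addr0 divr1 expr1n mul1r.
Qed.

(** The matrix a = 1, d = p, applied at p tau, leads back to tau with d^12 = p^12; hence the
    integrality of [hecke2] is asked at p tau. *)
Lemma alg_integer_Delta_mul tau (p : nat) : (0 < p)%N -> 0 < complex.Im tau ->
  alg_integer (hecke2 (p%:R * tau)) -> alg_integer (p%:R ^+ 12 * (Delta (p%:R * tau) / Delta tau)).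
Proof.
move=> p0 ht hJ; have [x [xa xb xd]] := @herm_ex p 1 0 p p0 (mul1n p) p0.
have ht' : 0 < complex.Im (p%:R * tau).
  by have := Im_affine 0 p0 (isT : (0 < 1)%N) ht; rewrite divr1 addr0.
have := alg_integer_Delta_quot x p0 ht' hJ; rewrite Delta_quot_def xa xb xd.
have -> : (1 * (p%:R * tau) + 0) / p%:R = tau.
  by rewrite mul1r addr0 mulrAC divff ?mul1r // pnatr_eq0 -lt0n.
by rewrite mulrA.
Qed.

End Hauptmodul.

(** * Eta quotients at imaginary quadratic points *)

(** Here a_k stands for the product of the 1 - q^(k + 10n), [u] for q^(1/4) and [v] for q^(1/2). The
    groups on the right are the Euler products in q^2, q^5, q^10 and q. *)
Lemma U_identity (K : fieldType) (u v a1 a2 a3 a4 a5 a6 a7 a8 a9 a10 : K) :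
  u != 0 -> v != 0 -> a10 != 0 -> a9 != 0 -> a8 != 0 -> a7 != 0 -> a6 != 0 -> a5 != 0 ->
  a4 != 0 -> a3 != 0 -> a2 != 0 -> a1 != 0 ->
  (u * v * (a1 * a9) / (a4 * a6) / (u * (a2 * a8) / (a3 * a7)))^-1 =
  v^-1 * ((a2 * a4 * a6 * a8 * a10) ^+ 2 * (a5 * a10) /
    (a10 ^+ 2 * (a1 * a2 * a3 * a4 * a5 * a6 * a7 * a8 * a9 * a10))).
Proof.
move=> h1 h2 h3 h4 h5 h6 h7 h8 h9 h10 h11 h12.
by field; rewrite ?h1 ?h2 ?h3 ?h4 ?h5 ?h6 ?h7 ?h8 ?h9 ?h10 ?h11 ?h12.
Qed.

Lemma eta_quotient_pow12 (K : fieldType) (x y z w : K) :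
  ((y ^+ 2 * z ^+ 4 / (x ^+ 4 * w ^+ 2))^-1) ^+ 12 =
  (x ^+ 24) ^+ 2 * w ^+ 24 / (y ^+ 24 * (z ^+ 24) ^+ 2).
Proof.
rewrite invf_div expr_div_n (exprMn 12 (x ^+ 4)) (exprMn 12 (y ^+ 2)) -!exprM.
by rewrite -[(4 * 12)%N]/(24 * 2)%N -[(2 * 12)%N]/24%N.
Qed.

(** The powers of q needed to complete Euler products to Delta balance: 4 + 5 - 20 - 1 = -12, the
    exponent of q in v^-24. *)
Lemma U_quotient_pow24 (K : fieldType) (v q a b c d : K) : v != 0 -> v ^+ 2 = q ->
  c != 0 -> d != 0 ->
  (v^-1 * (a ^+ 2 * b / (c ^+ 2 * d))) ^+ 24 =
  (q ^+ 2 * a ^+ 24) ^+ 2 * (q ^+ 5 * b ^+ 24) / ((q ^+ 10 * c ^+ 24) ^+ 2 * (q ^+ 1 * d ^+ 24)).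
Proof.
move=> v0 vq c0 d0; have q0 : q != 0 by rewrite -vq expf_neq0.
have v24 : v ^+ 24 = q ^+ 12 by rewrite -vq -exprM.
rewrite exprMn expr_div_n exprVn v24 (exprMn 24 (a ^+ 2)) (exprMn 24 (c ^+ 2)).
rewrite -(exprM a) -(exprM c) [(2 * 24)%N]mulnC (exprM a) (exprM c).
move: (a ^+ 24) (b ^+ 24) (c ^+ 24) (d ^+ 24) (expf_neq0 24 c0) (expf_neq0 24 d0).
by move=> A B D E D0 E0; field; rewrite q0 D0 E0.
Qed.

Section EtaQuotients.
Variable R : realType.
Local Notation C := R[i].
Implicit Types (q tau : C) (k m K n : nat).

Definition aprod q k m K : C := \prod_(n < K) (1 - q ^+ (k + m * n)).

Lemma aprod_bound q k m : cmod q < 1 -> (0 < m)%N ->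
  forall n, cmod (- q ^+ (k + m * n)) <= cmod q ^+ n.
Proof.
move=> q1 m0 n; rewrite cmodN cmodX ler_wiXn2l ?cmod_ge0 ?ltW //.
by rewrite (leq_trans (leq_pmull n m0)) // leq_addl.
Qed.

Lemma aprod_lim q k m : cmod q < 1 -> (0 < m)%N -> clim (aprod q k m) (climn (aprod q k m)).
Proof.
move=> q1 m0; have sg := @summable_geom R (cmod q); rewrite cmod_ge0 q1 in sg.
by have [l hl] := prod_cvg (aprod_bound k q1 m0) (sg isT); rewrite (climn_clim hl).
Qed.

Lemma aprod_lim_neq0 q k m : cmod q < 1 -> (0 < k)%N -> (0 < m)%N -> climn (aprod q k m) != 0.
Proof.
move=> q1 k0 m0; have sg := @summable_geom R (cmod q); rewrite cmod_ge0 q1 in sg.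
apply: (prod_lim_neq0 (aprod_bound k q1 m0) (sg isT)) (aprod_lim k q1 m0) => n.
by rewrite -(prednK (_ : 0 < k + m * n)%N) ?addn_gt0 ?k0 // one_subX_neq0.
Qed.

Lemma qprod_split q a m K :
  qprod (q ^+ a) (m * K) = \prod_(k < m) aprod q (a * k.+1) (a * m) K.
Proof.
rewrite /qprod /aprod; elim: K => [|K IH].
  by rewrite muln0 big_ord0 big1 // => k _; rewrite big_ord0.
rewrite mulnSr big_split_ord /= IH -big_split /=; apply: eq_bigr => k _.
rewrite big_ord_recr /=; congr (_ * (1 - _)); rewrite -exprM; congr (_ ^+ _); lia.
Qed.

Lemma euler_split q a m : cmod q < 1 -> (0 < a)%N -> (0 < m)%N ->
  euler (q ^+ a) = \prod_(k < m) climn (aprod q (a * k.+1) (a * m)).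
Proof.
move=> q1 a0 m0; have am0 : (0 < a * m)%N by rewrite muln_gt0 a0.
have qa1 : cmod (q ^+ a) < 1.
  by rewrite cmodX exprn_ilt1 ?cmod_ge0 -?lt0n.
have h1 := clim_sub (fun n => leq_pmull n m0) (euler_lim qa1).
apply: clim_uniq h1 _; apply: clim_ext => [K|]; first exact: esym (qprod_split _ _ _ _).
by apply: clim_prod => k; exact: aprod_lim.
Qed.

Lemma qpowE tau (r : rat) : qpow tau r = ce (ratr r * tau).
Proof. by rewrite /qpow /ce; congr cexp; ring. Qed.

Lemma qpochE tau k m : qpoch tau k%:R m%:R = climn (aprod (ce tau) k m).
Proof.
rewrite /qpoch /aprod; congr climn; apply: boolp.funext => N; apply: eq_bigr => n _.
by rewrite qpowE -natrM -natrD ratr_nat ceMn.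
Qed.

Lemma eta_pow24 tau : Defs.eta tau ^+ 24 = Delta tau.
Proof.
have e1 : qpow tau (1 / 24%:R) ^+ 24 = ce tau.
  rewrite qpowE -ceMn; congr ce; rewrite rmorphM fmorphV rmorph1 rmorph_nat.
  by rewrite mulrA div1r mulfV ?mul1r // pnatr_eq0.
have e2 : qpoch tau 1 1 = euler (ce tau).
  rewrite (qpochE tau 1 1) /euler; congr climn; apply: boolp.funext => N.
  by apply: eq_bigr => n _; rewrite mul1n.
rewrite /Defs.eta e2; apply: (etrans (exprMn _ _ _)); apply: (etrans _ (esym (DeltaE tau))).
exact: (congr1 (fun z => z * euler (ce tau) ^+ 24) e1).
Qed.

Lemma invUfunE tau : 0 < complex.Im tau -> let E k := euler (ce tau ^+ k) in
  (Ufun tau)^-1 = (ce (tau / 2))^-1 * (E 2%N ^+ 2 * E 5%N / (E 10%N ^+ 2 * E 1%N)).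
Proof.
move=> ht /=; have q1 := cmod_ce_lt1 ht; set q := ce tau in q1 *.
pose L k := climn (aprod q k 10).
have L0 k : (0 < k)%N -> L k != 0 by move=> k0; exact: aprod_lim_neq0.
have -> : euler (q ^+ 1) = L 1%N * L 2%N * L 3%N * L 4%N * L 5%N * L 6%N * L 7%N * L 8%N * L 9%N * L 10%N.
  by rewrite (@euler_split q 1 10) // !big_ord_recr big_ord0 /= !mul1n mul1r.
have -> : euler (q ^+ 2) = L 2%N * L 4%N * L 6%N * L 8%N * L 10%N.
  by rewrite (@euler_split q 2 5) // !big_ord_recr big_ord0 /= mul1r.
have -> : euler (q ^+ 5) = L 5%N * L 10%N.
  by rewrite (@euler_split q 5 2) // !big_ord_recr big_ord0 /= mul1r.
have -> : euler (q ^+ 10) = L 10%N.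
  by rewrite (@euler_split q 10 1) // !big_ord_recr big_ord0 /= mul1r.
rewrite /Ufun /Ifun /Jfun !qpowE.
rewrite (qpochE tau 1 10) (qpochE tau 2 10) (qpochE tau 3 10) (qpochE tau 4 10)
  (qpochE tau 6 10) (qpochE tau 7 10) (qpochE tau 8 10) (qpochE tau 9 10) -/q -!/(L _).
have e1 : ce (ratr (3%:R / 4%:R) * tau) = ce (ratr (1 / 4%:R) * tau) * ce (tau / 2).
  rewrite -ceD; congr ce; rewrite !rmorphM !fmorphV !rmorph_nat rmorph1.
  by field.
rewrite e1; move: (ce_neq0 (ratr (1 / 4%:R) * tau)) (ce_neq0 (tau / 2)).
move: (ce _) (ce _) => u v u0 v0.
have := L0 1%N isT; have := L0 2%N isT; have := L0 3%N isT; have := L0 4%N isT.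
have := L0 5%N isT; have := L0 6%N isT; have := L0 7%N isT; have := L0 8%N isT.
have := L0 9%N isT; have := L0 10%N isT; move: u0 v0.
move: (L 1%N) (L 2%N) (L 3%N) (L 4%N) (L 5%N) (L 6%N) (L 7%N) (L 8%N) (L 9%N) (L 10%N).
move: v u; exact: U_identity.
Qed.

End EtaQuotients.

Lemma common_denominator (K : fieldType) (u a v b s : K) : a != 0 -> b != 0 ->
  a * b * (u / a + v / b * s) = u * b + v * a * s.
Proof. by move=> a0 b0; field; rewrite a0 b0. Qed.

(** * Quadratic points and the two Delta quotients *)

Section ImaginaryQuadratic.
Variable R : realType.
Local Notation C := R[i].
Implicit Types (tau : C).

Lemma Im_ratr (x : rat) : complex.Im (ratr x : C) = 0.
Proof. by rewrite -(fmorph_rat (real_complex R)). Qed.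

Lemma sqr_sqrt_neg (d : int) : d < 0 -> sqrt_neg R d ^+ 2 = d%:~R.
Proof.
move=> d0; rewrite /sqrt_neg exprMn sqr_i -rmorphXn /= sqr_sqrtr; last first.
  by rewrite oppr_ge0 lerz0 ltW.
by rewrite rmorphN mulN1r opprK rmorph_int.
Qed.

(** [N * tau = x1 + y1 * s] satisfies an integral quadratic equation, which yields a trace-zero
    integral matrix fixing tau, with rows (N x1, -(x1^2 - y1^2 d)) and (N^2, -N x1), of determinant
    e > 0. *)
Lemma alg_integer_hecke2_quadratic (d : int) (x y : rat) : d < 0 ->
  0 < complex.Im (ratr x + ratr y * sqrt_neg R d) ->
  alg_integer (hecke2 (ratr x + ratr y * sqrt_neg R d)).
Proof.
move=> d0 ht; have y0 : y != 0.
  by apply/eqP => e; move: ht; rewrite e rmorph0 mul0r addr0 Im_ratr ltxx.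
pose N := denq x * denq y; pose x1 := numq x * denq y; pose y1 := numq y * denq x.
have N0 : 0 < N by rewrite mulr_gt0 ?denq_gt0.
have y10 : y1 != 0 by rewrite mulf_neq0 ?numq_eq0 ?denq_eq0.
have neg : N ^+ 2 * y1 ^+ 2 * d < 0.
  by rewrite pmulr_rlt0 // mulr_gt0 ?exprn_even_gt0 //= gt_eqF.
pose e := absz (N ^+ 2 * y1 ^+ 2 * d).
have eE : e%:Z = - (N ^+ 2 * y1 ^+ 2 * d).
  by rewrite /e abszE ltr0_norm.
have e0 : (0 < e)%N by rewrite absz_gt0 lt_eqF.
(* Adding e times the identity keeps the fixed point and makes the determinant e^2 + e, strictly
   between the squares of e and e + 1. *)
apply: (@alg_integer_hecke2 _ _ (e%:Z + N * x1) (- (x1 ^+ 2 - y1 ^+ 2 * d)) (N ^+ 2)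
  (e%:Z - N * x1) (e * e + e) ht).
- move=> k; have [ke|ek] := leqP k e; last by have := leq_mul ek ek; lia.
  by have := leq_mul ke ke; lia.
- transitivity (e%:Z * e%:Z - N ^+ 2 * y1 ^+ 2 * d); first by ring.
  by rewrite -eE PoszD PoszM.
have s2 := sqr_sqrt_neg d0; move: (sqrt_neg R d) s2 => s s2.
have dx0 : ((denq x)%:~R : C) != 0 by rewrite intr_eq0 denq_eq0.
have dy0 : ((denq y)%:~R : C) != 0 by rewrite intr_eq0 denq_eq0.
set tau := ratr x + ratr y * s.
have hN : N%:~R * tau = x1%:~R + y1%:~R * s.
  rewrite /tau /ratr /N /x1 /y1 !rmorphM /=.
  exact: common_denominator.
have h2 : N%:~R ^+ 2 * tau ^+ 2 = x1%:~R ^+ 2 + 2 * x1%:~R * y1%:~R * s + y1%:~R ^+ 2 * d%:~R.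
  by rewrite -exprMn hN -s2; ring.
clearbody e tau N x1 y1; rewrite !(rmorphD, rmorphN, rmorphB, rmorphM, rmorphXn) /=.
have -> : tau * (N%:~R ^+ 2 * tau + (e%:~R - N%:~R * x1%:~R)) =
  N%:~R ^+ 2 * tau ^+ 2 + e%:~R * tau - x1%:~R * (N%:~R * tau) by ring.
have -> : (e%:~R + N%:~R * x1%:~R) * tau = e%:~R * tau + x1%:~R * (N%:~R * tau) by ring.
by rewrite h2 hN; ring.
Qed.

Lemma alg_integer_coprimeX (z : C) (m n k : nat) : coprime m n ->
  alg_integer (m%:R ^+ k * z) -> alg_integer (n%:R ^+ k * z) -> alg_integer z.
Proof.
move=> cmn; rewrite -!natrX; apply: alg_integer_coprime.
by rewrite coprimeXl // coprimeXr.
Qed.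

(** For instance D1^2 D10 / (D2 D5^2) is (D1/D2)(D1/D5)(D10/D5) and also (D1/D5)^2 (D10/D2): the
    inverted ratio is along 2 in the first form and along 5 in the second. *)
Lemma alg_integer_eta_quotients tau :
  (forall k : nat, (0 < k)%N -> 0 < complex.Im (k%:R * tau) /\ alg_integer (hecke2 (k%:R * tau))) ->
  let D k := Delta (k%:R * tau) in
  alg_integer (D 1%N ^+ 2 * D 10%N / (D 2%N * D 5%N ^+ 2)) /\
  alg_integer (D 2%N ^+ 2 * D 5%N / (D 10%N ^+ 2 * D 1%N)).
Proof.
move=> h D.
have D0 k : (0 < k)%N -> D k != 0 by move=> /h[ht _]; exact: Delta_neq0.
have Dm p k : Delta (p%:R * (k%:R * tau)) = D (p * k)%N by rewrite mulrA -natrM.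
have hdiv p k : (0 < p)%N -> (0 < k)%N -> alg_integer (D k / D (p * k)%N).
  by move=> p0 /h[ht hJ]; have := alg_integer_Delta_div p0 ht hJ; rewrite Dm.
have hmul p k : (0 < p)%N -> (0 < k)%N -> alg_integer (p%:R ^+ 12 * (D (p * k)%N / D k)).
  move=> p0 k0; have [ht _] := h _ k0.
  have [_ hJ] := h (p * k)%N (etrans (muln_gt0 _ _) (introT andP (conj p0 k0))).
  by move: hJ; rewrite natrM -mulrA => /(alg_integer_Delta_mul p0 ht); rewrite Dm.
have := D0 1%N isT; have := D0 2%N isT; have := D0 5%N isT; have := D0 10%N isT.
have := hdiv 2%N 1%N isT isT; have := hdiv 5%N 1%N isT isT.
have := hdiv 5%N 2%N isT isT; have := hdiv 2%N 5%N isT isT.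
have := hmul 2%N 1%N isT isT; have := hmul 5%N 1%N isT isT.
have := hmul 5%N 2%N isT isT; have := hmul 2%N 5%N isT isT.
rewrite !muln1 -[(2 * 5)%N]/10%N -[(5 * 2)%N]/10%N.
move: (D 1%N) (D 2%N) (D 5%N) (D 10%N) => d1 d2 d5 d10.
move: (2%:R ^+ 12 : C) (5%:R ^+ 12 : C) (fun z => @alg_integer_coprimeX z 2 5 12 isT).
move=> c2 c5 cop m1 m2 m3 m4 v1 v2 v3 v4 n10 n5 n2 n1; split; apply: cop.
- have -> : c2 * (d1 ^+ 2 * d10 / (d2 * d5 ^+ 2)) = (d1 / d2) * (d1 / d5) * (c2 * (d10 / d5)).
    by field; rewrite n2 n5.
  exact: (alg_integerM (alg_integerM v4 v3) m1).
- have -> : c5 * (d1 ^+ 2 * d10 / (d2 * d5 ^+ 2)) = (d1 / d5) * (d1 / d5) * (c5 * (d10 / d2)).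
    by field; rewrite n2 n5.
  exact: (alg_integerM (alg_integerM v3 v3) m2).
- have -> : c2 * (d2 ^+ 2 * d5 / (d10 ^+ 2 * d1)) = (d5 / d10) * (d2 / d10) * (c2 * (d2 / d1)).
    by field; rewrite n1 n10.
  exact: (alg_integerM (alg_integerM v1 v2) m4).
have -> : c5 * (d2 ^+ 2 * d5 / (d10 ^+ 2 * d1)) = (d2 / d10) * (d2 / d10) * (c5 * (d5 / d1)).
  by field; rewrite n1 n10.
exact: (alg_integerM (alg_integerM v2 v2) m3).
Qed.

End ImaginaryQuadratic.

Theorem theorem5p3 (R : realType) (d : int) (x y : rat) :
  d < 0 ->
  0 < complex.Im (ratr x + ratr y * sqrt_neg R d) ->
  let tau : R[i] := ratr x + ratr y * sqrt_neg R d in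
  alg_integer (gfun tau)^-1 /\ alg_integer (Ufun tau)^-1.
Proof.
move=> d0 ht tau.
(* A multiple of tau is again a quadratic point for the same [d], with [x] and [y] scaled by [k]. *)
have cm (k : nat) : (0 < k)%N ->
    0 < complex.Im (k%:R * tau) /\ alg_integer (hecke2 (k%:R * tau)).
  move=> k0; have hk : 0 < complex.Im (k%:R * tau).
    by have := Im_affine 0 k0 (isT : (0 < 1)%N) ht; rewrite divr1 addr0.
  split => //; have e : k%:R * tau = ratr (k%:R * x) + ratr (k%:R * y) * sqrt_neg R d.
      rewrite /tau mulrDr (mulrA _ (ratr y)).
    have -> : ratr (k%:R * x) = k%:R * ratr x :> R[i] by rewrite rmorphM rmorph_nat.
    by have -> : ratr (k%:R * y) = k%:R * ratr y :> R[i] by rewrite rmorphM rmorph_nat.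
  by rewrite e; apply: alg_integer_hecke2_quadratic => //; rewrite -e.
have [hg hU] := alg_integer_eta_quotients cm; rewrite !mul1r in hg hU.
split.
  apply: (@alg_integer_root _ _ 12 isT).
  have := eta_quotient_pow12 (Defs.eta tau) (Defs.eta (2%:R * tau))
    (Defs.eta (5%:R * tau)) (Defs.eta (10%:R * tau)).
  rewrite (eta_pow24 tau) (eta_pow24 (2%:R * tau)) (eta_pow24 (5%:R * tau)) (eta_pow24 (10%:R * tau)).
  by rewrite /gfun => ->.
apply: (@alg_integer_root _ _ 24 isT); rewrite (invUfunE ht).
have q1 := cmod_ce_lt1 ht.
have E0 (k : nat) : (0 < k)%N -> euler (ce tau ^+ k) != 0.
  by move=> k0; apply: euler_neq0; rewrite cmodX exprn_ilt1 ?cmod_ge0 -?lt0n.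
have e2 : ce (tau / 2) ^+ 2 = ce tau by rewrite -ceMn mulrC divfK // pnatr_eq0.
rewrite (U_quotient_pow24 _ _ (ce_neq0 _) e2 (E0 10%N isT) (E0 1%N isT)).
by move: hU; rewrite !DeltaE !ceMn -/tau !expr1.
Qed.
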